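(* Consider the $K$-user MISO broadcast channel with a random time-varying, symmetric jammer described in the context, and let $\eta_j$ ($j=0,1,\dots,K$) be the probability that exactly $j$ receivers are jammed at a given time. For the CSIT-JSIT configuration $\mathsf{DP}$ (delayed CSIT, perfect JSIT), the sum degrees of freedom $$\sum_{j=0}^{K}\eta_j\,\mathsf{DoF}_{\mathsf{MAT}}(K-j)$$ is achievable, i.e. the degrees-of-freedom region contains a tuple $(d_1,\dots,d_K)$ with $\sum_{k=1}^K d_k$ equal to this value. Here $\mathsf{DoF}_{\mathsf{MAT}}(m)=\dfrac{m}{1+\frac12+\cdots+\frac1m}$ for $m\ge1$ and $\mathsf{DoF}_{\mathsf{MAT}}(0)=0$.
   Context: **Channel.** A transmitter with $K$ antennas sends independent, uniformly distributed messages $W_1,\dots,W_K$ to $K$ single-antenna receivers. At time $t=1,2,\dots$ receiver $k\in\{1,\dots,K\}$ observes $$Y_k(t)=\mathbf H_k(t)\mathbf X(t)+S_k(t)\,\mathbf G_k(t)\mathbf J(t)+N_k(t),$$ where $\mathbf X(t)\in\mathbb C^{K}$ is the channel input, subject to $E|\mathbf X(t)|^2\le P_T$; $\mathbf H_k(t)\in\mathbb C^{1\times K}$ is the channel from transmitter to receiver $k$; $\mathbf G_k(t)\in\mathbb C^{1\times K}$ is the channel from the jammer to receiver $k$; $\mathbf J(t)\in\mathbb C^K$ is the jammer's signal, of power $P_T$ (its distribution is otherwise arbitrary); $N_k(t)\sim\mathcal{CN}(0,1)$ is noise, i.i.d. over time and independent across receivers. The vectors $\mathbf H_k(t)$, $\mathbf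 G_k(t)$ have continuous distributions (i.e. with a density) with identity covariance, not depending on $P_T$, are i.i.d. over time and independent across $k$. The noise, the messages, $\mathbf H$, and the triple $(S,\mathbf J,\mathbf G)$ are mutually independent; arbitrary correlations among $S,\mathbf J,\mathbf G$ are allowed. **Jammer state.** $S(t)=(S_1(t),\dots,S_K(t))\in\{0,1\}^K$ is i.i.d. over time, with distribution $\lambda_{\mathbf s}=\Pr(S(t)=\mathbf s)$ not depending on $P_T$; $S_k(t)=1$ means receiver $k$ is jammed at time $t$ and $S_k(t)=0$ means it is not. The jammer is symmetric: $\lambda_{\mathbf s}=\lambda_{\pi(\mathbf s)}$ for every $\mathbf s\in\{0,1\}^K$ and every permutation $\pi$ of its coordinates. $\eta_j=\Pr(\|S(t)\|_1=j)$, where $\|\mathbf s\|_1$ is the number of ones in $\mathbf s$. **Information at the terminals.** Write $\mathbf H(t)=(\mathbf H_1(t),\dots,\mathbf H_K(t))$, $\mathbf H^{t}=(\mathbf H(1),\dots,\mathbf H(t))$, $S^{t}=(S(1),\dots,S(t))$. All receivers know $\mathbf H^n$ and $S^n$ (for the whole block of length $n$). Nobody knows $\mathbf G$. The transmitter always knows the statistics of $S(t)$. In configuration $\mathsf{DP}$, $\mathbf X(t)$ is a function of $(W_1,\dots,W_K,\mathbf H^{t-1},S^t)$. **DoF region.** For fixed $P_T$, a rate tuple $(R_1,\dots,R_K)$, $R_k=\frac1n\log|W_k|$ ($|W_k|$ the number of values of message $W_k$), is achievable if there are encoders (respecting the configuration and the power constraint) and decoders $g_k^{(n)}(Y_k^n,\mathbf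 H^n,S^n)$ whose error probabilities $\Pr(W_k\ne g_k^{(n)})$ tend to $0$ as $n\to\infty$ for all $k$. The degrees-of-freedom region is the set of all $(d_1,\dots,d_K)$ with $d_k=\lim_{P_T\to\infty}\frac{R_k}{\log P_T}$ for achievable rate tuples $(R_1(P_T),\dots,R_K(P_T))$. *)

(* Defs.v *)
From HB Require Import structures.
From mathcomp Require Import all_boot all_order all_algebra perm.
From mathcomp Require Import all_classical all_reals all_analysis.
From mathcomp Require Import complex.

Set Implicit Arguments.
Unset Strict Implicit.
Unset Printing Implicit Defensive.
Import Order.TTheory GRing.Theory Num.Theory.
Import numFieldNormedType.Exports.
Local Open Scope classical_set_scope.
Local Open Scope complex_scope.
Local Open Scope ring_scope.

(* Neither R[i] nor matrix types carry a measurable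
   structure in the library; they get the product one here, generated by the
   real and imaginary parts, respectively by the entries (so the Borel sets of
   C and of C^(m x n)). *)

HB.instance Definition _ (R : realType) := isPointed.Build R[i] 0.

Section measurable_complex.
Context (R : realType).

Let G : set (set R[i]) := g_sigma_preimageU (@complex.Re R) (@complex.Im R).

Let G0 : G set0. Proof. exact: sigma_algebra0. Qed.
Let GC A : G A -> G (~` A). Proof. exact: sigma_algebraC. Qed.
Let GU (F : (set R[i])^nat) : (forall i, G (F i)) -> G (\bigcup_i F i).
Proof. exact: sigma_algebra_bigcup. Qed.

HB.instance Definition _ :=
  @isMeasurable.Build default_measure_display R[i] G G0 GC GU.
End measurable_complex.

Definition measure_matrix_display : measure_display -> measure_display.
Proof. exact. Qed.

Section measurable_matrix.
Context {d} {T : measurableType d} (m n : nat).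

Let G : set (set 'M[T]_(m, n)) :=
  <<s \bigcup_(ij : 'I_m * 'I_n)
        preimage_set_system setT (fun A : 'M[T]_(m, n) => A ij.1 ij.2)
          measurable >>.

Let G0 : G set0. Proof. exact: sigma_algebra0. Qed.
Let GC A : G A -> G (~` A). Proof. exact: sigma_algebraC. Qed.
Let GU (F : (set 'M[T]_(m, n))^nat) :
  (forall i, G (F i)) -> G (\bigcup_i F i).
Proof. exact: sigma_algebra_bigcup. Qed.

HB.instance Definition _ :=
  @isMeasurable.Build (measure_matrix_display d) 'M[T]_(m, n) G G0 GC GU.
End measurable_matrix.

Section probability_notions.
Context (R : realType) d (T : measurableType d) (P : probability T R).

Definition mutually_independent (I : eqType) (F : I -> set (set T)) : Prop :=
  forall (s : seq I) (A : I -> set T), uniq s ->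
    (forall i, i \in s -> F i (A i)) ->
    P (\bigcap_(i in [set` s]) A i) = (\prod_(i <- s) P (A i))%E.

Definition independent_rvs (I : eqType) d' (E : measurableType d')
    (X : I -> T -> E) : Prop :=
  mutually_independent (fun i => preimage_set_system setT (X i) measurable).

Definition sigma_process (I : Type) d' (E : measurableType d')
    (X : I -> T -> E) : set (set T) :=
  <<s \bigcup_i preimage_set_system setT (X i) measurable >>.

Definition identically_distributed (I : Type) d' (E : measurableType d')
    (X : I -> T -> E) : Prop :=
  forall i j A, measurable A -> P (X i @^-1` A) = P (X j @^-1` A).

Definition sqnorm m n (v : 'M[R[i]]_(m, n)) : R :=
  \sum_(i < m) \sum_(j < n) Normc.normc (v i j) ^+ 2.

Definition cexpectation (X : T -> R[i]) : R[i] :=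
  (\int[P]_w complex.Re (X w)) +i* (\int[P]_w complex.Im (X w)).

(* The second moment is required to be finite, so that the integrals in the
   covariance are genuine (Rintegral is 0 on an infinite integral). *)
Definition identity_covariance n (X : T -> 'rV[R[i]]_n) : Prop :=
  (('E_P[fun w => sqnorm (X w)] < +oo)%E) /\
  (forall i j : 'I_n,
    cexpectation (fun w => (X w 0 i - cexpectation (fun w' => X w' 0 i)) *
                           conjc (X w 0 j - cexpectation (fun w' => X w' 0 j)))
    = (i == j)%:R).

(* Iterated Lebesgue integral over C^n = R^(2n); by Tonelli this is the
   integral for Lebesgue measure on R^(2n) when F is measurable and >= 0,
   which is the only case where it is used. *)
Fixpoint lebesgue_integral_C n : ('rV[R[i]]_n -> \bar R) -> \bar R :=
  match n with
  | 0 => fun F => F 0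
  | n'.+1 => fun F =>
      (\int[lebesgue_measure]_x \int[lebesgue_measure]_y
         lebesgue_integral_C
           (fun v : 'rV[R[i]]_n' => F (row_mx (x +i* y)%:M v : 'rV_(1 + n'))))%E
  end.

Definition has_density n (X : T -> 'rV[R[i]]_n) : Prop :=
  exists f : 'rV[R[i]]_n -> R,
    [/\ measurable_fun setT f, forall v, 0 <= f v &
        forall A, measurable A ->
          P (X @^-1` A) = lebesgue_integral_C (fun v => (f v * \1_A v)%:E)].

(* CN(0,1): independent real and imaginary parts, each N(0,1/2); the second
   parameter of normal_prob is the standard deviation. *)
Definition standard_complex_normal (X : T -> R[i]) : Prop :=
  forall A B : set R, measurable A -> measurable B ->
    P [set w | A (complex.Re (X w)) /\ B (complex.Im (X w))] =
    (normal_prob 0 (Num.sqrt 2^-1) A * normal_prob 0 (Num.sqrt 2^-1) B)%E.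

End probability_notions.

(* Time is numbered from 0: index t stands for the (t+1)-st channel use.  The
   power P_T is the argument of the jammer's signal, the only ingredient whose
   law may depend on it.  [msg M] is the tuple of messages when message k takes
   its values in {0, ..., M k - 1}; one such tuple is available on the space for
   every choice of sizes. *)
Record jammed_bc (R : realType) (K : nat) d (T : measurableType d)
    (P : probability T R) := JammedBC {
  chan : nat -> 'I_K -> {RV P >-> 'rV[R[i]]_K};
  jam_chan : nat -> 'I_K -> {RV P >-> 'rV[R[i]]_K};
  noise : nat -> 'I_K -> {RV P >-> R[i]};
  jam_state : nat -> {RV P >-> 'rV[bool]_K};
  jam_signal : R -> nat -> {RV P >-> 'cV[R[i]]_K};
  msg : ('I_K -> nat) -> 'I_K -> {RV P >-> nat};

  chan_indep :
    independent_rvs P (fun tk : nat * 'I_K => chan tk.1 tk.2 : T -> _);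
  chan_ident : forall k, identically_distributed P (fun t => chan t k : T -> _);
  chan_density : forall t k, has_density P (chan t k);
  chan_cov : forall t k, identity_covariance P (chan t k);

  jam_chan_indep :
    independent_rvs P (fun tk : nat * 'I_K => jam_chan tk.1 tk.2 : T -> _);
  jam_chan_ident :
    forall k, identically_distributed P (fun t => jam_chan t k : T -> _);
  jam_chan_density : forall t k, has_density P (jam_chan t k);
  jam_chan_cov : forall t k, identity_covariance P (jam_chan t k);

  noise_indep :
    independent_rvs P (fun tk : nat * 'I_K => noise tk.1 tk.2 : T -> _);
  noise_normal : forall t k, standard_complex_normal P (noise t k);

  jam_state_indep : independent_rvs P (fun t => jam_state t : T -> _);
  jam_state_ident : identically_distributed P (fun t => jam_state t : T -> _);

  jam_signal_power : forall p t, 0 < p ->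
    'E_P[fun w => sqnorm (jam_signal p t w)]%E = p%:E;

  msg_indep : forall M, (forall k, (0 < M k)%N) ->
    independent_rvs P (fun k => msg M k : T -> _);
  msg_uniform : forall M, (forall k, (0 < M k)%N) ->
    forall k m, (m < M k)%N -> P (msg M k @^-1` [set m]) = ((M k)%:R^-1)%:E;

  joint_indep : forall p M, 0 < p -> (forall k, (0 < M k)%N) ->
    mutually_independent P (fun i : 'I_4 => tnth [tuple
      sigma_process (fun tk : nat * 'I_K => noise tk.1 tk.2 : T -> _);
      sigma_process (fun k => msg M k : T -> _);
      sigma_process (fun tk : nat * 'I_K => chan tk.1 tk.2 : T -> _);
      <<s sigma_process (fun t => jam_state t : T -> _) `|`
          sigma_process (fun t => jam_signal p t : T -> _) `|`
          sigma_process
            (fun tk : nat * 'I_K => jam_chan tk.1 tk.2 : T -> _) >>] i)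
}.

(* A block code of length n for delayed CSIT and perfect JSIT: the input at
   time t sees the messages, the channels at times < t and the jammer states at
   times <= t.  Measurability is only asked in the continuous arguments, the
   other ones being discrete. *)
Record DP_code (R : realType) (K n : nat) := DPCode {
  msg_size : 'I_K -> nat;
  msg_size_gt0 : forall k, (0 < msg_size k)%N;
  enc : forall t, ('I_K -> nat) -> t.-tuple 'M[R[i]]_K ->
    t.+1.-tuple 'rV[bool]_K -> 'cV[R[i]]_K;
  enc_measurable : forall t m s, measurable_fun setT (fun h => enc (t := t) m h s);
  dec : 'I_K -> n.-tuple R[i] -> n.-tuple 'M[R[i]]_K ->
    n.-tuple 'rV[bool]_K -> nat;
  dec_measurable : forall k s, measurable_fun setT
    (fun yh : n.-tuple R[i] * n.-tuple 'M[R[i]]_K => dec k yh.1 yh.2 s)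
}.

Section DoF.
Context (R : realType) (K : nat) d (T : measurableType d) (P : probability T R).
Variable C : jammed_bc K P.

Definition chan_mx (t : nat) (w : T) : 'M[R[i]]_K :=
  \matrix_(k < K) chan C t k w.

Section code.
Variables (p : R) (n : nat) (c : DP_code R K n).

Definition input (t : nat) (w : T) : 'cV[R[i]]_K :=
  enc c (fun k => msg C (msg_size c) k w)
    [tuple chan_mx s w | s < t] [tuple jam_state C s w | s < t.+1].

Definition output (t : nat) (k : 'I_K) (w : T) : R[i] :=
  (chan C t k w *m input t w) 0 0
  + (jam_state C t w 0 k)%:R * (jam_chan C t k w *m jam_signal C p t w) 0 0
  + noise C t k w.

Definition decoded (k : 'I_K) (w : T) : nat :=
  dec c k [tuple output t k w | t < n]
    [tuple chan_mx t w | t < n] [tuple jam_state C t w | t < n].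

Definition error_prob (k : 'I_K) : R :=
  fine (P [set w | msg C (msg_size c) k w <> decoded k w]).

Definition power_constraint : Prop :=
  forall t, (t < n)%N -> ('E_P[fun w => sqnorm (input t w)] <= p%:E)%E.

End code.

Definition achievable_DP (p : R) (r : 'I_K -> R) : Prop :=
  exists c : forall n, DP_code R K n,
    [/\ forall n, power_constraint p (c n),
        forall k, ln (msg_size (c n) k)%:R / n%:R @[n --> \oo] --> r k &
        forall k, error_prob p (c n) k @[n --> \oo] --> 0].

Definition DoF_region_DP : set ('I_K -> R) :=
  [set dof | exists r : R -> 'I_K -> R,
     (forall p, 0 < p -> achievable_DP p (r p)) /\
     (forall k, r p k / ln p @[p --> +oo] --> dof k)].

Definition state_prob (s : 'rV[bool]_K) : R :=
  fine (P (jam_state C 0%N @^-1` [set s])).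

Definition symmetric_jammer : Prop :=
  forall (s : 'rV[bool]_K) (pi : 'S_K),
    state_prob s = state_prob (col_perm pi s).

Definition num_jammed_prob (j : nat) : R :=
  fine (P [set w | (\sum_(k < K) jam_state C 0%N w 0%R k)%N = j]).

End DoF.

Definition DoF_MAT (R : realType) (m : nat) : R :=
  if m is 0 then 0 else m%:R / \sum_(1 <= i < m.+1) i%:R^-1.

(* Main.v *)
(** The jamming state is public, so every jamming pattern is coded separately:
    the slots in which exactly the receivers of a set [A], #|A| = m, are not
    jammed carry the Maddah-Ali--Tse scheme for these m receivers, and the
    jammed receivers ignore what they observe.

    In phase j of that scheme every j-subset U of A gets slots carrying m-j+1
    fresh symbols wanted by all of U.  A receiver outside U overhears a linear
    combination which would complete the equations of the receivers of U; for
    each (j+1)-subset, the differences of the j+1 overheard combinations are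
    the j symbols of phase j+1.  Going backwards through the phases, receiver k
    recovers its data from well conditioned square systems.

    The data are points of a fixed square grid, of which about p points meet
    the power constraint.  A block whose channel matrices are well conditioned
    and whose noise is bounded determines the grid points of its receivers;
    each of the two conditions fails with small probability, independently in
    each slot, so by Chebyshev's inequality only a small fraction of the slots
    is bad.  The resulting symbol errors are corrected by an outer
    Gilbert-Varshamov code over the alphabet of grid points, whose rate loss is
    a vanishing fraction of ln p.  Decoding looks for a message explaining the
    observations in all but few slots; that it is unique is a deterministic
    statement, and neither random coding nor mutual information is needed. *)

Require Import Defs.
From HB Require Import structures.
From mathcomp Require Import all_boot all_order all_algebra perm.
From mathcomp Require Import all_classical all_reals all_analysis.
From mathcomp Require Import measurable_realfun complex.
From mathcomp Require Import ring lra zify.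
Set Implicit Arguments.
Unset Strict Implicit.
Unset Printing Implicit Defensive.
Import Order.TTheory GRing.Theory Num.Theory.
Import numFieldNormedType.Exports.
(** * The Gilbert-Varshamov bound *)

(** The order of the choices keeps the error analysis independent of the power: a tolerance [delta]
    comes before everything else, it determines the conditioning bound [B] and the noise bound [b],
    these determine the grid spacing [g], and only the number of grid points grows with [p]. Each
    slot belongs to a single block and a block carries at most K! symbols of a user, so a small
    fraction of bad slots means a small fraction of wrong symbols. Correcting them costs a constant
    times [delta * ln p]. A fixed [delta] therefore reaches the degrees of freedom only up to some
    [eta], and the gap is closed by letting [eta] depend on [p]; since the power from which a given
    [eta] works is not explicit, [eta] is chosen for each [p] as the best among finitely many
    values. A pattern of probability λ with m unjammed receivers contributes λ/H_m to each of them,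
    H_m being the harmonic sum, hence λ m/H_m to the total. *)

Lemma leq_card_bigcup (I T : finType) (P : pred I) (F : I -> {set T}) :
  #|\bigcup_(i | P i) F i| <= \sum_(i | P i) #|F i|.
Proof.
elim/big_rec2: _ => [|i n B _ le]; first by rewrite cards0.
by apply: leq_trans (leq_card_setU _ _) _; rewrite leq_add2l.
Qed.

Section gilbert_varshamov.
Variables (X Q : finType) (D : nat).
Implicit Types f g : {ffun X -> Q}.

Definition hamming f g := #|[set x | f x != g x]|.

Lemma hamming_sym f g : hamming f g = hamming g f.
Proof. by apply: eq_card => x; rewrite !inE eq_sym. Qed.

Lemma card_agree_off (Z : {set X}) g :
  #|[set f : {ffun X -> Q} | [forall x, (x \notin Z) ==> (f x == g x)]]| = #|Q| ^ #|Z|.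
Proof.
pose F x : pred Q := if x \in Z then predT else pred1 (g x).
rewrite (_ : #|_| = #|family F|); last first.
  apply: eq_card => f; rewrite inE; apply/forallP/familyP => fg x;
  by move: (fg x); rewrite /F; case: (x \in Z) => //=; rewrite inE.
rewrite card_family foldrE big_map big_enum /=.
rewrite (eq_bigr (fun x => if x \in Z then #|Q| else 1)); last first.
  by move=> x _; rewrite /F; case: (x \in Z) => //; rewrite card1.
by rewrite -big_mkcond prod_nat_const.
Qed.

(** Choose the set of disagreement, then the values on it. Bounding the number of these sets by
    [2 ^ #|X|] is crude but enough: it costs [ln 2] per coordinate, negligible against the logarithm
    of a growing alphabet. *)
Lemma hamming_ball_le g : 0 < #|Q| ->
  #|[set f | hamming f g <= D]| <= 2 ^ #|X| * #|Q| ^ D.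
Proof.
move=> Q0.
have sub : [set f | hamming f g <= D] \subset
   \bigcup_(Z : {set X} | #|Z| <= D)
     [set f : {ffun X -> Q} | [forall x, (x \notin Z) ==> (f x == g x)]].
  apply/fintype.subsetP => f; rewrite inE => fgD.
  apply/bigcupP; exists [set x | f x != g x] => //.
  by rewrite inE; apply/forallP => x; rewrite inE negbK implybb.
apply: leq_trans (subset_leq_card sub) (leq_trans (leq_card_bigcup _ _) _).
apply: (@leq_trans (\sum_(Z : {set X} | #|Z| <= D) #|Q| ^ D)).
  by apply: leq_sum => Z ZD; rewrite card_agree_off leq_pexp2l.
rewrite sum_nat_const leq_mul2r; apply/orP; right.
have -> : 2 ^ #|X| = #|{set X}| by rewrite -cardsT -card_powerset powersetT cardsT.
exact: max_card.
Qed.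

(** A separated code of maximal cardinality is also a covering: a word at distance more than [D]
    from all codewords could be added to it. Hence the balls of radius [D] around the codewords fill
    the space. *)
Lemma gilbert_varshamov : 0 < #|Q| -> exists C : {set {ffun X -> Q}},
  (forall f g, f \in C -> g \in C -> f != g -> D < hamming f g) /\
  #|Q| ^ #|X| <= #|C| * (2 ^ #|X| * #|Q| ^ D).
Proof.
move=> Q0.
pose sep (C : {set {ffun X -> Q}}) :=
  [forall f in C, forall g in C, (f != g) ==> (D < hamming f g)].
have sepP (C : {set {ffun X -> Q}}) : reflect (forall f g, f \in C -> g \in C -> f != g -> D < hamming f g)
    (sep C).
  apply: (iffP forall_inP) => [h f g fC gC fg|h f fC].
    by move/forall_inP: (h f fC) => /(_ g gC); rewrite fg.
  by apply/forall_inP => g gC; apply/implyP; exact: h.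
have sep0 : sep finset.set0 by apply/sepP => f g; rewrite inE.
case: (@arg_maxnP _ finset.set0 sep (fun C : {set {ffun X -> Q}} => #|C|) sep0) => C /sepP Csep Cmax.
exists C; split => //.
have cover : [set: {ffun X -> Q}] \subset \bigcup_(g in C) [set f | hamming f g <= D].
  apply/fintype.subsetP => f _; apply/bigcupP.
  have [|none] := altP (@exists_inP _ (mem C) (fun g => hamming f g <= D)).
    by move=> [g gC fg]; exists g; rewrite ?inE.
  have far g : g \in C -> D < hamming f g.
    move=> gC; rewrite ltnNge; apply: contra none => fg.
    by apply/exists_inP; exists g.
  have fC : f \notin C.
    apply: contra none => fC; apply/exists_inP; exists f => //.
    by rewrite /hamming (_ : [set _ | _] = finset.set0) ?cards0//; apply/setP => x; rewrite !inE eqxx.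
  have /Cmax : sep (f |: C).
    apply/sepP => g h; rewrite !inE => /orP[/eqP->|gC] /orP[/eqP->|hC].
    - by rewrite eqxx.
    - by move=> _; exact: far.
    - by move=> _; rewrite hamming_sym; exact: far.
    - exact: Csep.
  by rewrite cardsU1 fC add1n /geq /= ltnn.
have := leq_trans (subset_leq_card cover) (leq_card_bigcup _ _).
rewrite cardsT card_ffun => /leq_trans; apply.
rewrite -sum_nat_const; apply: leq_sum => g _; exact: hamming_ball_le.
Qed.

End gilbert_varshamov.

Local Open Scope ring_scope.

(** * The Maddah-Ali--Tse scheme on one block *)

Lemma normc_ge0 (R : rcfType) (z : R[i]) : 0 <= Normc.normc z.
Proof. by case: z => a b; rewrite sqrtr_ge0. Qed.

Lemma normc_sum (R : rcfType) (I : Type) (r : seq I) (P : pred I) (F : I -> R[i]) :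
  Normc.normc (\sum_(i <- r | P i) F i) <= \sum_(i <- r | P i) Normc.normc (F i).
Proof.
elim/big_rec2 : _ => [|i x y _ le]; first by rewrite Normc.normc0.
by apply: le_trans (le_normcD _ _) _; rewrite lerD2l.
Qed.

(* Every square submatrix [M'] of [M] satisfies |adj M'| <= B |det M'|, i.e. its inverse is
   bounded by [B]; this form is polynomial in the entries. *)
Definition well_conditioned (R : rcfType) K (B : R) (M : 'M[R[i]]_K) :=
  (forall i j, Normc.normc (M i j) <= B) /\
  (forall r (f g : {ffun 'I_r -> 'I_K}), injective f -> injective g ->
    \det (mxsub f g M) != 0 /\
    forall i j, Normc.normc (\adj (mxsub f g M) i j) <=
                B * Normc.normc (\det (mxsub f g M))).

(** Cramer's rule: [\det M * v] is [\adj M] applied to [M *m v], and the assumption on the adjugate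
    lets |det M| cancel. *)
Lemma mulmx_bound (R : rcfType) r (M : 'M[R[i]]_r) (v : 'cV_r) (B c : R) :
  0 <= B -> 0 <= c -> \det M != 0 ->
  (forall i j, Normc.normc (\adj M i j) <= B * Normc.normc (\det M)) ->
  (forall i, Normc.normc ((M *m v) i 0) <= c) ->
  forall i, Normc.normc (v i 0) <= r%:R * B * c.
Proof.
move=> B0 c0 dM adjM Mv i.
have E : \det M * v i 0 = \sum_j \adj M i j * (M *m v) j 0.
  have := congr1 (fun N : 'cV_r => N i 0) (mulmxA (\adj M) M v).
  by rewrite mul_adj_mx mul_scalar_mx !mxE => <-.
have dpos : 0 < Normc.normc (\det M).
  rewrite lt_neqAle normc_ge0 andbT eq_sym.
  by apply: contra dM => /eqP/Normc.eq0_normc ->.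
rewrite -(ler_pM2l dpos) -Normc.normcM E.
apply: le_trans (normc_sum _ _ _) _.
apply: (@le_trans _ _ (\sum_(j < r) B * Normc.normc (\det M) * c)).
  apply: ler_sum => j _; rewrite Normc.normcM.
  by apply: ler_pM => //; rewrite normc_ge0.
rewrite sumr_const card_ord -mulr_natl.
by rewrite le_eqVlt; apply/orP; left; apply/eqP; ring.
Qed.

Section MAT.
Variables (R : rcfType) (K : nat) (k0 : 'I_K) (A : {set 'I_K}).
Implicit Types (S : {set 'I_K}) (H : {set 'I_K} -> nat -> 'M[R[i]]_K).
Local Notation m := #|A|.
Local Notation nc := Normc.normc.

(* Phases are numbered from 0: phase [j] serves the subsets of cardinal [j.+1],
   each with [nsyms j] symbols sent in [nslots j] slots.  These balance: a slot
   consumes [m - j] symbols ([nsymsE]) and, for each subset of cardinal [j.+2], one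
   slot from each of its subsets yields [j.+1] symbols of the next phase
   ([nsymsS]). *)
Definition nslots j := (j`! * (m - j.+1)`!)%N.
Definition nsyms j := (j`! * (m - j)`!)%N.

Lemma nsymsE j : (j < m)%N -> nsyms j = (nslots j * (m - j))%N.
Proof.
move=> jm; rewrite /nsyms /nslots -(subnSK jm) factS.
by rewrite -mulnA; congr (_ * _)%N; rewrite mulnC.
Qed.

Lemma nsymsS j : nsyms j.+1 = (nslots j * j.+1)%N.
Proof. by rewrite /nsyms /nslots factS; ring. Qed.

Definition antenna (a : nat) : 'I_K := insubd k0 a.

Definition elem S i := nth k0 (enum S) i.

(* The symbols of phase 0 are the data [u]; the [e]-th symbol of phase [j]
   for [S] is only meaningful for #|S| = j.+1 and e < nsyms j. *)
Fixpoint symbol H (u : 'I_K -> nat -> R[i]) (j : nat) S (e : nat) : R[i] :=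
  if j is j'.+1 then
    let rx k := \sum_(a < m - j') H (S :\ k) (e %/ j)%N k (antenna a) *
                  symbol H u j' (S :\ k) (e %/ j * (m - j') + a)%N in
    rx (elem S 0) - rx (elem S (e %% j).+1)
  else \sum_(k in S) u k e.

(** The noiseless observation of receiver [k] in the [i]-th slot of phase [j] devoted to [S], where
    the first m - j antennas send m - j consecutive symbols. It is the local [rx] of [symbol], for
    an arbitrary receiver. *)
Definition rx H u j S i k : R[i] :=
  \sum_(a < m - j) H S i k (antenna a) * symbol H u j S (i * (m - j) + a)%N.

(** The quotient of [e] by [j.+1] is a slot number, the remainder selects a receiver of [S] to be
    compared with the first one. Receiver k overheard the slot devoted to [S :\ k], so each receiver
    of [S] knows one term and learns the others from the differences. *)
Lemma symbolS H u j S e : symbol H u j.+1 S e =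
  rx H u j (S :\ elem S 0) (e %/ j.+1) (elem S 0) -
  rx H u j (S :\ elem S (e %% j.+1).+1) (e %/ j.+1) (elem S (e %% j.+1).+1).
Proof. by []. Qed.

(** Linearity in the data turns the comparison of two explanations of the same observations into a
    statement about a single data vector with small observations. *)
Lemma symbolB H u v j S e :
  symbol H (fun k e => u k e - v k e) j S e = symbol H u j S e - symbol H v j S e.
Proof.
have rxB j' S' i k :
    (forall S e, symbol H (fun k e => u k e - v k e) j' S e
               = symbol H u j' S e - symbol H v j' S e) ->
    rx H (fun k e => u k e - v k e) j' S' i k
     = rx H u j' S' i k - rx H v j' S' i k.
  move=> IH; rewrite /rx -sumrB; apply: eq_bigr => a _.
  by rewrite IH mulrBr.
elim: j S e => [|j IH] S e; first by rewrite /= sumrB.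
by rewrite !symbolS !rxB//; ring.
Qed.

Lemma rxB H u v j S i k :
  rx H (fun k e => u k e - v k e) j S i k = rx H u j S i k - rx H v j S i k.
Proof.
by rewrite /rx -sumrB; apply: eq_bigr => a _; rewrite symbolB mulrBr.
Qed.

Lemma elem_in S i : (i < #|S|)%N -> elem S i \in S.
Proof. by move=> iS; rewrite -mem_enum mem_nth -?cardE. Qed.

Lemma subcard S j : S \subset A -> #|S| = j.+1 -> (j < m)%N.
Proof. by move=> SA <-; exact: subset_leq_card. Qed.

Lemma slot_lt j e : (e < nsyms j.+1)%N -> (e %/ j.+1 < nslots j)%N.
Proof. by rewrite nsymsS ltn_divLR. Qed.

Lemma symbol_lt j i a : (j < m)%N -> (i < nslots j)%N -> (a < m - j)%N ->
  (i * (m - j) + a < nsyms j)%N.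
Proof.
move=> jm ij am; rewrite nsymsE//.
apply: (@leq_trans (i.+1 * (m - j))); last by rewrite leq_mul2r ij orbT.
by rewrite mulSnr ltn_add2l.
Qed.

Lemma cardD1_elem S j k : #|S| = j.+2 -> k \in S -> #|S :\ k| = j.+1.
Proof. by move=> cS kS; move: (cardsD1 k S); rewrite kS cS add1n => -[<-]. Qed.

(** The recursion of [symbol] restricted to its meaningful indices; the bounds on slot and symbol
    numbers are verified here once for all. *)
Lemma symbol_ind (Q : nat -> {set 'I_K} -> nat -> Prop) :
  (forall S e, S \subset A -> #|S| = 1%N -> (e < nsyms 0)%N -> Q 0%N S e) ->
  (forall j S e k l, S \subset A -> #|S| = j.+2 -> (e < nsyms j.+1)%N ->
     k = elem S 0 -> l = elem S (e %% j.+1).+1 ->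
     k \in S -> l \in S ->
     (forall k' a, k' \in S -> (a < m - j)%N ->
        Q j (S :\ k') (e %/ j.+1 * (m - j) + a)%N) -> Q j.+1 S e) ->
  forall j S e, S \subset A -> #|S| = j.+1 -> (e < nsyms j)%N -> Q j S e.
Proof.
move=> Q0 QS; elim=> [|j IH] S e SA cS eS; first exact: Q0.
apply: (QS _ _ _ (elem S 0) (elem S (e %% j.+1).+1)) => //.
- by apply: elem_in; rewrite cS.
- by apply: elem_in; rewrite cS ltnS ltn_mod.
move=> k' a kS am; apply: IH; first by rewrite (fintype.subset_trans _ SA)// finset.subsetDl.
  by rewrite (cardD1_elem cS).
apply: symbol_lt => //; last exact: slot_lt.
by apply: ltn_trans (subcard SA cS).
Qed.

(** Causality of the scheme: a symbol of phase [j] involves only the channels of slots devoted to at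
    most [j] receivers, that is, of earlier phases. This is why delayed channel knowledge
    suffices. *)
Lemma eq_in_symbol H H' u j S e : S \subset A -> #|S| = j.+1 -> (e < nsyms j)%N ->
  (forall S' i, S' \subset A -> (0 < #|S'|)%N -> (#|S'| <= j)%N ->
     (i < nslots #|S'|.-1)%N -> H S' i = H' S' i) ->
  symbol H u j S e = symbol H' u j S e.
Proof.
move=> SA cS eS.
move: j S e SA cS eS; apply: symbol_ind => [//|].
move=> j S e k l SA cS eS kE lE kS lS IH HH.
suff rE k' : k' \in S -> rx H u j (S :\ k') (e %/ j.+1) k' =
                         rx H' u j (S :\ k') (e %/ j.+1) k'.
  by rewrite !symbolS -kE -lE !rE.
move=> k'S; apply: eq_bigr => a _.
have cS' := cardD1_elem cS k'S.
have SA' : S :\ k' \subset A by rewrite (fintype.subset_trans _ SA)// finset.subsetDl.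
rewrite HH// ?cS'//; last exact: slot_lt.
congr (_ * _); apply: IH => // S' i S'A S'0 S'j iS'.
by apply: HH => //; rewrite ltnW.
Qed.

(** Each phase multiplies the amplitude by at most [2 * K%:R * B]: two observations are subtracted,
    each a sum over at most [K] antennas with coefficients bounded by [B]. *)
Lemma symbol_le H u j S e (a B : R) : 1 <= B -> 0 <= a ->
  S \subset A -> #|S| = j.+1 -> (e < nsyms j)%N ->
  (forall k e, nc (u k e) <= a) ->
  (forall S' i, S' \subset A -> (0 < #|S'|)%N -> (#|S'| <= j)%N ->
     (i < nslots #|S'|.-1)%N -> forall k l, nc (H S' i k l) <= B) ->
  nc (symbol H u j S e) <= a * (2 * K%:R * B) ^+ j.
Proof.
move=> B1 a0 SA cS eS ua.
have B0 : 0 <= B by rewrite (le_trans _ B1).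
move: j S e SA cS eS; apply: symbol_ind.
  move=> S e SA /eqP/cards1P[k ->] _ _ /=.
  by rewrite big_set1 expr0 mulr1.
move=> j S e k l SA cS eS kE lE kS lS IH HB.
suff rE k' : k' \in S -> nc (rx H u j (S :\ k') (e %/ j.+1) k') <=
     K%:R * (B * (a * (2 * K%:R * B) ^+ j)).
  rewrite symbolS -kE -lE; apply: le_trans (le_normcD _ _) _.
  rewrite normcN; apply: le_trans (lerD (rE _ kS) (rE _ lS)) _.
  by rewrite exprS le_eqVlt; apply/orP; left; apply/eqP; ring.
move=> k'S; apply: le_trans (normc_sum _ _ _) _.
have cS' := cardD1_elem cS k'S.
have SA' : S :\ k' \subset A by rewrite (fintype.subset_trans _ SA)// finset.subsetDl.
have cnn : 0 <= B * (a * (2 * K%:R * B) ^+ j).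
  by rewrite !mulr_ge0// exprn_ge0// !mulr_ge0.
apply: (@le_trans _ _ (\sum_(b < m - j) B * (a * (2 * K%:R * B) ^+ j))).
  apply: ler_sum => b _; rewrite Normc.normcM; apply: ler_pM; rewrite ?normc_ge0//.
    by apply: HB => //; rewrite ?cS'//; exact: slot_lt.
  apply: IH => // S' i S'A S'0 S'j iS'.
  by apply: HB => //; rewrite ltnW.
rewrite sumr_const card_ord -[X in X <= _]mulr_natl ler_wpM2r// ler_nat.
by rewrite (leq_trans (leq_subr _ _))// -[X in (_ <= X)%N]card_ord max_card.
Qed.

(* The accuracy of the symbols recovered [n] phases before the end when
   observations are known up to [b]. *)
Fixpoint decoding_gap (b B : R) n : R :=
  if n is n'.+1 then K%:R * B * (b + 2 * decoding_gap b B n') else 0.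

Lemma decoding_gap_ge0 b B n : 0 <= b -> 0 <= B -> 0 <= decoding_gap b B n.
Proof.
by move=> b0 B0; elim: n => //= n IH; rewrite !mulr_ge0// addr_ge0// mulr_ge0.
Qed.

(* Backwards over the phases: the symbols of phase [j.+1] give receiver [k] the
   equations overheard by the receivers outside [S], which together with its
   own equation form an invertible system for the symbols of phase [j]. *)
Lemma symbol_small H u (b B : R) k : 0 <= b -> 0 <= B -> k \in A ->
  (forall S i, S \subset A -> (0 < #|S|)%N -> (i < nslots #|S|.-1)%N ->
     well_conditioned B (H S i) /\ nc (rx H u #|S|.-1 S i k) <= b) ->
  forall j S e, S \subset A -> #|S| = j.+1 -> k \in S -> (e < nsyms j)%N ->
  nc (symbol H u j S e) <= decoding_gap b B (m - j).
Proof.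
move=> b0 B0 kA hyp j.
have [mj|] := leqP m j.
  by move=> S e SA cS; move: (subcard SA cS); rewrite ltnNge mj.
move: {2}(m - j)%N (leqnn (m - j)) => n; elim: n j => [|n IHn] j.
  by rewrite leqn0 subn_eq0 leqNgt => /negP.
move=> mjn jm S e SA cS kS eS.
set i := (e %/ (m - j))%N; set a := (e %% (m - j))%N.
have mj0 : (0 < m - j)%N by rewrite subn_gt0.
have ij : (i < nslots j)%N by rewrite ltn_divLR// -nsymsE.
have am : (a < m - j)%N by rewrite ltn_mod.
have [wc _] : well_conditioned B (H S i) /\ nc (rx H u j S i k) <= b.
  by have := hyp S i SA; rewrite cS /=; exact.
pose r := (m - j)%N.
(* The rows of the system: [k] itself and the receivers outside [S], which makes m - (j + 1) + 1 = m
   - j equations for as many symbols. With the first m - j antennas as columns this is one of the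
   submatrices controlled by [well_conditioned]. *)
pose others := k :: enum (A :\: S).
have so : size others = r.
  rewrite /= -cardE; move: (cardsID S A); rewrite (finset.setIidPr SA) cS => mE.
  by rewrite /r -mE addSn subSn ?leq_addr// addKn.
have uo : uniq others by rewrite /= enum_uniq andbT mem_enum inE kS.
pose f : {ffun 'I_r -> 'I_K} := [ffun x : 'I_r => nth k0 others x].
pose g : {ffun 'I_r -> 'I_K} := [ffun x : 'I_r => antenna x].
have rK : (r <= K)%N.
  by rewrite (leq_trans (leq_subr _ _))// -[X in (_ <= X)%N]card_ord max_card.
have finj : injective f.
  move=> x y; rewrite !ffunE => /eqP; rewrite nth_uniq ?so// => /eqP xy.
  exact: val_inj.
have ginj : injective g.
  move=> x y; rewrite !ffunE => /(congr1 val).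
  by rewrite !val_insubd !(leq_trans (ltn_ord _) rK) => /val_inj.
have [_ /(_ r f g finj ginj)[dne adjB]] := wc.
pose v : 'cV[R[i]]_r := \col_c symbol H u j S (i * r + c)%N.
set c := decoding_gap b B (m - j.+1).
have c0 : 0 <= c by exact: decoding_gap_ge0.
have IH k' x : k' \in A -> (x <= j)%N -> k' \notin S ->
    nc (symbol H u j.+1 (k' |: S) (i * j.+1 + x)) <= c.
  move=> k'A xj k'S.
  have k'SA : k' |: S \subset A.
    by apply/fintype.subsetP => y; rewrite !inE => /orP[/eqP->//|]; exact: (fintype.subsetP SA).
  have ck'S : #|k' |: S| = j.+2 by rewrite cardsU1 k'S cS.
  have j1m := subcard k'SA ck'S.
  apply: IHn => //; first by rewrite subnS -ltnS prednK.
    by rewrite !inE kS orbT.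
  rewrite nsymsS; apply: (@leq_trans (i.+1 * j.+1)).
    by rewrite mulSnr ltn_add2l ltnS.
  by rewrite leq_mul2r ij orbT.
have own S' : S' \subset A -> #|S'| = j.+1 -> nc (rx H u j S' i k) <= b.
  by move=> S'A cS'; have := hyp S' i S'A; rewrite cS' /= => /(_ isT ij)[].
have Hrow x : nc ((mxsub f g (H S i) *m v) x 0) <= b + 2 * c.
  have -> : (mxsub f g (H S i) *m v) x 0 = rx H u j S i (f x).
    rewrite mxE; apply: eq_bigr => y _; rewrite !mxE.
    by rewrite /g !ffunE.
  have fx : f x \in others by rewrite ffunE mem_nth ?so.
  move: fx; rewrite inE => /orP[/eqP ->|].
    apply: le_trans (own S SA cS) _; rewrite lerDl mulr_ge0//.
  rewrite mem_enum inE; set k' := f x => /andP[k'S k'A].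
  pose S' := k' |: S.
  have cS' : #|S'| = j.+2 by rewrite cardsU1 k'S cS.
  have S'A : S' \subset A.
    by apply/fintype.subsetP => y; rewrite !inE => /orP[/eqP->//|]; exact: (fintype.subsetP SA).
  (* The symbols for [S'] compare its first receiver with the others: at position 0 in the
     enumeration the difference vanishes, and at position [x'.+1] it is the symbol of remainder
     [x']. *)
  have rel0 z : z \in S' ->
      nc (rx H u j (S' :\ elem S' 0) i (elem S' 0) - rx H u j (S' :\ z) i z) <= c.
    move=> zS'.
    have iz : (index z (enum S') < j.+2)%N.
      by rewrite -cS' cardE index_mem mem_enum.
    have zE : elem S' (index z (enum S')) = z by rewrite /elem nth_index ?mem_enum.
    case: (index z (enum S')) iz zE => [_ ->|x' x'j zE].
      by rewrite subrr Normc.normc0.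
    have := IH k' x' k'A x'j k'S; rewrite symbolS.
    rewrite divnMDl// divn_small// addn0 modnMDl modn_small//.
    by rewrite -/S' zE.
  have kS' : k \in S' by rewrite !inE kS orbT.
  have k'S' : k' \in S' by rewrite !inE eqxx.
  have S'k' : S' :\ k' = S.
    by rewrite /S' finset.setU1K.
  (* Receiver [k] starts from what it overheard itself in the slot devoted to [S' :\ k] and passes
     to [k'] through the reference receiver. The two differences account for the term [2 * c]. *)
  have -> : rx H u j S i k' = rx H u j (S' :\ k) i k +
     (rx H u j (S' :\ elem S' 0) i (elem S' 0) - rx H u j (S' :\ k) i k) -
     (rx H u j (S' :\ elem S' 0) i (elem S' 0) - rx H u j (S' :\ k') i k').
    by rewrite S'k'; ring.
  apply: le_trans (le_normcD _ _) _; rewrite normcN.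
  apply: le_trans (lerD (le_normcD _ _) (rel0 _ k'S')) _.
  rewrite mulrDl mul1r addrA lerD2r lerD// ?rel0//.
  by apply: own; rewrite ?(cardD1_elem cS')// (fintype.subset_trans _ S'A)// finset.subsetDl.
have bc0 : 0 <= b + 2 * c by rewrite addr_ge0// mulr_ge0.
have := mulmx_bound B0 bc0 dne adjB Hrow (Ordinal am).
rewrite mxE /= -divn_eq => le1; apply: le_trans le1 _.
rewrite -(subnSK jm) /= ler_wpM2r// ler_wpM2r// ler_nat//.
Qed.

End MAT.

(** * The slots of a block, ordered by phases *)

Section slots.
Variables (K : nat) (A : {set 'I_K}).
Local Notation m := #|A|.

(** Sorting by cardinality runs the phases in order, so that the channels entering a symbol belong
    to earlier slots of the block. *)
Definition slots : seq ({set 'I_K} * nat) :=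
  sort (fun x y : {set 'I_K} * nat => (#|x.1| <= #|y.1|)%N)
    [seq (U, i) | U : {set 'I_K} <- enum [set U in powerset A | U != finset.set0],
                  i : nat <- iota 0 (nslots A #|U|.-1)].

Lemma mem_slots S i : ((S, i) \in slots) =
  [&& S \subset A, S != finset.set0 & (i < nslots A #|S|.-1)%N].
Proof.
rewrite mem_sort; apply/allpairsPdep/and3P => [[S' [i' [S'A i'S [-> ->]]]]|[SA S0 iS]].
  by move: S'A i'S; rewrite mem_enum !inE mem_iota => /andP[? ?] /andP[].
by exists S, i; rewrite mem_enum !inE SA S0 mem_iota.
Qed.

Lemma index_slots_lt x y : x \in slots -> y \in slots -> (#|x.1| < #|y.1|)%N ->
  (index x slots < index y slots)%N.
Proof.
move=> xs ys; apply: contraTT; rewrite -!leqNgt => yx.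
have tr : transitive (fun x y : {set 'I_K} * nat => (#|x.1| <= #|y.1|)%N).
  by move=> ? ? ?; exact: leq_trans.
have refl : reflexive (fun x y : {set 'I_K} * nat => (#|x.1| <= #|y.1|)%N).
  by move=> ?.
have srt : sorted (fun x y : {set 'I_K} * nat => (#|x.1| <= #|y.1|)%N) slots.
  by apply: sort_sorted => ? ?; exact: leq_total.
exact: (sorted_leq_index tr refl srt _ _ ys xs yx).
Qed.

(** The C(m, j+1) subsets served in phase j take j! (m-j-1)! slots each, m!/(j+1) altogether. A
    block thus delivers m! symbols to each of the m receivers in m! H_m slots. *)
Lemma size_slots (R : numFieldType) :
  (size slots)%:R = m`!%:R * \sum_(1 <= j < m.+1) j%:R^-1 :> R.
Proof.
rewrite size_sort size_allpairs_dep sumnE big_map big_enum /=.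
under eq_bigr do rewrite size_iota.
rewrite (partition_big (fun U : {set 'I_K} => inord #|U| : 'I_m.+1) xpredT)//=.
have inordE (U : {set 'I_K}) (j : 'I_m.+1) : U \subset A ->
    (inord #|U| == j) = (#|U| == j :> nat).
  by move=> UA; rewrite -(inj_eq val_inj) /= inordK// ltnS subset_leq_card.
rewrite natr_sum big_ord_recl [X in X + _](_ : _ = 0) ?add0r; last first.
  rewrite big_pred0// => U; apply/negP; rewrite !inE => /andP[/andP[UA U0]].
  by rewrite inordE// cards_eq0 (negbTE U0).
rewrite big_add1 /= big_mkord big_distrr /=; apply: eq_bigr => j _.
transitivity (('C(m, j.+1) * nslots A j)%:R : R).
  congr _%:R; rewrite -cards_draws -sum_nat_const.
  apply: eq_big => [U|U].
    rewrite !inE; have [UA|//] := boolP (U \subset A).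
    rewrite inordE//=; case: eqP => [E|]; rewrite ?andbF//.
    by rewrite E cards0.
  rewrite !inE => /andP[/andP[UA U0]].
  by rewrite inordE// => /eqP ->.
have jm : (j.+1 <= m)%N by [].
apply: (@mulIf _ j.+1%:R); first by rewrite pnatr_eq0.
rewrite -mulrA mulVf ?pnatr_eq0// mulr1 -natrM; congr _%:R.
by rewrite -(bin_fact jm) /nslots factS; ring.
Qed.

End slots.

Local Open Scope classical_set_scope.
Local Open Scope ring_scope.

(** * Interleaving the jamming patterns *)

Section occurrences.
Context (E : eqType) (st : nat -> E).

Definition occ s t := [seq t' <- iota 0 t | st t' == s].

Lemma occ_cat s t n : (t <= n)%N ->
  occ s n = occ s t ++ [seq t' <- iota t (n - t) | st t' == s].
Proof. by move=> tn; rewrite /occ -filter_cat -iotaD subnKC. Qed.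

Lemma nth_occ s n r : (r < size (occ s n))%N ->
  [/\ (nth 0 (occ s n) r < n)%N, st (nth 0 (occ s n) r) = s &
      size (occ s (nth 0 (occ s n) r)) = r].
Proof.
move=> rn; set t := nth _ _ _.
have : t \in occ s n by rewrite mem_nth.
rewrite mem_filter mem_iota add0n => /andP[/eqP ts /= tn]; split => //.
have uo : uniq (occ s n) by rewrite filter_uniq ?iota_uniq.
have oE := occ_cat s tn.
have tE : occ s t.+1 = rcons (occ s t) t.
  by rewrite /occ -addn1 iotaD filter_cat /= add0n ts eqxx cats1.
have tN : t \notin occ s t by rewrite mem_filter mem_iota ltnn !andbF.
have : index t (occ s n) = r by rewrite index_uniq.
by rewrite oE tE index_cat mem_rcons mem_head -cats1 index_cat (negbTE tN) /= eqxx addn0.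
Qed.

Lemma nth_occ_prefix s t n r : (t <= n)%N -> (r < size (occ s t))%N ->
  nth 0%N (occ s n) r = nth 0%N (occ s t) r.
Proof. by move=> tn rt; rewrite (occ_cat s tn) nth_cat rt. Qed.

Lemma size_occ s n : size (occ s n) = (\sum_(t < n) (st t == s))%N.
Proof.
rewrite size_filter -sum1_count big_mkcond /= -(big_mkord xpredT (fun t => nat_of_bool (st t == s))).
rewrite /index_iota subn0; apply: eq_bigr => t _; by case: eqP.
Qed.

End occurrences.

(** * Transmission and decoding of the blocks of one jamming pattern *)

Section transmission.
Variables (R : realType) (K : nat) (k0 : 'I_K).
Local Notation state := 'rV[bool]_K.
Local Notation nc := Normc.normc.

Definition unjammed (s : state) : {set 'I_K} := [set k | ~~ s 0 k].

Definition block_chan (A : {set 'I_K}) (oc : seq nat) (b : nat)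
    (Hs : nat -> 'M[R[i]]_K) (U : {set 'I_K}) (i : nat) : 'M[R[i]]_K :=
  Hs (nth 0%N oc (b * size (slots A) + index (U, i) (slots A))).

(* Delayed channel knowledge. *)
Definition past (t : nat) (Hs : nat -> 'M[R[i]]_K) (t' : nat) : 'M[R[i]]_K :=
  if (t' < t)%N then Hs t' else 0.

(* The default slot is read only if every receiver is jammed; then [n = 0] and
   nothing is sent. *)
Definition scheme (Hs : nat -> 'M[R[i]]_K) (st : nat -> state)
    (v : state -> nat -> 'I_K -> nat -> R[i]) (t : nat) : 'cV[R[i]]_K :=
  let s := st t in let A := unjammed s in let oc := occ st s t in
  let b := (size oc %/ size (slots A))%N in
  let Ui := nth (finset.set0, 0%N) (slots A) (size oc %% size (slots A)) in
  let n := (#|A| - #|Ui.1|.-1)%N in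
  \col_a if (a < n)%N then
    symbol k0 A (block_chan A oc b (past t Hs)) (v s b) #|Ui.1|.-1 Ui.1
      (Ui.2 * n + a)%N
  else 0.

(* Slots with an exceptionally large input are sacrificed, so that the power
   constraint holds pointwise. *)
Definition clipped (p : R) Hs st v t : 'cV[R[i]]_K :=
  if sqnorm (scheme Hs st v t) <= p then scheme Hs st v t else 0.

Lemma sqnorm0 m n : sqnorm (0 : 'M[R[i]]_(m, n)) = 0.
Proof.
by rewrite /sqnorm big1// => i _; rewrite big1// => j _; rewrite mxE Normc.normc0 expr0n.
Qed.

Lemma clipped_power p Hs st v t : 0 <= p -> sqnorm (clipped p Hs st v t) <= p.
Proof. by move=> p0; rewrite /clipped; case: ifP => //; rewrite sqnorm0. Qed.

(** The two ranges are those of delayed channel knowledge and perfect jamming knowledge. The lemma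
    also allows a receiver, which holds tuples of length [n], to recompute the input that a guessed
    message would have produced. *)
Lemma eq_clipped p Hs Hs' st st' v t :
  (forall t', (t' < t)%N -> Hs t' = Hs' t') ->
  (forall t', (t' <= t)%N -> st t' = st' t') ->
  clipped p Hs st v t = clipped p Hs' st' v t.
Proof.
move=> HH stst.
suff E : scheme Hs st v t = scheme Hs' st' v t by rewrite /clipped E.
have pE : past t Hs = past t Hs'.
  by apply/funext => t'; rewrite /past; case: ifP => // /HH.
have oE s : occ st s t = occ st' s t.
  apply: eq_in_filter => t'; rewrite mem_iota add0n => /andP[_ t't].
  by rewrite stst// ltnW.
by rewrite /scheme pE stst// oE.
Qed.

Section block.
Variables (Hs : nat -> 'M[R[i]]_K) (st : nat -> state) (n : nat) (s : state).
Variable b : nat.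
Let A := unjammed s.
Let oc := occ st s n.
Hypothesis b_complete : (b.+1 * size (slots A) <= size oc)%N.

Definition slot_time (U : {set 'I_K}) (i : nat) :=
  nth 0%N oc (b * size (slots A) + index (U, i) (slots A)).

Let index_lt U i : (U, i) \in slots A ->
  (b * size (slots A) + index (U, i) (slots A) < size oc)%N.
Proof.
move=> Us; apply: leq_trans b_complete.
by rewrite mulSnr ltn_add2l index_mem.
Qed.

Lemma slot_timeP U i : (U, i) \in slots A ->
  [/\ (slot_time U i < n)%N, st (slot_time U i) = s &
    (size (occ st s (slot_time U i)) %/ size (slots A) = b)%N].
Proof.
move=> Us; have [tn ts tr] := nth_occ (index_lt Us); split => //.
rewrite tr divnMDl; last by apply: (leq_ltn_trans (leq0n (index (U, i) (slots A)))); rewrite index_mem.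
by rewrite divn_small ?addn0// index_mem.
Qed.

(** The encoder works with the occurrences and channels before the current time. By the order of
    [slots] and [eq_in_symbol] these are all it reads, so in a complete block its input agrees with
    the one computed from the whole transmission. *)
Lemma scheme_slot v U i : (U, i) \in slots A ->
  scheme Hs st v (slot_time U i) =
  \col_a if (a < #|A| - #|U|.-1)%N then
    symbol k0 A (block_chan A oc b Hs) (v s b) #|U|.-1 U (i * (#|A| - #|U|.-1) + a)
  else 0.
Proof.
move=> Us; have [tn ts tr] := nth_occ (index_lt Us).
have [_ _ bE] := slot_timeP Us.
move: tn ts tr bE; rewrite -/(slot_time U i); set t := slot_time U i => tn ts tr bE.
rewrite /scheme ts -/A.
have -> : nth (finset.set0, 0%N) (slots A) (size (occ st s t) %% size (slots A)) = (U, i).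
  by rewrite tr modnMDl modn_small ?index_mem// nth_index.
rewrite bE; apply/colP => a; rewrite !mxE; case: ifP => //= aj.
move: (Us); rewrite mem_slots => /and3P[UA U0 iU].
have cU : #|U| = #|U|.-1.+1 by rewrite prednK// card_gt0.
have Um : (#|U|.-1 < #|A|)%N by rewrite -cU subset_leq_card.
apply: eq_in_symbol => //; first exact: symbol_lt.
move=> U' i' U'A U'0 U'j i'U; rewrite /block_chan /oc.
have U's : (U', i') \in slots A by rewrite mem_slots U'A -card_gt0 U'0.
have lt : (b * size (slots A) + index (U', i') (slots A) < size (occ st s t))%N.
  by rewrite tr ltn_add2l index_slots_lt//= cU.
rewrite (@nth_occ_prefix _ _ _ t n)//; last exact: ltnW.
by rewrite /past; have [-> _ _] := nth_occ lt.
Qed.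

(** In a block whose channels are all well conditioned the input is never clipped once [p] exceeds
    this bound. *)
Lemma scheme_power v U i (a B : R) : 1 <= B -> 0 <= a ->
  (forall k e, nc (v s b k e) <= a) ->
  (forall U i, (U, i) \in slots A -> well_conditioned B (Hs (slot_time U i))) ->
  (U, i) \in slots A ->
  sqnorm (scheme Hs st v (slot_time U i)) <= K%:R * (a * (2 * K%:R * B) ^+ K) ^+ 2.
Proof.
move=> B1 a0 va wc Us; rewrite scheme_slot//.
move: (Us); rewrite mem_slots => /and3P[UA U0 iU].
have cU : #|U| = #|U|.-1.+1 by rewrite prednK// card_gt0.
have Um : (#|U|.-1 < #|A|)%N by rewrite -cU subset_leq_card.
have K1 : 1 <= 2 * K%:R * B.
  have K0 : (0 < K)%N by rewrite (leq_ltn_trans _ (ltn_ord k0)).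
  have : 1 <= K%:R :> R by rewrite ler1n.
  by move: B1 => + ?; nra.
have c0 : 0 <= a * (2 * K%:R * B) ^+ K by rewrite mulr_ge0// exprn_ge0// (le_trans _ K1).
rewrite /sqnorm; apply: (@le_trans _ _ (\sum_(l < K) (a * (2 * K%:R * B) ^+ K) ^+ 2)); last first.
  by rewrite sumr_const card_ord -[X in X <= _]mulr_natl.
apply: ler_sum => l _; rewrite big_ord1 mxE.
rewrite lerXn2r ?nnegrE ?normc_ge0//.
case: ifP => [al|_]; last by rewrite Normc.normc0.
apply: le_trans (@symbol_le _ _ k0 A _ _ _ _ _ _ _ B1 a0 UA cU _ va _) _.
- exact: symbol_lt.
- move=> U' i' U'A U'0 U'j i'U.
  have U's : (U', i') \in slots A by rewrite mem_slots U'A -card_gt0 U'0.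
  by have [] := wc _ _ U's.
rewrite ler_wpM2l// ler_weXn2l//.
by rewrite (leq_trans (ltnW Um))// -[X in (_ <= X)%N](card_ord K) max_card.
Qed.

Lemma scheme_rx v U i k : (U, i) \in slots A ->
  \sum_l Hs (slot_time U i) k l * scheme Hs st v (slot_time U i) l 0 =
  rx k0 A (block_chan A oc b Hs) (v s b) #|U|.-1 U i k.
Proof.
move=> Us; rewrite scheme_slot//; under eq_bigr do rewrite mxE.
have mK : (#|A| - #|U|.-1 <= K)%N.
  by rewrite (leq_trans (leq_subr _ _))// -[X in (_ <= X)%N](card_ord K) max_card.
rewrite /rx (big_ord_widen K (fun a => block_chan A oc b Hs U i k (antenna k0 a) *
  symbol k0 A (block_chan A oc b Hs) (v s b) #|U|.-1 U (i * (#|A| - #|U|.-1) + a)) mK).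
rewrite [RHS]big_mkcond /=.
apply: eq_bigr => l _; case: ifP => ll; last by rewrite mulr0.
rewrite /block_chan -/(slot_time U i); congr (Hs _ _ _ * _).
by apply: val_inj; rewrite /= val_insubd ltn_ord.
Qed.

(* Two data assignments that both explain the observations of receiver [k] on
   the whole block carry the same symbols for [k], up to [decoding_gap]. *)
Lemma block_decode p v v' (y : nat -> R[i]) k (a c B : R) : 1 <= B -> 0 <= a ->
  0 <= c -> K%:R * (a * (2 * K%:R * B) ^+ K) ^+ 2 <= p ->
  (forall k e, nc (v s b k e) <= a) -> (forall k e, nc (v' s b k e) <= a) ->
  (forall U i, (U, i) \in slots A -> let t := slot_time U i in
     [/\ well_conditioned B (Hs t),
         nc (y t - \sum_l Hs t k l * clipped p Hs st v t l 0) <= c &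
         nc (y t - \sum_l Hs t k l * clipped p Hs st v' t l 0) <= c]) ->
  k \in A -> forall e, (e < (#|A|)`!)%N ->
  nc (v s b k e - v' s b k e) <= decoding_gap K (2 * c) B #|A|.
Proof.
move=> B1 a0 c0 ap va v'a good kA e em.
have wc U i : (U, i) \in slots A -> well_conditioned B (Hs (slot_time U i)).
  by move=> /good[].
have clip w : (forall k e, nc (w s b k e) <= a) -> forall U i, (U, i) \in slots A ->
    clipped p Hs st w (slot_time U i) = scheme Hs st w (slot_time U i).
  move=> wa U i Us; rewrite /clipped ifT//; apply: le_trans ap.
  exact: scheme_power.
have c20 : 0 <= 2 * c by rewrite mulr_ge0.
have B0 : 0 <= B by rewrite (le_trans _ B1).
pose u := fun k e => v s b k e - v' s b k e.
(* In phase 0, for the subset [[set k]], the symbol [e] is the datum [u k e] itself. The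
   observations of the difference [u] are bounded by [2 * c], both data being within [c] of the same
   [y]. *)
have := @symbol_small _ _ k0 A (block_chan A oc b Hs) u _ _ k c20 B0 kA _ 0%N [set k] e.
rewrite /= big_set1 finset.sub1set subn0; apply => //; last 3 first.
- by rewrite cards1.
- by rewrite finset.in_set1.
- by rewrite /nsyms fact0 mul1n subn0.
move=> U i UA U0 iU.
have Us : (U, i) \in slots A by rewrite mem_slots UA -card_gt0 U0.
have [w1 y1 y2] := good _ _ Us.
split; first exact: w1.
rewrite rxB -!scheme_rx//.
rewrite clip// in y1; rewrite clip// in y2.
set s1 := \sum_l _ in y1 *; set s2 := \sum_l _ in y2 *.
rewrite (_ : s1 - s2 = (y (slot_time U i) - s2) - (y (slot_time U i) - s1)); last by ring.
apply: le_trans (le_normcD _ _) _; rewrite normcN.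
by rewrite mulrDl mul1r lerD.
Qed.

End block.

End transmission.

(** * Measurability *)

Section measurability.
Context d (T : measurableType d) (R : realType).
Implicit Types f g : T -> R[i].

Lemma measurable_complexP f : measurable_fun setT f <->
  measurable_fun setT (fun x => complex.Re (f x)) /\
  measurable_fun setT (fun x => complex.Im (f x)).
Proof.
apply: (@iff_trans _ (g_sigma_preimageU (@complex.Re R \o f)
                        (@complex.Im R \o f) `<=` measurable)).
- rewrite g_sigma_preimageU_comp; split=> [mf A [C HC <-]|f12]; first exact: mf.
  by move=> _ A mA; apply: f12; exists A.
- split => [h12|[mf1 mf2]].
    split => _ A mA; apply: h12; apply: sub_sigma_algebra;
    by [left; exists A|right; exists A].
  apply: smallest_sub; first exact: sigma_algebra_measurable.
  by rewrite subUset; split=> [|] A [C mC <-]; [exact: mf1|exact: mf2].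
Qed.

Lemma measurable_complexD f g : measurable_fun setT f -> measurable_fun setT g ->
  measurable_fun setT (fun x => f x + g x).
Proof.
move=> /measurable_complexP[f1 f2] /measurable_complexP[g1 g2].
apply/measurable_complexP; split.
  rewrite (_ : (fun _ => _) = (fun x => complex.Re (f x) + complex.Re (g x))).
    exact: measurable_funD.
  by apply/funext => x; case: (f x) (g x) => ? ? [].
rewrite (_ : (fun _ => _) = (fun x => complex.Im (f x) + complex.Im (g x))).
  exact: measurable_funD.
by apply/funext => x; case: (f x) (g x) => ? ? [].
Qed.

Lemma measurable_complexN f : measurable_fun setT f ->
  measurable_fun setT (fun x => - f x).
Proof.
move=> /measurable_complexP[f1 f2]; apply/measurable_complexP; split.
  rewrite (_ : (fun _ => _) = (fun x => - complex.Re (f x))).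
    exact: measurableT_comp.
  by apply/funext => x; case: (f x).
rewrite (_ : (fun _ => _) = (fun x => - complex.Im (f x))).
  exact: measurableT_comp.
by apply/funext => x; case: (f x).
Qed.

Lemma measurable_complexB f g : measurable_fun setT f -> measurable_fun setT g ->
  measurable_fun setT (fun x => f x - g x).
Proof. by move=> mf mg; apply: measurable_complexD => //; exact: measurable_complexN. Qed.

Lemma measurable_complexM f g : measurable_fun setT f -> measurable_fun setT g ->
  measurable_fun setT (fun x => f x * g x).
Proof.
move=> /measurable_complexP[f1 f2] /measurable_complexP[g1 g2].
apply/measurable_complexP; split.
  rewrite (_ : (fun _ => _) = (fun x => complex.Re (f x) * complex.Re (g x) -
      complex.Im (f x) * complex.Im (g x))).
    by apply: measurable_funB; exact: measurable_funM.
  by apply/funext => x; case: (f x) (g x) => ? ? [].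
rewrite (_ : (fun _ => _) = (fun x => complex.Re (f x) * complex.Im (g x) +
    complex.Im (f x) * complex.Re (g x))).
  by apply: measurable_funD; exact: measurable_funM.
by apply/funext => x; case: (f x) (g x) => ? ? [].
Qed.

Lemma measurable_complex_sum (I : Type) (s : seq I) (Q : pred I)
    (F : I -> T -> R[i]) :
  (forall i, measurable_fun setT (F i)) ->
  measurable_fun setT (fun x => \sum_(i <- s | Q i) F i x).
Proof.
move=> mF; elim: s => [|i s IH].
  rewrite (_ : (fun _ => _) = cst 0); first exact: measurable_cst.
  by apply/funext => x; rewrite big_nil.
under eq_fun do rewrite big_cons.
by case: (Q i) => //; exact: measurable_complexD.
Qed.

Lemma measurable_complex_prod (I : Type) (s : seq I) (Q : pred I)
    (F : I -> T -> R[i]) :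
  (forall i, measurable_fun setT (F i)) ->
  measurable_fun setT (fun x => \prod_(i <- s | Q i) F i x).
Proof.
move=> mF; elim: s => [|i s IH].
  rewrite (_ : (fun _ => _) = cst 1); first exact: measurable_cst.
  by apply/funext => x; rewrite big_nil.
under eq_fun do rewrite big_cons.
by case: (Q i) => //; exact: measurable_complexM.
Qed.

Lemma measurable_normc f : measurable_fun setT f ->
  measurable_fun setT (fun x => Normc.normc (f x)).
Proof.
move=> /measurable_complexP[f1 f2].
rewrite (_ : (fun _ => _) =
  Num.sqrt \o (fun x => complex.Re (f x) ^+ 2 + complex.Im (f x) ^+ 2)).
  apply: measurableT_comp.
    by apply: continuous_measurable_fun; exact: sqrt_continuous.
  by apply: measurable_funD; exact: measurable_funX.
by apply/funext => x /=; case: (f x).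
Qed.

End measurability.

Section measurable_matrix_entries.
Context d (T : measurableType d) d' (E : measurableType d') (m n : nat).

Lemma measurable_mx_entry (i : 'I_m) (j : 'I_n) :
  measurable_fun setT (fun M : 'M[E]_(m, n) => M i j).
Proof.
move=> _ Y mY; apply: sub_sigma_algebra; exists (i, j) => //=.
by exists Y.
Qed.

Lemma measurable_mxP (f : T -> 'M[E]_(m, n)) : measurable_fun setT f <->
  forall i j, measurable_fun setT (fun x => f x i j).
Proof.
split=> [mf i j|mf].
  exact: (measurableT_comp (measurable_mx_entry i j)).
move=> _ /= Y mY; rewrite setTI.
pose D := [set B : set 'M[E]_(m, n) | measurable (f @^-1` B)].
suff: measurable `<=` D by apply.
apply: smallest_sub.
  split => [|B mB|F mF]; rewrite /D /=.
  - by rewrite preimage_set0.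
  - by rewrite setTD preimage_setC; apply: measurableC; exact: mB.
  - by rewrite preimage_bigcup; apply: bigcupT_measurable => i; exact: mF.
move=> B [[i j] _ [C mC <-]] /=.
by rewrite setTI /D /=; have := mf i j measurableT _ mC; rewrite setTI.
Qed.

End measurable_matrix_entries.

Section measurable_mx_ops.
Context d (T : measurableType d) (R : realType).

Lemma measurable_det_fun n (F : T -> 'M[R[i]]_n) :
  (forall i j, measurable_fun setT (fun x => F x i j)) ->
  measurable_fun setT (fun x => \det (F x)).
Proof.
move=> mF; apply: measurable_complex_sum => s.
apply: measurable_complexM; first exact: measurable_cst.
by apply: measurable_complex_prod.
Qed.

Lemma measurable_adj_fun n (F : T -> 'M[R[i]]_n) (i j : 'I_n) :
  (forall i j, measurable_fun setT (fun x => F x i j)) ->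
  measurable_fun setT (fun x => \adj (F x) i j).
Proof.
move=> mF.
under eq_fun do rewrite mxE /cofactor.
apply: measurable_complexM; first exact: measurable_cst.
apply: measurable_det_fun => k l; under eq_fun do rewrite !mxE.
exact: mF.
Qed.

Lemma measurable_mulmx_fun m n p (F : T -> 'M[R[i]]_(m, n)) (G : T -> 'M[R[i]]_(n, p)) :
  measurable_fun setT F -> measurable_fun setT G ->
  measurable_fun setT (fun x => F x *m G x).
Proof.
move=> /measurable_mxP mF /measurable_mxP mG; apply/measurable_mxP => i j.
under eq_fun do rewrite mxE.
by apply: measurable_complex_sum => k; exact: measurable_complexM.
Qed.

Lemma measurable_sqnorm m n (F : T -> 'M[R[i]]_(m, n)) :
  measurable_fun setT F -> measurable_fun setT (fun x => sqnorm (F x)).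
Proof.
move=> /measurable_mxP mF.
apply: measurable_sum => i; apply: measurable_sum => j.
exact/measurable_funX/measurable_normc.
Qed.

End measurable_mx_ops.

Lemma measurable_mx_set1 d (E : measurableType d) m n (M : 'M[E]_(m, n)) :
  (forall x : E, measurable [set x]) -> measurable [set M].
Proof.
move=> m1.
rewrite (_ : [set M] = \bigcap_(ij in [set: 'I_m * 'I_n])
    ((fun N : 'M[E]_(m, n) => N ij.1 ij.2) @^-1` [set M ij.1 ij.2])).
  apply: fin_bigcap_measurable => [|ij _].
    exact: finite_finset.
  rewrite -[X in measurable X]setTI; exact: measurable_mx_entry.
apply/seteqP; split => [_ -> //|N /= NM].
by apply/matrixP => i j; exact: (NM (i, j)).
Qed.

(** The decoder searches a finite set and counts bad slots, so it depends on the continuous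
    observations only through finitely many Boolean tests. *)
Lemma measurable_finite_tests d (T : measurableType d) d' (E : measurableType d')
    (W : finType) (b : W -> T -> bool) (phi : {ffun W -> bool} -> E) :
  (forall w, measurable_fun setT (b w)) ->
  measurable_fun setT (fun x => phi [ffun w => b w x]).
Proof.
move=> mb _ Y mY; rewrite setTI.
rewrite (_ : _ @^-1` _ = \bigcup_(g in [set g | Y (phi g)])
   \bigcap_(w in [set: W]) (b w @^-1` [set g w])).
  apply: fin_bigcup_measurable; first exact: finite_finset.
  move=> g _; apply: fin_bigcap_measurable; first exact: finite_finset.
  by move=> w _; rewrite -[X in measurable X]setTI; exact: mb.
apply/seteqP; split => [x /= Yx|x [g /= Yg xg]].
  by exists [ffun w => b w x] => // w _ /=; rewrite ffunE.
rewrite (_ : [ffun w => b w x] = g)//.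
by apply/ffunP => w; rewrite ffunE; exact: xg.
Qed.

(** * Independence and the weak law of large numbers *)

Section independence.
Context (R : realType) d (T : measurableType d) (P : probability T R).

(** For fixed [B], both sides are finite measures in [A] that agree on a generating family stable
    under intersections. *)
Lemma indep_sigma_ext (G : set (set T)) (B : set T) :
  G `<=` measurable -> G setT -> setI_closed G -> measurable B ->
  (forall A, G A -> P (A `&` B) = P A * P B)%E ->
  forall A, <<s G >> A -> P (A `&` B) = (P A * P B)%E.
Proof.
move=> Gm GT GI mB GB A sA.
have r0 : 0 <= fine (P B) by exact: fine_ge0.
have E (C : set T) : mscale (NngNum r0) P C = (P C * P B)%E.
  by rewrite /mscale /= fineK ?fin_num_measure// muleC.
rewrite -E -/(mrestr P mB A).
apply: (g_sigma_algebra_measure_unique G Gm (fun=> setT)) sA => //.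
- by rewrite bigcup_const.
- by move=> C GC; rewrite -[LHS]/(P (C `&` B)) GB// -E.
- by move=> k; rewrite /mrestr ltey_eq fin_num_measure.
Qed.

Variables (I : eqType) (F : I -> set (set T)).
Hypotheses (F_ind : mutually_independent P F)
  (F_meas : forall i, F i `<=` measurable)
  (F_setI : forall i, setI_closed (F i)) (F_T : forall i, F i setT).

(** The union of the families [F i] is not stable under intersection; finite intersections of their
    members are. Index sequences can be merged by filling in [setT] where one of them has no
    condition. *)
Let cylinders (J : set I) : set (set T) := [set A | exists s : seq I,
  exists a : I -> set T, [/\ uniq s, (forall i, i \in s -> J i),
    (forall i, F i (a i)) & A = \bigcap_(i in [set` s]) a i]].

Let cylindersm J : cylinders J `<=` measurable.
Proof.
move=> _ [s [a [us sJ Fa ->]]]; apply: fin_bigcap_measurable.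
  exact: finite_seq.
by move=> i _; exact: (F_meas (Fa i)).
Qed.

Let cylindersT J : cylinders J setT.
Proof.
exists [::], (fun=> setT); split => //.
by apply/seteqP; split => // x _ i.
Qed.

Let cylindersI J : setI_closed (cylinders J).
Proof.
move=> _ _ [s [a [us sJ Fa ->]]] [s' [a' [us' sJ' Fa' ->]]].
exists (undup (s ++ s')), (fun i => (if i \in s then a i else setT) `&`
  (if i \in s' then a' i else setT)); split.
- exact: undup_uniq.
- by move=> i; rewrite mem_undup mem_cat => /orP[]; [exact: sJ|exact: sJ'].
- by move=> i; apply: F_setI; case: ifP.
apply/seteqP; split => [x [xs xs'] i _ /=|x xss].
  by split; case: ifP => // ?; [exact: xs|exact: xs'].
split=> i /= iss; have /= := xss i; rewrite mem_undup mem_cat iss ?orbT => /(_ isT)[].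
  by [].
by [].
Qed.

Let sub_cylinders (J : set I) : \bigcup_(i in J) F i `<=` cylinders J.
Proof.
move=> A [i Ji FA]; exists [:: i], (fun k => if k == i then A else setT); split => //.
- by move=> k; rewrite inE => /eqP ->.
- by move=> k; case: eqP => [->|].
apply/seteqP; split => [x Ax k|x /(_ i)] /=; rewrite inE.
  by move=> /eqP ->; rewrite eqxx.
by rewrite eqxx; exact.
Qed.

Let cylinders_ind (J J' : set I) : [disjoint J & J']%classic -> forall A B,
  cylinders J A -> cylinders J' B -> P (A `&` B) = (P A * P B)%E.
Proof.
move=> /disj_setPS JJ' _ _ [s [a [us sJ Fa ->]]] [s' [a' [us' sJ' Fa' ->]]].
have sJs i : i \in s -> i \in s' -> False.
  by move=> /sJ Ji /sJ' J'i; exact: (JJ' i).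
have ss' : uniq (s ++ s').
  rewrite cat_uniq us us' andbT /=; apply/hasPn => i is'; apply/negP => is_.
  exact: (sJs i).
pose c i := if i \in s then a i else a' i.
rewrite (_ : _ `&` _ = \bigcap_(i in [set` s ++ s']) c i).
  rewrite (F_ind ss'); last by move=> i _; rewrite /c; case: ifP.
  rewrite big_cat /=; congr (_ * _)%E.
    rewrite (F_ind us)//; apply: eq_big_seq => i is_.
    by rewrite /c is_.
  rewrite (F_ind us')//; apply: eq_big_seq => i is'.
  rewrite /c ifF//; apply/negP => is_.
  exact: (sJs i).
apply/seteqP; split => [x [xs xs'] i /=|x xss].
  rewrite mem_cat /c; case: ifPn => [is_ _|_ /=]; [exact: xs|exact: xs'].
split=> i /= iss; have /= := xss i; rewrite mem_cat iss ?orbT /c => /(_ isT) //.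
  by rewrite iss.
rewrite ifF//; apply/negP => is_.
exact: (sJs i).
Qed.

(** The extension from cylinders to the generated sigma-algebra is made on one side of the
    intersection, then on the other. *)
Lemma independent_blocks (J J' : set I) (A B : set T) :
  (forall i, J i -> J' i -> False) ->
  <<s \bigcup_(i in J) F i >> A -> <<s \bigcup_(i in J') F i >> B ->
  P (A `&` B) = (P A * P B)%E.
Proof.
move=> JJ' sA sB.
have dJ : [disjoint J & J']%classic.
  by apply/disj_setPS => i [Ji J'i]; exact: (JJ' i).
have sub J0 C : <<s \bigcup_(i in J0) F i >> C -> <<s cylinders J0 >> C.
  apply: sub_smallest2r; first exact: smallest_sigma_algebra.
  exact: sub_cylinders.
have mS J0 C : <<s cylinders J0 >> C -> measurable C.
  by apply: (smallest_sub (@sigma_algebra_measurable _ T)); exact: cylindersm.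
apply: (indep_sigma_ext (@cylindersm J) (@cylindersT J) (@cylindersI J)); last exact: (sub _ _ sA).
  exact: mS (sub _ _ sB).
move=> C GC; rewrite setIC muleC.
apply: (indep_sigma_ext (@cylindersm J') (@cylindersT J') (@cylindersI J')); last exact: (sub _ _ sB).
  exact: cylindersm GC.
by move=> D GD; rewrite setIC muleC; exact: (cylinders_ind dJ).
Qed.

End independence.

Section weak_law.
Context (R : realType) d (T : measurableType d) (P : probability T R).

Lemma Lfun1_indic (A : set T) : measurable A -> (\1_A : T -> R) \in Lfun P 1.
Proof.
move=> mA; apply/Lfun1_integrable; apply: measurable_bounded_integrable => //.
  by rewrite ltey_eq fin_num_measure.
exists 1; split => // x x1 t _ /=.
by rewrite indicE (le_trans _ (ltW x1))//; case: (_ \in _); rewrite ?normr0 ?normr1.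
Qed.

Lemma expectation_finsum (I : eqType) (s : seq I) (F : I -> T -> R) :
  (forall i, F i \in Lfun P 1) ->
  ('E_P[fun w => (\sum_(i <- s) F i w)%R] = \sum_(i <- s) 'E_P[F i])%E.
Proof.
move=> LF; rewrite -(big_map F xpredT (fun f => 'E_P[f]%E)) -expectation_sum.
  by congr expectation; apply/funext => w; rewrite big_map fct_sumE.
by move=> _ /mapP[i _ ->].
Qed.

Variable A : nat -> set T.
Hypotheses (mA : forall t, measurable (A t))
  (indA : forall t t', t != t' -> P (A t `&` A t') = (P (A t) * P (A t'))%E).

Let prob t := fine (P (A t)).
Let Pprob t : P (A t) = (prob t)%:E.
Proof. by rewrite fineK// fin_num_measure. Qed.
Let prob_ge0 t : 0 <= prob t. Proof. exact: fine_ge0. Qed.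

Let Y (tt : nat * nat) (w : T) : R :=
  (\1_(A tt.1) w - prob tt.1) * (\1_(A tt.2) w - prob tt.2).

Let YE tt : Y tt = \1_(A tt.1 `&` A tt.2) - prob tt.2 \o* \1_(A tt.1)
   - prob tt.1 \o* \1_(A tt.2) + cst (prob tt.1 * prob tt.2).
Proof.
apply/funext => w; rewrite /Y !fctE indicI /=.
ring.
Qed.

Let LY tt : Y tt \in Lfun P 1.
Proof.
by rewrite YE rpredD ?rpredB ?Lfun_cst ?Lfun_scale ?Lfun1_indic//; exact: measurableI.
Qed.

Let EY tt :
  'E_P[Y tt]%E = (fine (P (A tt.1 `&` A tt.2)) - prob tt.1 * prob tt.2)%:E.
Proof.
have mAA : measurable (A tt.1 `&` A tt.2) by exact: measurableI.
have LZ t c : c \o* (\1_(A t) : T -> R) \in Lfun P 1.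
  by rewrite Lfun_scale ?Lfun1_indic.
rewrite YE expectationD ?rpredB ?Lfun_cst ?Lfun1_indic// expectation_cst.
rewrite expectationB ?rpredB ?Lfun1_indic// expectationB ?Lfun1_indic//.
rewrite !expectationZl ?Lfun1_indic// !expectation_indic//.
rewrite !Pprob -[P _]fineK ?fin_num_measure// -!EFinM -!EFinB -EFinD.
congr EFin; ring.
Qed.

Let EY_le tt : ('E_P[Y tt] <= (tt.1 == tt.2)%:R%:E)%E.
Proof.
case: tt => t t'; rewrite EY /= lee_fin; have [<-|tt'] := eqVneq t t'.
  rewrite setIid -/(prob t) (@le_trans _ _ (prob t))//.
    by rewrite lerBlDr lerDl mulr_ge0.
  by rewrite -lee_fin -Pprob probability_le1.
by rewrite indA// fineM ?fin_num_measure// subrr.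
Qed.

Lemma count_measurable n (c : R) :
  measurable [set w | c <= \sum_(t < n) \1_(A t) w].
Proof.
have : measurable_fun setT (fun w => \sum_(t < n) (\1_(A t) w : R)).
  by apply: measurable_sum => t; exact: measurable_indic.
move=> /(_ measurableT `[c, +oo[%classic); rewrite setTI => mS.
rewrite (_ : [set _ | _] = (fun w => \sum_(t < n) \1_(A t) w) @^-1` `[c, +oo[%classic).
  by apply: mS; exact: measurable_itv.
by apply/seteqP; split => w /=; rewrite in_itv /= andbT.
Qed.

(** The entries [Y] of the squared deviation have as means the covariances of the indicators: at
    most 1 on the diagonal and 0 off it by pairwise independence. The variance of the count is thus
    at most [n], and Chebyshev gives n / (e n)^2. *)
Lemma chebyshev_count (a e : R) n : (0 < n)%N -> 0 < e ->
  (forall t, prob t <= a) ->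
  (P [set w | ((a + e) * n%:R <= \sum_(t < n) \1_(A t) w)%R] <=
   (e ^- 2 / n%:R)%:E)%E.
Proof.
move=> n0 e0 pa; set E := [set w | _].
have mE : measurable E by exact: count_measurable.
pose s := [seq (t, t') | t <- iota 0 n, t' <- iota 0 n].
pose Z w := \sum_(t < n) (\1_(A t) w - prob t).
have Z2 w : Z w ^+ 2 = \sum_(tt <- s) Y tt w.
  rewrite /s big_allpairs expr2 /Z -(big_mkord xpredT (fun t => \1_(A t) w - prob t)).
  rewrite /index_iota subn0 big_distrl /=; apply: eq_bigr => t _.
  by rewrite big_distrr.
have EZ : ('E_P[fun w => (Z w ^+ 2)%R] <= n%:R%:E)%E.
  under [X in 'E_P[X]%E]eq_fun do rewrite Z2.
  rewrite expectation_finsum//.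
  apply: le_trans (lee_sum _ (fun tt _ => EY_le tt)) _.
  rewrite sumEFin lee_fin /s big_allpairs /=.
  apply: (@le_trans _ _ (\sum_(t <- iota 0 n) 1)); last first.
    by rewrite big_const_seq count_predT size_iota iter_addr_0.
  rewrite big_seq [leRHS]big_seq; apply: ler_sum => t tn.
  rewrite (bigD1_seq t) ?iota_uniq//= eqxx big1 ?addr0// => t' /negbTE.
  by rewrite eq_sym => ->.
have mZ : measurable_fun setT Z.
  apply: measurable_sum => t; apply: measurable_funB; last exact: measurable_cst.
  exact: measurable_indic.
have nR : 0 < n%:R :> R by rewrite ltr0n.
(* Markov's inequality for [Z ^+ 2]: on [E] the count exceeds its mean, which is at most [a * n%:R],
   by at least [e * n%:R]. *)
have cE : ('E_P[((e * n%:R) ^+ 2)%R \o* \1_E] <= 'E_P[fun w => (Z w ^+ 2)%R])%E.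
  apply: expectation_le.
  - by apply: measurable_funM; [exact: measurable_indic|exact: measurable_cst].
  - exact: measurable_funX.
  - by move=> w /=; rewrite mulr_ge0// sqr_ge0.
  - by move=> w; rewrite sqr_ge0.
  apply: aeW => w /=; rewrite indicE; have [wE|] := boolP (w \in E); last first.
    by rewrite mul0r sqr_ge0.
  rewrite mul1r; move: wE; rewrite inE /E /= => wE.
  have enZ : e * n%:R <= Z w.
    have pan : \sum_(t < n) prob t <= a * n%:R.
      rewrite mulr_natr -[X in a *+ X](card_ord n) -sumr_const.
      by apply: ler_sum => t _; exact: pa.
    by rewrite /Z sumrB; move: wE pan; rewrite mulrDl; lra.
  by rewrite lerXn2r// nnegrE ?mulr_ge0 ?(ltW e0)// (le_trans _ enZ)// mulr_ge0// ltW.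
rewrite expectationZl ?Lfun1_indic// expectation_indic// in cE.
have := le_trans cE EZ.
rewrite -lee_pdivlMl; last by rewrite exprn_gt0// mulr_gt0.
move=> /le_trans; apply; rewrite -EFinM lee_fin.
rewrite exprMn invfM -mulrA ler_wpM2l ?invr_ge0 ?sqr_ge0//.
by rewrite expr2 invfM -mulrA mulVf ?mulr1// gt_eqF.
Qed.

Lemma weak_law (a e : R) : 0 < e -> (forall t, (P (A t) <= a%:E)%E) ->
  fine (P [set w | ((a + e) * n%:R <= \sum_(t < n) \1_(A t) w)%R])
    @[n --> \oo] --> (0 : R).
Proof.
move=> e0 pa; apply: (@squeeze_cvgr _ _ _ _ (fun=> 0) (fun n : nat => e ^- 2 / n%:R)).
- near=> n; rewrite fine_ge0//=.
  have n0 : (0 < n)%N by near: n; exists 1%N.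
  rewrite -lee_fin fineK; last by rewrite fin_num_measure//; exact: count_measurable.
  by apply: chebyshev_count => // t; rewrite -lee_fin -Pprob.
- exact: cvg_cst.
rewrite -[X in _ --> X](mulr0 (e ^- 2)); apply: cvgM; first exact: cvg_cst.
apply/gtr0_cvgV0; last exact: cvgr_idn.
by near=> n; rewrite ltr0n; near: n; exists 1%N.
Unshelve. all: by end_near. Qed.

End weak_law.

(** * Conditioning of the random channel *)

Section hyperplane.
Context (R : realType).

Lemma integral_off_point (h : R -> \bar R) (a : R) :
  (forall x, x != a -> h x = 0%E) -> (\int[lebesgue_measure]_x h x = 0)%E.
Proof.
move=> h0; rewrite (_ : h = (cst (h a)) \_ [set a]).
  by rewrite -integral_mkcond integral_cst// [X in (_ * X)%E]lebesgue_measure_set1 mule0.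
apply/funext => x; rewrite patchE /= in_set1.
by case: eqVneq => [->|/h0].
Qed.

Lemma lebesgue_integral_C0 n (F : 'rV[R[i]]_n -> \bar R) :
  (forall v, F v = 0%E) -> lebesgue_integral_C F = 0%E.
Proof.
elim: n F => [|n IH] F F0 /=; first exact: F0.
by rewrite integral0_eq// => x _; rewrite integral0_eq// => y _; exact: IH.
Qed.

(** If a later coordinate has a nonzero coefficient, the first one is absorbed in the constant [c],
    which is there for this induction. Otherwise the equation determines the first coordinate, in
    particular its real part, and the outermost integral is over a single point. *)
Lemma lebesgue_integral_C_hyperplane n (F : 'rV[R[i]]_n -> \bar R)
    (z : 'I_n -> R[i]) (c : R[i]) :
  (exists j, z j != 0) ->
  (forall v : 'rV[R[i]]_n, \sum_j v 0 j * z j + c != 0 -> F v = 0%E) ->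
  lebesgue_integral_C F = 0%E.
Proof.
elim: n F z c => [|n IH] F z c [j zj] F0; first by case: j {zj}.
rewrite /=.
have sumE (u : R[i]) (v : 'rV[R[i]]_n) :
    \sum_j (row_mx u%:M v : 'rV_(1 + n)) 0 j * z j =
    u * z ord0 + \sum_j v 0 j * z (lift ord0 j).
  rewrite big_ord_recl; congr (_ + _).
    by rewrite mxE; case: splitP => k //= _; rewrite ord1 mxE eqxx mulr1n.
  apply: eq_bigr => i _.
  rewrite mxE; case: splitP => k /=; first by rewrite ord1.
  by move=> ik; congr (v _ _ * _); apply: val_inj => /=; case: ik.
have [[k zk]|nz] := pselect (exists k, z (lift ord0 k) != 0).
  rewrite integral0_eq// => x _; rewrite integral0_eq// => y _.
  apply: (IH _ (fun k => z (lift ord0 k)) ((x +i* y)%C * z ord0 + c)).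
    by exists k.
  move=> v vn; apply: F0; rewrite sumE; apply: contra vn => /eqP E.
  by apply/eqP; rewrite -[RHS]E; ring.
have zl k : z (lift ord0 k) = 0.
  by apply/eqP/negPn/negP => zk; apply: nz; exists k.
have z0 : z ord0 != 0.
  by case: (unliftP ord0 j) zj => [k ->|->//]; rewrite zl eqxx.
apply: (@integral_off_point _ (complex.Re (- c / z ord0))) => x xn.
rewrite integral0_eq// => y _; apply: lebesgue_integral_C0 => v.
apply: F0; rewrite sumE big1 ?addr0; last by move=> k _; rewrite zl mulr0.
apply: contra xn => /eqP E; rewrite (_ : - c / z ord0 = (x +i* y)%C)//.
by apply: (mulIf z0); rewrite divfK//; apply/esym/eqP; rewrite -addr_eq0; apply/eqP.
Qed.

Lemma measurable_linear_form n (z : 'I_n -> R[i]) d (T : measurableType d)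
    (X : T -> 'rV[R[i]]_n) : measurable_fun setT X ->
  measurable_fun setT (fun v => \sum_j X v 0 j * z j).
Proof.
move=> /measurable_mxP mX; apply: measurable_complex_sum => j.
by apply: measurable_complexM => //; exact: measurable_cst.
Qed.

Lemma measurable_complex_set1 (a : R[i]) : measurable [set a].
Proof.
have /measurable_complexP[mR mI] := @measurable_id _ R[i] setT.
rewrite (_ : [set a] = (@complex.Re R @^-1` [set complex.Re a]) `&`
   (@complex.Im R @^-1` [set complex.Im a])).
  apply: measurableI; rewrite -[X in measurable X]setTI; [apply: mR|apply: mI] => //.
apply/seteqP; split => [x -> //|x [/= r i]].
by case: x a r i => ? ? [? ?] /= -> ->.
Qed.

Lemma density_hyperplane d (T : measurableType d) (P : probability T R) n
    (X : T -> 'rV[R[i]]_n) (z : 'I_n -> R[i]) :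
  has_density P X -> (exists j, z j != 0) ->
  P (X @^-1` [set v : 'rV[R[i]]_n | \sum_j v 0 j * z j = 0]) = 0%E.
Proof.
move=> [f [mf f0 fE]] nz; rewrite fE; last first.
  have := @measurable_linear_form _ z _ _ _ (@measurable_id _ 'rV[R[i]]_n setT).
  by move=> /(_ measurableT _ (measurable_complex_set1 0)); rewrite setTI.
apply: (@lebesgue_integral_C_hyperplane _ _ z 0) => // v; rewrite addr0 => vz.
by rewrite indicE memNset ?mulr0//= => /eqP; rewrite (negbTE vz).
Qed.

End hyperplane.

Section random_channel.
Context (R : realType) d (T : measurableType d) (P : probability T R) (K : nat).
Variable X : nat -> 'I_K -> {RV P >-> 'rV[R[i]]_K}.
Hypotheses
  (X_indep : independent_rvs P (fun tk : nat * 'I_K => X tk.1 tk.2 : T -> _))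
  (X_ident : forall k, identically_distributed P (fun t => X t k : T -> _))
  (X_dens : forall t k, has_density P (X t k)).

Let F (tk : nat * 'I_K) : set (set T) :=
  preimage_set_system setT (X tk.1 tk.2) measurable.

Let Xmx t w : 'M[R[i]]_K := \matrix_k X t k w.

Let mX t k : measurable_fun setT (X t k).
Proof. exact: measurable_funPT. Qed.

Let F_meas tk : F tk `<=` measurable.
Proof. by move=> _ [B mB <-]; exact: mX. Qed.

Let F_setI tk : setI_closed (F tk).
Proof.
move=> _ _ [A mA <-] [B mB <-]; exists (A `&` B); first exact: measurableI.
by rewrite !setTI preimage_setI.
Qed.

Let F_T tk : F tk setT.
Proof. by exists setT => //; rewrite setTI preimage_setT. Qed.

Let sigmaF (J : set (nat * 'I_K)) := \bigcup_(i in J) F i.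

Let mX_sigma (J : set (nat * 'I_K)) t k : J (t, k) ->
  measurable_fun (setT : set (g_sigma_algebraType (sigmaF J))) (X t k).
Proof.
move=> Jtk _ B mB; apply: sub_sigma_algebra; exists (t, k) => //=.
by exists B.
Qed.

Let indep_funs (J J' : set (nat * 'I_K)) d1 d2 (E1 : measurableType d1)
    (E2 : measurableType d2) (f : T -> E1) (g : T -> E2) :
  (forall i, J i -> J' i -> False) ->
  measurable_fun (setT : set (g_sigma_algebraType (sigmaF J))) f ->
  measurable_fun (setT : set (g_sigma_algebraType (sigmaF J'))) g ->
  forall A B, measurable A -> measurable B ->
  P ((f @^-1` A) `&` (g @^-1` B)) = (P (f @^-1` A) * P (g @^-1` B))%E.
Proof.
move=> JJ' mf mg A B mA mB.
apply: (independent_blocks X_indep F_meas F_setI F_T JJ').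
  by have := mf measurableT A mA; rewrite setTI.
by have := mg measurableT B mB; rewrite setTI.
Qed.

Let measurable_entry_fun d0 (T0 : measurableType d0) (f : T0 -> 'rV[R[i]]_K) i j :
  measurable_fun setT f -> measurable_fun setT (fun w => f w i j).
Proof. by move=> /measurable_mxP. Qed.

Let mXmx t : measurable_fun setT (Xmx t).
Proof.
apply/measurable_mxP => i j.
under eq_fun do rewrite mxE.
exact: measurable_entry_fun.
Qed.

Let mXmx_sigma (J : set (nat * 'I_K)) t : (forall k, J (t, k)) ->
  measurable_fun (setT : set (g_sigma_algebraType (sigmaF J))) (Xmx t).
Proof.
move=> Jt; apply/measurable_mxP => i j.
under eq_fun do rewrite mxE.
by apply: measurable_entry_fun; exact: mX_sigma.
Qed.

Lemma chan_indep_times t t' A : t != t' -> measurable A ->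
  P ((Xmx t @^-1` A) `&` (Xmx t' @^-1` A)) =
  (P (Xmx t @^-1` A) * P (Xmx t' @^-1` A))%E.
Proof.
move=> tt' mA; apply: (@indep_funs [set tk | tk.1 = t] [set tk | tk.1 = t']) => //.
- by move=> i /= -> /eqP; rewrite (negbTE tt').
- exact: mXmx_sigma.
- exact: mXmx_sigma.
Qed.

(** By independence the probability of a product of row events is the product over the rows, whose
    laws do not depend on time; such products generate the matrix sets and are stable under
    intersection. *)
Lemma chan_mx_ident t t' A : measurable A ->
  P (Xmx t @^-1` A) = P (Xmx t' @^-1` A).
Proof.
move=> mA.
pose G : set (set 'M[R[i]]_K) := [set B | exists a : 'I_K -> set 'rV[R[i]]_K,
   (forall k, measurable (a k)) /\ B = [set M | forall k, a k (row k M)]].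
have mrow k : measurable_fun setT (fun M : 'M[R[i]]_K => row k M).
  apply/measurable_mxP => i j; under eq_fun do rewrite mxE.
  exact: measurable_mx_entry.
have GE B : G B -> exists2 a : 'I_K -> set 'rV[R[i]]_K,
    (forall k, measurable (a k)) & B = \bigcap_(k in [set: 'I_K]) ((row k) @^-1` a k).
  move=> [a [ma ->]]; exists a => //.
  by apply/seteqP; split => [M Ma k _|M Ma k]; exact: Ma.
have Gm : G `<=` measurable.
  move=> B /GE[a ma ->]; apply: fin_bigcap_measurable; first exact: finite_finset.
  by move=> k _; have := mrow k measurableT _ (ma k); rewrite setTI.
have GT : G setT by exists (fun=> setT); split => //; apply/seteqP; split.
apply: (measure_unique G (fun=> setT) _ _ _ _
  (distribution P (mfun_Sub (mem_set (mXmx t))))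
  (distribution P (mfun_Sub (mem_set (mXmx t'))))) => //.
- apply/seteqP; split.
    apply: smallest_sub; first exact: smallest_sigma_algebra.
    move=> _ [[i j] _ [C mC <-]]; apply: sub_sigma_algebra.
    exists (fun k => if k == i then [set v : 'rV[R[i]]_K | C (v 0 j)] else setT); split.
      move=> k; case: ifP => // _.
      have := @measurable_mx_entry _ R[i] 1 K 0 j measurableT _ mC.
      by rewrite setTI.
    apply/seteqP; split => [M [_ /= CM] k|M /(_ i)] /=.
      by case: eqP => [->|//]; rewrite /= mxE.
    by rewrite eqxx /= mxE.
  by apply: smallest_sub; [exact: sigma_algebra_measurable|exact: Gm].
- move=> _ _ [a [ma ->]] [b [mb ->]]; exists (fun k => a k `&` b k); split.
    by move=> k; exact: measurableI.
  by apply/seteqP; split => [M [Ma Mb] k|M Mab]; split => // k; have [] := Mab k.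
- by rewrite bigcup_const.
- move=> B /GE[a ma ->].
  have pE s : P (Xmx s @^-1` \bigcap_(k in [set: 'I_K]) (row k @^-1` a k)) =
      (\prod_(k < K) P (X s k @^-1` a k))%E.
    pose A' (tk : nat * 'I_K) := X tk.1 tk.2 @^-1` a tk.2.
    rewrite -(big_map (fun k => (s, k)) xpredT (fun tk => P (A' tk))).
    rewrite -(X_indep (A := A')).
    - congr (P _); apply/seteqP; split => [w /= Xw [t1 k] /= /mapP[k' _ [-> ->]]|w Xw k _ /=].
        by have := Xw k' I; rewrite /= rowK.
      rewrite rowK; apply: (Xw (s, k)) => /=.
      by rewrite map_f// mem_index_enum.
    - by rewrite map_inj_uniq ?index_enum_uniq// => ? ? [].
    - by move=> [t1 k] _; exists (a k) => //; rewrite setTI.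
  rewrite -[LHS]/(P (Xmx t @^-1` _)) -[RHS]/(P (Xmx t' @^-1` _)) !pE.
  by apply: eq_bigr => k _; exact: X_ident.
- by move=> k; rewrite -[X in (X < _)%E]/(P (Xmx t @^-1` setT)) probability_setT ltry.
Qed.

Let measurable_of_sigma J d0 (E : measurableType d0) (Z : T -> E) :
  measurable_fun (setT : set (g_sigma_algebraType (sigmaF J))) Z ->
  measurable_fun (setT : set T) Z.
Proof.
move=> sZ _ B mB; rewrite setTI.
have := sZ measurableT B mB; rewrite setTI.
apply: (smallest_sub (@sigma_algebra_measurable _ T)).
by move=> A [tk _ FA]; exact: F_meas FA.
Qed.

(** A vector [Z] built from the other rows is independent of the row [X t k]. The joint law is
    therefore a product measure, and for each fixed nonzero value of [Z] the row, having a density,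
    lies in the orthogonal hyperplane with probability 0. *)
Lemma hyperplane_null t k (Z : T -> 'rV[R[i]]_K) :
  measurable_fun (setT : set (g_sigma_algebraType (sigmaF [set tk | tk != (t, k)]))) Z ->
  P [set w | Z w != 0 /\ \sum_j X t k w 0 j * Z w 0 j = 0] = 0%E.
Proof.
move=> sZ.
have mZ : measurable_fun (setT : set T) Z.
  exact: measurable_of_sigma sZ.
pose D := [set zx : 'rV[R[i]]_K * 'rV[R[i]]_K |
   zx.1 != 0 /\ \sum_j zx.2 0 j * zx.1 0 j = 0].
have mD : measurable D.
  pose g (zx : 'rV[R[i]]_K * 'rV[R[i]]_K) := \sum_j zx.2 0 j * zx.1 0 j.
  have -> : D = (~` (fst @^-1` [set 0])) `&` (g @^-1` [set 0]).
    by apply/seteqP; split => x /= [/eqP ? ?]; split => //; exact/eqP.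
  apply: measurableI.
    apply: measurableC; rewrite -[X in measurable X]setTI.
    apply: measurable_fst => //; apply: measurable_mx_set1 => x.
    exact: measurable_complex_set1.
  have mg : measurable_fun setT g.
    apply: measurable_complex_sum => j; apply: measurable_complexM.
      by apply: (measurable_entry_fun 0 j); exact: measurable_snd.
    by apply: (measurable_entry_fun 0 j); exact: measurable_fst.
  by have := mg measurableT _ (measurable_complex_set1 0); rewrite setTI.
have mZX : measurable_fun setT (fun w => (Z w, X t k w)).
  exact: measurable_fun_pair.
rewrite -[LHS]/(distribution P (mfun_Sub (mem_set mZX)) D).
rewrite -(@product_measure_unique _ _ _ _ R (distribution P (mfun_Sub (mem_set mZ))) (distribution P (X t k))) //.
  rewrite /product_measure1 integral0_eq// => z _ /=.
  have [->|z0] := eqVneq z 0.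
    rewrite (_ : xsection _ _ = set0) ?measure0//.
    by apply/seteqP; split => // x; rewrite /xsection /= inE => -[]; rewrite eqxx.
  rewrite (_ : xsection _ _ = [set v : 'rV[R[i]]_K | \sum_j v 0 j * z 0 j = 0]).
    apply: density_hyperplane; first exact: X_dens.
    apply: contrapT => nz; move/eqP: z0; apply; apply/rowP => j; rewrite mxE.
    by apply/eqP/negPn/negP => zj; apply: nz; exists j.
  apply/seteqP; split => [x|x /= xz]; rewrite /xsection /= inE /=.
    by case.
  by split.
move=> A B mA mB; rewrite /pushforward /=.
apply: (@indep_funs [set tk | tk != (t, k)] [set (t, k)]) => //.
  by move=> i /= /eqP.
exact: mX_sigma.
Qed.

(** Expanded along its first row, the minor is a linear form in the row [f ord0], with cofactors of
    the other rows as coefficients. One of them is a smaller minor, almost surely nonzero by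
    induction, and [hyperplane_null] applies. *)
Lemma minor_negligible t r (f g : 'I_r -> 'I_K) : injective f -> injective g ->
  P.-negligible [set w | \det (mxsub f g (Xmx t w)) = 0].
Proof.
elim: r f g => [|r IH] f g finj ginj.
  rewrite (_ : [set _ | _] = set0); first exact: negligible_set0.
  apply/seteqP; split => // w /=; rewrite det_mx00 => /eqP.
  by rewrite oner_eq0.
pose cof j w := cofactor (mxsub f g (Xmx t w)) 0 j.
(* The cofactors spread over all [K] antennas, with 0 at the columns not selected by [g], so that
   the expansion becomes a linear form in the whole row. *)
pose Z w : 'rV[R[i]]_K := \row_l \sum_(j < r.+1 | g j == l) cof j w.
have sZ : measurable_fun
    (setT : set (g_sigma_algebraType (sigmaF [set tk | tk != (t, f ord0)]))) Z.
  apply/measurable_mxP => i l.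
  rewrite (_ : (fun w => _) = (fun w => \sum_(j < r.+1 | g j == l) cof j w)); last first.
    by apply/funext => w; rewrite mxE.
  apply: measurable_complex_sum => j; apply: measurable_complexM.
    exact: measurable_cst.
  apply: measurable_det_fun => a b.
  rewrite (_ : (fun w => _) =
      (fun w => X t (f (lift ord0 a)) w 0 (g (lift j b)))); last first.
    by apply/funext => w; rewrite !mxE.
  apply: measurable_entry_fun; apply: mX_sigma => /=.
  by apply/eqP => -[] /finj /eqP; rewrite eq_sym (negbTE (neq_lift _ _)).
have detE w : \det (mxsub f g (Xmx t w)) =
    \sum_l X t (f ord0) w 0 l * Z w 0 l.
  rewrite (expand_det_row _ ord0); under eq_bigr do rewrite !mxE.
  under [RHS]eq_bigr do rewrite mxE.
  rewrite (partition_big g xpredT)//=; apply: eq_bigr => l _.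
  by rewrite big_distrr /=; apply: eq_bigr => j /eqP <-.
have Z0 w : Z w = 0 ->
    \det (mxsub (f \o lift ord0) (g \o lift ord0) (Xmx t w)) = 0.
  move=> /rowP/(_ (g ord0)); rewrite !mxE (big_pred1 ord0); last first.
    by move=> j /=; rewrite inj_eq.
  rewrite /cof /cofactor addn0 expr0 mul1r => <-; congr (\det _).
  by apply/matrixP => a b; rewrite !mxE.
have mXZ : measurable_fun setT (fun w => \det (mxsub f g (Xmx t w))).
  apply: measurable_det_fun => a b.
  rewrite (_ : (fun w => _) = (fun w => Xmx t w (f a) (g b))); last first.
    by apply/funext => w; rewrite mxE.
  by have /measurable_mxP := mXmx t.
have finj' : injective (f \o lift ord0) by apply: inj_comp => //; exact: lift_inj.
have ginj' : injective (g \o lift ord0) by apply: inj_comp => //; exact: lift_inj.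
have n2 : P.-negligible
    [set w | Z w != 0 /\ \sum_j X t (f ord0) w 0 j * Z w 0 j = 0].
  apply/negligibleP; last exact: hyperplane_null sZ.
  rewrite (_ : [set _ | _] = [set w | \det (mxsub f g (Xmx t w)) = 0] `\`
     [set w | Z w = 0]).
    apply: measurableD.
      by have := mXZ measurableT _ (@measurable_complex_set1 R 0); rewrite setTI.
    have mZ : measurable_fun (setT : set T) Z by exact: measurable_of_sigma sZ.
    have := mZ measurableT _ (@measurable_mx_set1 _ R[i] 1 K 0 (@measurable_complex_set1 R)).
    by rewrite setTI.
  by apply/seteqP; split => w /=; rewrite detE => -[] ? ?; split => //; exact/eqP.
apply: negligibleS (negligibleU (IH _ _ finj' ginj') n2).
move=> w /= d0; have [/Z0 ?|Zw] := eqVneq (Z w) 0; first by left.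
right; split => //; exact: etrans (esym (detE w)) d0.
Qed.

End random_channel.

Section measurable_sets.
Context d (T : measurableType d).

Lemma measurable_boolset (b : T -> bool) : measurable_fun setT b ->
  measurable [set x | b x].
Proof. by move=> /(_ measurableT [set true]); rewrite setTI; exact. Qed.

Lemma measurable_forall_fin (I : finType) (Q : I -> T -> Prop) :
  (forall i, measurable [set x | Q i x]) -> measurable [set x | forall i, Q i x].
Proof.
move=> mQ; rewrite (_ : [set _ | _] = \bigcap_(i in [set: I]) [set x | Q i x]).
  by apply: fin_bigcap_measurable => //; exact: finite_finset.
by apply/seteqP; split => [x Qx i _|x Qx i]; exact: Qx.
Qed.

Lemma measurable_forall_nat (Q : nat -> T -> Prop) :
  (forall i, measurable [set x | Q i x]) -> measurable [set x | forall i, Q i x].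
Proof.
move=> mQ; rewrite (_ : [set _ | _] = \bigcap_i [set x | Q i x]).
  exact: bigcapT_measurable.
by apply/seteqP; split => [x Qx i _|x Qx i]; exact: Qx.
Qed.

Lemma measurable_implies (c : Prop) (Q : T -> Prop) :
  measurable [set x | Q x] -> measurable [set x | c -> Q x].
Proof.
move=> mQ; have [hc|hc] := pselect c.
  rewrite (_ : [set _ | _] = [set x | Q x])//.
  by apply/seteqP; split => x /=; [exact|].
by rewrite (_ : [set _ | _] = setT)//; apply/seteqP; split => x // _ /hc.
Qed.

End measurable_sets.

Lemma measurable_well_conditioned (R : realType) K (B : R) :
  measurable [set M : 'M[R[i]]_K | well_conditioned B M].
Proof.
have mle (f g : 'M[R[i]]_K -> R) : measurable_fun setT f ->
    measurable_fun setT g -> measurable [set M | f M <= g M].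
  by move=> mf mg; exact/measurable_boolset/measurable_fun_ler.
have me (i j : 'I_K) : measurable_fun setT (fun M : 'M[R[i]]_K => M i j).
  exact: measurable_mx_entry.
apply: measurableI.
  do 2 apply: measurable_forall_fin => ?.
  by apply: mle; [exact: measurable_normc|exact: measurable_cst].
apply: measurable_forall_nat => r; apply: measurable_forall_fin => f.
apply: measurable_forall_fin => g; do 2 apply: measurable_implies.
have mdet : measurable_fun setT (fun M : 'M[R[i]]_K => \det (mxsub f g M)).
  apply: measurable_det_fun => a b.
  by rewrite (_ : (fun _ => _) = (fun M : 'M[R[i]]_K => M (f a) (g b)))//; apply/funext => M; rewrite mxE.
apply: measurableI.
  rewrite [X in measurable X](_ : _ = ~` ((fun M : 'M[R[i]]_K => \det (mxsub f g M)) @^-1` [set 0])).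
    apply: measurableC; rewrite -[X in measurable X]setTI.
    by apply: mdet => //; exact: measurable_complex_set1.
  by apply/seteqP; split => M /= /eqP.
do 2 apply: measurable_forall_fin => ?; apply: mle.
  apply: measurable_normc; apply: measurable_adj_fun => a b.
  by rewrite (_ : (fun _ => _) = (fun M : 'M[R[i]]_K => M (f a) (g b)))//; apply/funext => M; rewrite mxE.
by apply: measurable_funM; [exact: measurable_cst|exact: measurable_normc].
Qed.

Lemma well_conditioned_le (R : realType) K (B B' : R) (M : 'M[R[i]]_K) :
  B <= B' -> well_conditioned B M -> well_conditioned B' M.
Proof.
move=> BB' [ent min]; split => [i j|r f g fi gi].
  exact: le_trans (ent i j) BB'.
have [d0 adj] := min r f g fi gi; split => // i j.
by rewrite (le_trans (adj i j))// ler_wpM2r// normc_ge0.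
Qed.

(** Injectivity of the selections forces r ≤ K, which leaves finitely many submatrices; the sum of
    all the ratios involved dominates each of them. *)
Lemma well_conditioned_exists (R : realType) K (M : 'M[R[i]]_K) :
  (forall r (f g : {ffun 'I_r -> 'I_K}), injective f -> injective g ->
    \det (mxsub f g M) != 0) -> exists n : nat, well_conditioned n%:R M.
Proof.
move=> dM.
pose N r (f g : {ffun 'I_r -> 'I_K}) :=
  \sum_(ij : 'I_r * 'I_r) Normc.normc (\adj (mxsub f g M) ij.1 ij.2) /
     Normc.normc (\det (mxsub f g M)).
pose B0 : R := \sum_(ij : 'I_K * 'I_K) Normc.normc (M ij.1 ij.2).
pose B1 : R := \sum_(r < K.+1)
  \sum_(fg : {ffun 'I_r -> 'I_K} * {ffun 'I_r -> 'I_K}) N r fg.1 fg.2.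
have term_le (I : finType) (F : I -> R) i : (forall i, 0 <= F i) -> F i <= \sum_i F i.
  by move=> F0; rewrite (bigD1 i)//= lerDl sumr_ge0.
have N0 r f g : 0 <= @N r f g.
  by apply: sumr_ge0 => ij _; rewrite divr_ge0 ?normc_ge0.
have B00 : 0 <= B0 by apply: sumr_ge0 => ij _; exact: normc_ge0.
have B10 : 0 <= B1 by apply: sumr_ge0 => r _; apply: sumr_ge0.
have [n Bn] : exists n : nat, B0 + B1 <= n%:R.
  exists (Num.trunc (B0 + B1)).+1.
  by rewrite ltW// truncnS_gt.
exists n; apply: well_conditioned_le Bn _; split => [i j|r f g fi gi].
  apply: (@le_trans _ _ B0); last by rewrite lerDl.
  by apply: (term_le _ (fun ij : 'I_K * 'I_K => _) (i, j)) => ij; exact: normc_ge0.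
have d0 := dM _ _ _ fi gi; split => // i j.
have dpos : 0 < Normc.normc (\det (mxsub f g M)).
  rewrite lt_neqAle normc_ge0 andbT eq_sym.
  by apply: contra d0 => /eqP/Normc.eq0_normc ->.
rewrite -ler_pdivrMr//; apply: (@le_trans _ _ B1); last by rewrite lerDr.
have rK : (r < K.+1)%N by have := leq_card f fi; rewrite !card_ord.
apply: (@le_trans _ _ (N r f g)).
  by apply: (term_le _ (fun ij : 'I_r * 'I_r => _) (i, j)) => ij; rewrite divr_ge0 ?normc_ge0.
apply: (@le_trans _ _ (\sum_(fg : {ffun 'I_r -> 'I_K} * {ffun 'I_r -> 'I_K}) N r fg.1 fg.2)).
  by apply: (term_le _ (fun fg : {ffun 'I_r -> 'I_K} * {ffun 'I_r -> 'I_K} => N r fg.1 fg.2) (f, g)).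
apply: (term_le _ (fun r : 'I_K.+1 =>
  \sum_(fg : {ffun 'I_r -> 'I_K} * {ffun 'I_r -> 'I_K}) N r fg.1 fg.2) (Ordinal rK)).
by move=> s; apply: sumr_ge0.
Qed.

Section random_channel.
Context (R : realType) d (T : measurableType d) (P : probability T R) (K : nat).
Variable X : nat -> 'I_K -> {RV P >-> 'rV[R[i]]_K}.
Hypotheses
  (X_indep : independent_rvs P (fun tk : nat * 'I_K => X tk.1 tk.2 : T -> _))
  (X_ident : forall k, identically_distributed P (fun t => X t k : T -> _))
  (X_dens : forall t k, has_density P (X t k)).

(** The bad events decrease with the bound [n] and their intersection lies in the union of the null
    sets where some minor vanishes, so their probabilities tend to 0. Equality of laws makes one [n]
    serve all times. *)
Lemma bad_channel_prob (e : R) : 0 < e -> exists n : nat, forall t,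
  (P ((fun w => \matrix_k X t k w : 'M[R[i]]_K) @^-1`
       [set M | ~ well_conditioned n%:R M]) <= e%:E)%E.
Proof.
move=> e0.
pose Xmx (w : T) : 'M[R[i]]_K := \matrix_k X 0%N k w.
pose bad n := Xmx @^-1` [set M | ~ well_conditioned (n%:R : R) M].
have mXmx : measurable_fun setT Xmx.
  apply/measurable_mxP => i j.
  rewrite (_ : (fun w => _) = (fun w => X 0%N i w 0 j)); last first.
    by apply/funext => w; rewrite mxE.
  have mX : measurable_fun setT (X 0%N i) by exact: measurable_funPT.
  by have /measurable_mxP := mX.
have mWC n : measurable [set M : 'M[R[i]]_K | ~ well_conditioned (n%:R : R) M].
  by apply: measurableC; exact: measurable_well_conditioned.
have mbad n : measurable (bad n).
  by rewrite -[X in measurable X]setTI; exact: mXmx.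
have badI : P (\bigcap_n bad n) = 0%E.
  apply/negligibleP; first exact: bigcapT_measurable.
  (* Selections of rows and columns are enumerated by [unpickle], which presents the exceptional set
     as a countable union; codes of no injective pair contribute the empty set. *)
  pose null (r : nat) := \bigcup_(k in [set: nat])
     (if unpickle k is Some (f, g) then
       if injectiveb (f : {ffun 'I_r -> 'I_K}) && injectiveb (g : {ffun 'I_r -> 'I_K})
       then [set w | \det (mxsub f g (Xmx w)) = 0] else set0 else set0).
  apply: (@negligibleS _ _ _ P (\bigcup_r null r)).
    move=> w bw; apply: contrapT => nw.
    have [n wc] : exists n : nat, well_conditioned (n%:R : R) (Xmx w).
      apply: well_conditioned_exists => r f g fi gi; apply/eqP => d0; apply: nw.
      exists r => //; exists (pickle (f, g)) => //.
      by rewrite pickleK ifT//; apply/andP; split; apply/injectiveP.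
    exact: (bw n I wc).
  apply: negligible_bigcup => r; apply: negligible_bigcup => k.
  case: unpickle => [[f g]|]; last exact: negligible_set0.
  case: ifPn => [/andP[/injectiveP fi /injectiveP gi]|_]; last exact: negligible_set0.
  exact: minor_negligible.
have cvgb : P (bad n) @[n --> \oo] --> 0%E.
  rewrite -badI; apply: nonincreasing_cvg_mu => //.
  - by rewrite ltey_eq fin_num_measure.
  - exact: bigcapT_measurable.
  move=> m n mn; apply/subsetPset => w /= nwc wc; apply: nwc.
  by apply: well_conditioned_le wc; rewrite ler_nat.
have [n _ /(_ n (leqnn n)) ne] : \forall n \near \oo, (P (bad n) <= e%:E)%E.
  have /fine_cvgP[_ /cvgr_le/(_ e e0)] := cvgb.
  apply: filterS => n /=; rewrite -lee_fin fineK//.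
  by rewrite fin_num_measure.
exists n => t.
have E := chan_mx_ident X_indep X_ident t 0%N (mWC n).
by rewrite /= in E; rewrite E.
Qed.

End random_channel.

(** * The block code *)

Lemma decoding_gap_le (R : realType) K (b B : R) n n' : 0 <= b -> 0 <= B ->
  (n <= n')%N -> decoding_gap K b B n <= decoding_gap K b B n'.
Proof.
move=> b0 B0; elim: n n' => [|n IH] [|n'] //= nn'; first exact: (decoding_gap_ge0 K n'.+1).
by rewrite ler_wpM2l ?mulr_ge0// lerD2l ler_wpM2l// IH.
Qed.

(** * The square grid of data points *)

Section constellation.
Variables (R : realType) (g : R) (q : nat).
Hypothesis g0 : 0 <= g.

Definition point (ab : 'I_q.+1 * 'I_q.+1) : R[i] :=
  (g * ab.1%:R +i* (g * ab.2%:R))%C.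

Lemma point_le ab : Normc.normc (point ab) <= 2 * g * q%:R.
Proof.
have sq_le (a : 'I_q.+1) : (g * a%:R) ^+ 2 <= (g * q%:R) ^+ 2.
  rewrite lerXn2r ?nnegrE ?mulr_ge0//.
  by rewrite ler_wpM2l// ler_nat -ltnS.
rewrite -(ler_pXn2r (n := 2))// ?nnegrE ?sqrtr_ge0//; last by rewrite !mulr_ge0.
rewrite sqr_sqrtr ?addr_ge0 ?sqr_ge0//.
have := sqr_ge0 (g * q%:R); have := sq_le ab.1; have := sq_le ab.2.
rewrite -[2 * g * _]mulrA [(2 * _) ^+ 2]exprMn.
by move=> h1 h2 h3; nra.
Qed.

Lemma normc_ge_ReIm (z : R[i]) :
  `|complex.Re z| <= Normc.normc z /\ `|complex.Im z| <= Normc.normc z.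
Proof.
case: z => x y /=; rewrite -[`|x|]sqrtr_sqr -[`|y|]sqrtr_sqr.
by split; rewrite ler_wsqrtr// ?lerDl ?lerDr sqr_ge0.
Qed.

Lemma point_sep ab ab' : ab != ab' -> g <= Normc.normc (point ab - point ab').
Proof.
have dist (a a' : 'I_q.+1) : a != a' -> g <= `|g * a%:R - g * a'%:R|.
  move=> aa'; rewrite -mulrBr normrM ger0_norm// -[leLHS]mulr1 ler_wpM2l//.
  have : (a%:R : R) - a'%:R = ((a : int) - (a' : int))%:~R by rewrite intrB.
  move=> ->; rewrite -intr_norm -[1]/(1%:~R) ler_int.
  by move: aa'; rewrite -val_eqE /=; lia.
case: ab ab' => [a1 a2] [b1 b2] ne.
have [re im] := normc_ge_ReIm (point (a1, a2) - point (b1, b2)).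
have [E|a1b1] := eqVneq a1 b1; last exact: le_trans (dist _ _ a1b1) re.
have a2b2 : a2 != b2 by apply: contra ne => /eqP <-; rewrite E.
exact: le_trans (dist _ _ a2b2) im.
Qed.

End constellation.

Section code.
Variables (R : realType) (K : nat) (k0 : 'I_K) (n : nat).
Variables (p g B c : R) (q E : nat).
Local Notation state := 'rV[bool]_K.
Local Notation nc := Normc.normc.
Variable N : state -> nat.
Variable M : 'I_K -> nat.

(* The coordinates of the codeword of user [k]: jamming pattern, block number
   and index in the block.  The ordinals only make the type finite. *)
Definition valid_pos k (x : state * 'I_n.+1 * 'I_(K`!).+1) : bool :=
  [&& k \in unjammed x.1.1, (x.1.2 < N x.1.1)%N & (x.2 < (#|unjammed x.1.1|)`!)%N].

Definition pos k := {x : state * 'I_n.+1 * 'I_(K`!).+1 | valid_pos k x}.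

Local Notation letter := ('I_q.+1 * 'I_q.+1)%type.

Variable cb : forall k, nat -> {ffun pos k -> letter}.

Definition data (m : 'I_K -> nat) (s : state) (b : nat) (k : 'I_K) (e : nat) : R[i] :=
  if insub (s, inord b, inord e) is Some x then point g (cb k (m k) x) else 0.

Lemma data_pos m k (x : pos k) :
  data m (val x).1.1 (val x).1.2 k (val x).2 = point g (cb k (m k) x).
Proof. by rewrite /data !inord_val -!surjective_pairing valK. Qed.

Lemma data_le m s b k e : 0 <= g -> nc (data m s b k e) <= 2 * g * q%:R.
Proof.
move=> g0; rewrite /data; case: insubP => [x _ _|_]; first exact: point_le.
by rewrite Normc.normc0 !mulr_ge0.
Qed.

(** Slots in which [k] is jammed are not tested. The message tuple [m] is complete because the
    predicted input depends on the data of all users. *)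
Definition bad_slot k m (y : nat -> R[i]) Hs (st : nat -> state) (t : nat) : bool :=
  ~~ st t 0 k && (~~ `[< well_conditioned B (Hs t) >] ||
    (c < nc (y t - \sum_l Hs t k l * clipped k0 p Hs st (data m) t l 0))).

Definition consistent k m y Hs st : bool :=
  (#|[set t : 'I_n | bad_slot k m y Hs st t]%SET| <= E)%N.

Hypotheses (B1 : 1 <= B) (c0 : 0 <= c) (gapg : decoding_gap K (2 * c) B K < g).
Hypothesis power : K%:R * (2 * g * q%:R * (2 * K%:R * B) ^+ K) ^+ 2 <= p.
Hypothesis sep : forall k m m', (m < M k)%N -> (m' < M k)%N -> m != m' ->
  (E.*2 * (K`!).+1 < hamming (cb k m) (cb k m'))%N.

(** Together the two explanations have at most 2E bad slots. A block free of them determines the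
    grid points of [k], since [decoding_gap] is below the spacing [g]; hence the codewords differ
    only inside blocks containing a bad slot, in fewer coordinates than two distinct codewords
    must. *)
Lemma consistent_unique k m m' y Hs st :
  (forall s, (N s * size (slots (unjammed s)) <= size (occ st s n))%N) ->
  (m k < M k)%N -> (m' k < M k)%N ->
  consistent k m y Hs st -> consistent k m' y Hs st -> m k = m' k.
Proof.
move=> Nocc mM m'M cm cm'.
have B0 : 0 <= B by rewrite (le_trans _ B1).
have c20 : 0 <= 2 * c by rewrite mulr_ge0.
have g0 : 0 <= g by rewrite (le_trans _ (ltW gapg))// decoding_gap_ge0.
apply/eqP; apply: contraT => mm'.
have := sep mM m'M mm'; apply: contraLR => _; rewrite -leqNgt.
pose Bt := [set t : 'I_n | bad_slot k m y Hs st t] :|: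
           [set t : 'I_n | bad_slot k m' y Hs st t].
have cBt : (#|Bt| <= E.*2)%N.
  apply: leq_trans (leq_card_setU _ _) _; rewrite -addnn.
  by apply: leq_add; [exact: cm|exact: cm'].
(* A time determines its pattern and block number. With a free index in the block, the bad slots
   thus reach every coordinate in which the codewords can differ. *)
pose f (te : 'I_n * 'I_(K`!).+1) : state * 'I_n.+1 * 'I_(K`!).+1 :=
  (st te.1, inord (size (occ st (st te.1) te.1) %/ size (slots (unjammed (st te.1)))), te.2).
pose diff := [set x | cb k (m k) x != cb k (m' k) x]%SET.
have sub : [set val x | x in diff]%SET \subset f @: finset.setX Bt [set: 'I_(K`!).+1].
  apply/fintype.subsetP => _ /imsetP[x xd ->].
  set s := (val x).1.1; set b := (val x).1.2; set e := (val x).2.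
  have xE : val x = (s, b, e) by rewrite -!surjective_pairing.
  have /and3P[ks bN em] : valid_pos k (s, b, e) by rewrite -xE; exact: valP.
  have bc : (b.+1 * size (slots (unjammed s)) <= size (occ st s n))%N.
    by rewrite (leq_trans _ (Nocc s))// leq_mul2r bN orbT.
  suff [U [i [Us]]] : exists U i, (U, i) \in slots (unjammed s) /\
      exists2 t : 'I_n, t = slot_time st n s b U i :> nat & t \in Bt.
    move=> [t tE tB]; apply/imsetP; exists (t, e); first by rewrite finset.in_setX tB finset.in_setT.
    have [_ ts tb] := slot_timeP bc Us.
    by rewrite xE /f /= tE ts tb inord_val.
  apply: contrapT => nobad.
  have good U i : (U, i) \in slots (unjammed s) -> let t := slot_time st n s b U i in
      [/\ well_conditioned B (Hs t),
          nc (y t - \sum_l Hs t k l * clipped k0 p Hs st (data m) t l 0) <= c &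
          nc (y t - \sum_l Hs t k l * clipped k0 p Hs st (data m') t l 0) <= c].
    move=> Us t; have [tn ts tb] := slot_timeP bc Us.
    have : Ordinal tn \notin Bt.
      by apply/negP => tB; apply: nobad; exists U, i; split => //; exists (Ordinal tn).
    rewrite !inE negb_or /bad_slot /= -/t ts.
    have -> : ~~ s 0 k by move: ks; rewrite inE.
    rewrite /= !negb_or !negbK -!leNgt => /andP[/andP[/asboolP ? ?] /andP[_ ?]].
    by split.
  have a0 : 0 <= 2 * g * q%:R by rewrite !mulr_ge0.
  have := block_decode bc B1 a0 c0 power (fun k e => data_le m s b k e g0)
    (fun k e => data_le m' s b k e g0) good ks em.
  have -> : data m s b k e = point g (cb k (m k) x) by exact: data_pos.
  have -> : data m' s b k e = point g (cb k (m' k) x) by exact: data_pos.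
  move: xd; rewrite inE => /(point_sep g0) sepx le1.
  have := lt_le_trans gapg (le_trans sepx le1).
  rewrite ltNge decoding_gap_le//.
  by rewrite -[X in (_ <= X)%N](card_ord K) max_card.
have := leq_trans (subset_leq_card sub) (leq_imset_card _ _).
rewrite card_imset; last exact: val_inj.
move=> /leq_trans; apply; rewrite cardsX cardsT card_ord leq_mul2r cBt orbT//.
Qed.

End code.

Lemma measurable_nth d (E : measurableType d) (x0 : E) n i :
  measurable_fun setT (fun s : n.-tuple E => nth x0 s i).
Proof.
have [it|ti] := ltnP i n.
  rewrite (_ : (fun _ => _) = (fun s : n.-tuple E => tnth s (Ordinal it))).
    exact: measurable_tnth.
  by apply/funext => s; rewrite (tnth_nth x0).
rewrite (_ : (fun _ => _) = cst x0); first exact: measurable_cst.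
by apply/funext => s; rewrite nth_default// size_tuple.
Qed.

(** * Measurability of the encoder and of the consistency test *)

Section measurable_scheme.
Context (R : realType) (K : nat) (k0 : 'I_K) d (T : measurableType d).

Lemma measurable_symbol (A : {set 'I_K}) (H : T -> {set 'I_K} -> nat -> 'M[R[i]]_K)
    u j U e : (forall U i, measurable_fun setT (fun x => H x U i)) ->
  measurable_fun setT (fun x => symbol k0 A (H x) u j U e).
Proof.
move=> mH.
have mrx j' U' i k :
    (forall U e, measurable_fun setT (fun x => symbol k0 A (H x) u j' U e)) ->
    measurable_fun setT (fun x => rx k0 A (H x) u j' U' i k).
  move=> IH; apply: measurable_complex_sum => a; apply: measurable_complexM => //.
  by have /measurable_mxP := mH U' i.
elim: j U e => [|j IH] U e; first exact: measurable_cst.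
rewrite (_ : (fun x => _) = (fun x =>
  rx k0 A (H x) u j (U :\ elem k0 U 0) (e %/ j.+1)%N (elem k0 U 0) -
  rx k0 A (H x) u j (U :\ elem k0 U (e %% j.+1).+1%N) (e %/ j.+1)%N
    (elem k0 U (e %% j.+1).+1%N)))//.
by apply: measurable_complexB; exact: mrx.
Qed.

Variable Hs : T -> nat -> 'M[R[i]]_K.
Hypothesis mHs : forall t, measurable_fun setT (fun x => Hs x t).

Lemma measurable_scheme st v t :
  measurable_fun setT (fun x => scheme k0 (Hs x) st v t).
Proof.
apply/measurable_mxP => a l.
set Ui := nth (finset.set0, 0%N) (slots (unjammed (st t)))
   (size (occ st (st t) t) %% size (slots (unjammed (st t)))).
pose n := (#|unjammed (st t)| - #|Ui.1|.-1)%N.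
rewrite (_ : (fun x => _) = (fun x => if (a < n)%N then
   symbol k0 (unjammed (st t)) (block_chan (unjammed (st t)) (occ st (st t) t)
       (size (occ st (st t) t) %/ size (slots (unjammed (st t))))%N (past t (Hs x)))
     (v (st t) (size (occ st (st t) t) %/ size (slots (unjammed (st t))))%N)
     #|Ui.1|.-1 Ui.1 (Ui.2 * n + a)%N else 0)); last first.
  by apply/funext => x; rewrite mxE.
case: (a < n)%N; last exact: measurable_cst.
apply: measurable_symbol => U i; rewrite /block_chan /past.
by case: (_ < t)%N; [exact: mHs|exact: measurable_cst].
Qed.

Lemma measurable_clipped p st v t :
  measurable_fun setT (fun x => clipped k0 p (Hs x) st v t).
Proof.
apply: measurable_fun_ifT; last exact: measurable_cst.
  apply: measurable_fun_ler; last exact: measurable_cst.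
  exact/measurable_sqnorm/measurable_scheme.
exact: measurable_scheme.
Qed.

Variable y : T -> nat -> R[i].
Hypothesis my : forall t, measurable_fun setT (fun x => y x t).

Lemma measurable_consistent n p g B c q E N (cb : forall k, nat -> {ffun pos n N k -> 'I_q.+1 * 'I_q.+1})
    k m st : measurable_fun setT
  (fun x => consistent k0 p g B c E cb k m (y x) (Hs x) st).
Proof.
pose phi (f : {ffun 'I_n -> bool}) : bool := (#|[set t | f t]%SET| <= E)%N.
rewrite (_ : (fun x => _) = (fun x =>
    phi [ffun t : 'I_n => bad_slot k0 p g B c cb k m (y x) (Hs x) st t])); last first.
  apply/funext => x; rewrite /consistent /phi; congr (_ <= _)%N.
  by apply: eq_card => t; rewrite !inE ffunE.
apply: measurable_finite_tests => t; rewrite /bad_slot.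
apply: measurable_and; first exact: measurable_cst.
apply: measurable_or.
  apply: measurable_neg.
  apply: (measurable_fun_bool true); rewrite setTI.
  rewrite (_ : _ @^-1` _ = (Hs ^~ t) @^-1` [set M | well_conditioned B M]).
    by rewrite -[X in measurable X]setTI; apply: mHs => //; exact: measurable_well_conditioned.
  by apply/seteqP; split => x /= /asboolP.
apply: measurable_fun_ltr; first exact: measurable_cst.
apply: measurable_normc; apply: measurable_complexB => //.
apply: measurable_complex_sum => l; apply: measurable_complexM.
  by have /measurable_mxP := mHs t.
by have /measurable_mxP := measurable_clipped p st (data g cb m) t.
Qed.

End measurable_scheme.

Section mat_code.
Variables (R : realType) (K : nat) (k0 : 'I_K) (n : nat).
Variables (p g B c : R) (q E : nat).
Local Notation state := 'rV[bool]_K.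
Variable N : state -> nat.
Variable M : 'I_K -> nat.
Variable cb : forall k, nat -> {ffun pos n N k -> 'I_q.+1 * 'I_q.+1}.
Hypothesis M_gt0 : forall k, (0 < M k)%N.

Definition mat_enc t (m : 'I_K -> nat) (h : t.-tuple 'M[R[i]]_K)
    (s : t.+1.-tuple state) : 'cV[R[i]]_K :=
  clipped k0 p (nth 0 h) (nth (const_mx false) s) (data g cb m) t.

Definition candidate k (w : {ffun 'I_K -> 'I_(\max_k M k).+1}) y Hs st : bool :=
  [forall k', (w k' < M k')%N] &&
  consistent k0 p g B c E cb k (fun k' => w k' : nat) y Hs st.

(** The search is over tuples of all the messages, since these jointly determine the observations,
    but only the [k]-th entry of a candidate is unique, and only that one is returned. *)
Definition mat_dec k (y : n.-tuple R[i]) (h : n.-tuple 'M[R[i]]_K)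
    (s : n.-tuple state) : nat :=
  if [pick w | candidate k w (nth 0 y) (nth 0 h) (nth (const_mx false) s)] is Some w
  then w k else 0%N.

Lemma mat_enc_measurable t m s :
  measurable_fun setT (fun h => @mat_enc t m h s).
Proof. by apply: measurable_clipped => i; exact: measurable_nth. Qed.

Lemma mat_dec_measurable k s : measurable_fun setT
  (fun yh : n.-tuple R[i] * n.-tuple 'M[R[i]]_K => mat_dec k yh.1 yh.2 s).
Proof.
pose W := {ffun 'I_K -> 'I_(\max_k M k).+1}.
pose phi (f : {ffun W -> bool}) : nat := if [pick w | f w] is Some w then w k else 0%N.
rewrite (_ : (fun _ => _) = (fun yh : n.-tuple R[i] * n.-tuple 'M[R[i]]_K => phi
   [ffun w => candidate k w (nth 0 yh.1) (nth 0 yh.2) (nth (const_mx false) s)])); last first.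
  apply/funext => yh; rewrite /mat_dec /phi.
  by under [in RHS]eq_pick do rewrite ffunE.
apply: measurable_finite_tests => w; apply: measurable_and.
  exact: measurable_cst.
apply: measurable_consistent => t.
  apply: (@measurableT_comp _ _ _ _ _ _ (fun s : n.-tuple 'M[R[i]]_K => nth 0 s t)).
    exact: measurable_nth.
  exact: measurable_snd.
apply: (@measurableT_comp _ _ _ _ _ _ (fun s : n.-tuple R[i] => nth 0 s t)).
  exact: measurable_nth.
exact: measurable_fst.
Qed.

Definition mat_code : DP_code R K n :=
  DPCode M_gt0 mat_enc_measurable mat_dec_measurable.

Hypotheses (B1 : 1 <= B) (c0 : 0 <= c) (gapg : decoding_gap K (2 * c) B K < g).
Hypothesis power : K%:R * (2 * g * q%:R * (2 * K%:R * B) ^+ K) ^+ 2 <= p.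
Hypothesis sep : forall k m m', (m < M k)%N -> (m' < M k)%N -> m != m' ->
  (E.*2 * (K`!).+1 < hamming (cb k m) (cb k m'))%N.

Lemma mat_dec_correct k m (y : nat -> R[i]) Hs st :
  (forall s, (N s * size (slots (unjammed s)) <= size (occ st s n))%N) ->
  (forall k', (m k' < M k')%N) -> consistent k0 p g B c E cb k m y Hs st ->
  mat_dec k [tuple y t | t < n] [tuple Hs t | t < n] [tuple st t | t < n] = m k.
Proof.
move=> Nocc mM cm.
have nthE (X : Type) (x0 : X) (f : nat -> X) t : (t < n)%N ->
    nth x0 [tuple f i | i < n] t = f t.
  by move=> tn; rewrite -[t]/(val (Ordinal tn)) -tnth_nth tnth_mktuple.
have occE s : occ (nth (const_mx false) [tuple st t | t < n]) s n = occ st s n.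
  apply: eq_in_filter => t; rewrite mem_iota add0n => /andP[_ tn].
  by rewrite nthE.
have consE w : consistent k0 p g B c E cb k w (nth 0 [tuple y t | t < n])
    (nth 0 [tuple Hs t | t < n]) (nth (const_mx false) [tuple st t | t < n]) =
    consistent k0 p g B c E cb k w y Hs st.
  rewrite /consistent; congr (_ <= _)%N; apply: eq_card => t; rewrite !inE.
  rewrite /bad_slot !nthE//.
  rewrite (@eq_clipped _ _ _ _ _ Hs _ st)// => t' t't; rewrite nthE//.
    exact: ltn_trans t't _.
  exact: leq_ltn_trans t't _.
rewrite /mat_dec; case: pickP => [w /andP[/forallP wM]|/(_ [ffun k' => inord (m k')])].
  rewrite consE => cw; symmetry.
  exact: (consistent_unique (m' := fun k' => w k' : nat) B1 c0 gapg power sep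
    Nocc (mM k) (wM k) cm cw).
rewrite /candidate consE => /negP[].
have mE : (fun k' => [ffun k' => inord (m k')] k' : 'I_(\max_k M k).+1) = m :> ('I_K -> nat).
  apply/funext => k'; rewrite ffunE inordK// ltnS (leq_trans (ltnW (mM k')))//.
  exact: leq_bigmax.
apply/andP; split.
  by apply/forallP => k'; have := congr1 (@^~ k') mE => /= ->.
by rewrite mE.
Qed.

End mat_code.

(** * Error probability *)

Section discrete.
Context d (T : measurableType d).

(** Encoders and decoders are measurable for each fixed value of their discrete arguments; splitting
    the space along the countably many values makes them measurable when these arguments are
    random. *)
Lemma measurable_fun_discrete (D : countType) d' (E : measurableType d')
    (X : T -> D) (f : D -> T -> E) :
  (forall a, measurable [set w | X w = a]) ->
  (forall a, measurable_fun setT (f a)) ->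
  measurable_fun setT (fun w => f (X w) w).
Proof.
move=> mX mf _ Y mY; rewrite setTI.
rewrite (_ : _ @^-1` _ = \bigcup_a ([set w | X w = a] `&` (f a @^-1` Y))).
  apply: countable_bigcupT_measurable; first exact: countableP.
  move=> a; apply: measurableI => //.
  by rewrite -[X in measurable X]setTI; exact: mf.
by apply/seteqP; split => [w /= Yw|w [a _ [/= <-]]//]; exists (X w).
Qed.

End discrete.

Section pairwise.
Context (R : realType) d (T : measurableType d) (P : probability T R).

Lemma probability_union_le (I : finType) (F : I -> set T) :
  (forall i, measurable (F i)) ->
  (P (\bigcup_(i in [set: I]) F i) <= \sum_i P (F i))%E.
Proof.
move=> mF.
have -> : \bigcup_(i in [set: I]) F i = \big[setU/set0]_(i <- index_enum I) F i.
  rewrite -bigcup_seq; apply: eq_bigcupl; split => i //= _.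
  by rewrite mem_index_enum.
elim: (index_enum I) => [|i s IH]; first by rewrite !big_nil measure0.
rewrite !big_cons; apply: le_trans (leeD2l _ IH); apply: measureU2 => //.
exact: bigsetU_measurable.
Qed.

Lemma independent_rvs_pair (I : eqType) d' (E : measurableType d')
    (X : I -> T -> E) (i j : I) (A : set E) :
  independent_rvs P X -> i != j -> measurable A ->
  P ((X i @^-1` A) `&` (X j @^-1` A)) = (P (X i @^-1` A) * P (X j @^-1` A))%E.
Proof.
move=> indX ij mA.
have := indX [:: i; j] (fun l => X l @^-1` A).
rewrite /= inE ij big_cons big_seq1 => <- //.
  congr (P _); apply/seteqP; split => w /=.
    by move=> [wi wj] l /=; rewrite !inE => /orP[] /eqP ->.
  by move=> wl; split; apply: wl; rewrite /= !inE eqxx ?orbT.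
by move=> l _; exists A => //; rewrite setTI.
Qed.

End pairwise.

Section code_measurability.
Context (R : realType) (K : nat) d (T : measurableType d) (P : probability T R).
Variable C : jammed_bc K P.
Variables (p : R) (n : nat) (c : DP_code R K n).

Lemma measurable_chan_mx t : measurable_fun setT (chan_mx C t).
Proof.
apply/measurable_mxP => i j.
rewrite (_ : (fun w => _) = (fun w => chan C t i w 0 j)); last first.
  by apply/funext => w; rewrite mxE.
have mX : measurable_fun setT (chan C t i) by exact: measurable_funPT.
by have /measurable_mxP := mX.
Qed.

Lemma measurable_state_set1 t s : measurable [set w | jam_state C t w = s].
Proof.
have mX : measurable_fun setT (jam_state C t) by exact: measurable_funPT.
rewrite -[X in measurable X]setTI; apply: (mX measurableT [set s]).
exact: measurable_mx_set1.
Qed.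

Lemma measurable_states_set1 l (s : l.-tuple 'rV[bool]_K) :
  measurable [set w | [tuple jam_state C t w | t < l] = s].
Proof.
rewrite (_ : [set _ | _] = [set w | forall t : 'I_l, jam_state C t w = tnth s t]).
  by apply: measurable_forall_fin => t; exact: measurable_state_set1.
apply/seteqP; split => w /=.
  by move=> <- t; rewrite tnth_mktuple.
by move=> ws; apply: eq_from_tnth => t; rewrite tnth_mktuple.
Qed.

Lemma measurable_msgs_set1 M (m : {ffun 'I_K -> nat}) :
  measurable [set w | [ffun k => msg C M k w] = m].
Proof.
rewrite (_ : [set _ | _] = [set w | forall k, msg C M k w = m k]).
  apply: measurable_forall_fin => k.
  have mX : measurable_fun setT (msg C M k) by exact: measurable_funPT.
  by rewrite -[X in measurable X]setTI; exact: (mX measurableT [set m k]).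
apply/seteqP; split => w /=.
  by move=> <- k; rewrite ffunE.
by move=> wm; apply/ffunP => k; rewrite ffunE.
Qed.

Lemma measurable_chan_tuple l :
  measurable_fun setT (fun w => [tuple chan_mx C t w | t < l]).
Proof.
apply/measurable_fun_tnthP => t.
rewrite (_ : _ \o _ = chan_mx C t); first exact: measurable_chan_mx.
by apply/funext => w; rewrite /= tnth_mktuple.
Qed.

Lemma measurable_input t : measurable_fun setT (input C c t).
Proof.
pose X w := ([ffun k => msg C (msg_size c) k w],
             [tuple jam_state C s w | s < t.+1]).
pose f (ms : {ffun 'I_K -> nat} * t.+1.-tuple 'rV[bool]_K) w :=
  enc c ms.1 [tuple chan_mx C s w | s < t] ms.2.
rewrite (_ : input C c t = fun w => f (X w) w); last first.
  apply/funext => w; rewrite /input /f /X /=; congr (enc _ _ _ _).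
  by apply/funext => k; rewrite ffunE.
apply: measurable_fun_discrete => [[m s]|[m s]].
  rewrite (_ : [set _ | _] = [set w | [ffun k => msg C (msg_size c) k w] = m] `&`
     [set w | [tuple jam_state C s w | s < t.+1] = s]).
    by apply: measurableI; [exact: measurable_msgs_set1|exact: measurable_states_set1].
  by apply/seteqP; split => w; rewrite /X /=; [move=> [-> ->]|move=> [-> ->]].
apply: (@measurableT_comp _ _ _ _ _ _ (fun h => enc c m h s)).
  exact: enc_measurable.
exact: measurable_chan_tuple.
Qed.

Lemma measurable_output t k : measurable_fun setT (output C p c t k).
Proof.
apply: measurable_complexD; last exact: measurable_funPT.
apply: measurable_complexD.
  have := @measurable_mulmx_fun _ T R _ _ _ _ _ (measurable_funPT (chan C t k)) (measurable_input t).
  by move=> /measurable_mxP.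
apply: measurable_complexM.
  have mX : measurable_fun setT (jam_state C t) by exact: measurable_funPT.
  have /measurable_mxP/(_ 0 k) mXk := mX.
  apply: (@measurableT_comp _ _ _ _ _ _ (fun b : bool => (b : nat)%:R : R[i])) => //.
have := @measurable_mulmx_fun _ T R _ _ _ _ _ (measurable_funPT (jam_chan C t k))
   (measurable_funPT (jam_signal C p t)).
by move=> /measurable_mxP.
Qed.

Lemma measurable_decoded k : measurable_fun setT (decoded C p c k).
Proof.
pose f (s : n.-tuple 'rV[bool]_K) w := dec c k [tuple output C p c t k w | t < n]
    [tuple chan_mx C t w | t < n] s.
apply: (@measurable_fun_discrete _ _ _ _ _
  (fun w => [tuple jam_state C t w | t < n]) f) => s.
  exact: measurable_states_set1.
apply: (@measurableT_comp _ _ _ _ _ _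
  (fun yh : n.-tuple R[i] * n.-tuple 'M[R[i]]_K => dec c k yh.1 yh.2 s) setT
  (fun w => ([tuple output C p c t k w | t < n], [tuple chan_mx C t w | t < n]))).
  exact: dec_measurable.
apply: measurable_fun_pair; last exact: measurable_chan_tuple.
apply/measurable_fun_tnthP => t.
rewrite (_ : _ \o _ = output C p c t k); first exact: measurable_output.
by apply/funext => w; rewrite /= tnth_mktuple.
Qed.

Lemma measurable_error k :
  measurable [set w | msg C (msg_size c) k w <> decoded C p c k w].
Proof.
rewrite (_ : [set _ | _] = ~` [set w | msg C (msg_size c) k w == decoded C p c k w]).
  apply: measurableC; apply: measurable_boolset; apply: measurable_fun_eqn.
    exact: measurable_funPT.
  exact: measurable_decoded.
by apply/seteqP; split => w /= ne; [move=> /eqP /ne|move=> E; apply: ne; apply/eqP].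
Qed.

(** The [msg_size c k] values of a uniform message already carry the whole mass. *)
Lemma msg_bound : P [set w | exists k, (msg_size c k <= msg C (msg_size c) k w)%N] = 0%E.
Proof.
pose M := msg_size c.
have mm k (A : set nat) : measurable (msg C M k @^-1` A).
  have mX : measurable_fun setT (msg C M k) by exact: measurable_funPT.
  by rewrite -[X in measurable X]setTI; exact: mX.
have P0 k : P (msg C M k @^-1` [set x | (M k <= x)%N]) = 0%E.
  have Mk := msg_size_gt0 c k.
  rewrite (_ : _ @^-1` _ = ~` (msg C M k @^-1` [set x | (x < M k)%N])); last first.
    by apply/seteqP; split => w /=; [rewrite leqNgt => /negP|move=> /negP; rewrite -leqNgt].
  rewrite probability_setC// (_ : _ @^-1` _ = \big[setU/set0]_(i < M k) (msg C M k @^-1` [set (i : nat)])).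
    rewrite measure_semi_additive_ord//=.
    - rewrite (eq_bigr (fun=> ((M k)%:R^-1)%:E)); last first.
        by move=> i _; apply: msg_uniform => //; exact: msg_size_gt0.
      rewrite sumEFin sumr_const card_ord -[_ *+ M k]mulr_natr mulVf ?subee//.
      by rewrite pnatr_eq0 -lt0n.
    - by move=> i j _ _ [w [/= wi wj]]; apply: val_inj; exact: etrans (esym wi) wj.
    - exact: bigsetU_measurable.
  rewrite -(bigcup_mkord (M k) (fun i => msg C M k @^-1` [set i])).
  by apply/seteqP; split => [w /= wM|w [i /= iM wi]]; [by exists (msg C M k w)|by rewrite /= wi].
rewrite (_ : [set _ | _] = \bigcup_(k in [set: 'I_K]) (msg C M k @^-1` [set x | (M k <= x)%N])).
  apply/eqP; rewrite eq_le measure_ge0 andbT.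
  apply: le_trans (probability_union_le P (fun k => mm k _)) _.
  by rewrite big1.
by apply/seteqP; split => [w [k wk]|w [k _ wk]]; exists k.
Qed.

End code_measurability.

(** * Noise tails and the exceptional events *)

Section noise.
Context (R : realType) (K : nat) d (T : measurableType d) (P : probability T R).
Variable C : jammed_bc K P.

(* A rectangle rather than a disc: its probability is read off
   [standard_complex_normal]. *)
Definition large (b : R) : set R[i] :=
  [set z | ~ (`|complex.Re z| <= b /\ `|complex.Im z| <= b)].

Lemma measurable_large b : measurable (large b).
Proof.
apply: measurableC.
have /measurable_complexP[mR mI] := @measurable_id _ R[i] setT.
by apply: measurableI; apply: measurable_boolset; apply: measurable_fun_ler;
  [exact: measurableT_comp|exact: measurable_cst|exact: measurableT_comp|exact: measurable_cst].
Qed.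

Lemma normc_small b (z : R[i]) : 0 <= b -> ~ large b z -> Normc.normc z <= 2 * b.
Proof.
move=> b0 /contrapT [re im].
rewrite -(ler_pXn2r (n := 2))// ?nnegrE ?normc_ge0 ?mulr_ge0//.
case: z re im => x y /=; rewrite !ler_norml => /andP[? ?] /andP[? ?].
by rewrite sqr_sqrtr ?addr_ge0 ?sqr_ge0//; nra.
Qed.

Lemma measurable_noise t k : measurable_fun setT (noise C t k).
Proof. exact: measurable_funPT. Qed.

Lemma noise_ident t k t' k' b :
  P (noise C t k @^-1` large b) = P (noise C t' k' @^-1` large b).
Proof.
have mA : measurable [set x : R | `|x| <= b].
  by apply: measurable_boolset; apply: measurable_fun_ler.
have E s l : P (noise C s l @^-1` large b) =
    (1 - normal_prob 0%R (Num.sqrt 2^-1) [set x : R | (`|x| <= b)%R] *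
         normal_prob 0%R (Num.sqrt 2^-1) [set x : R | (`|x| <= b)%R])%E.
  rewrite -(noise_normal C s l mA mA) -probability_setC //.
  rewrite (_ : [set _ | _] = noise C s l @^-1` (~` large b)).
    rewrite -[X in measurable X]setTI; apply: measurable_noise => //.
    by apply: measurableC; exact: measurable_large.
  by apply/seteqP; split => w /=; [move=> h; apply|exact: contrapT].
by rewrite !E.
Qed.

(** The rectangles exhaust the plane, so the tails decrease to probability 0; the common law makes
    one [b] serve all times and receivers. *)
Lemma noise_tail (e : R) : 0 < e -> exists b : nat, forall t k,
  (P (noise C t k @^-1` large b%:R) <= e%:E)%E.
Proof.
move=> e0.
have [k0 _|K0] := pickP [pred k : 'I_K | true]; last first.
  by exists 0%N => t k; have := K0 k.
pose A (b : nat) := noise C 0 k0 @^-1` large b%:R.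
have mA b : measurable (A b).
  by rewrite -[X in measurable X]setTI; apply: measurable_noise => //; exact: measurable_large.
have A0 : \bigcap_b A b = set0.
  apply/seteqP; split => // w Aw.
  pose z := noise C 0 k0 w.
  apply: (Aw (Num.trunc (Normc.normc z)).+1 I).
  have [re im] := normc_ge_ReIm z.
  by split; apply: le_trans (ltW (truncnS_gt _)).
have : P (A b) @[b --> \oo] --> 0%E.
  rewrite -(measure0 P) -A0; apply: nonincreasing_cvg_mu => //.
  - by rewrite ltey_eq fin_num_measure.
  - exact: bigcapT_measurable.
  move=> m n mn; apply/subsetPset => w /= nb [re im]; apply: nb.
  by split; rewrite (le_trans re, le_trans im)// ler_nat.
move=> /fine_cvgP[_ /cvgr_le/(_ e e0)] [n _ /(_ n (leqnn n)) ne].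
exists n => t k; rewrite (noise_ident t k 0%N k0).
by move: ne; rewrite /= -lee_fin fineK// fin_num_measure.
Qed.

End noise.

Section rare_events.
Context (R : realType) (K : nat) d (T : measurableType d) (P : probability T R).
Variable C : jammed_bc K P.
Variables (nB b : nat) (delta : R).
Local Notation state := 'rV[bool]_K.
Local Notation B := (nB%:R : R).

Definition bad_chan t : set T := chan_mx C t @^-1` [set M | ~ well_conditioned B M].
Definition bad_noise t k : set T := noise C t k @^-1` large b%:R.
Definition off_state (s : state) t : set T := ~` [set w | jam_state C t w = s].

Hypotheses (d0 : 0 < delta)
  (bchan : forall t, (P (bad_chan t) <= delta%:E)%E)
  (bnoise : forall t k, (P (bad_noise t k) <= delta%:E)%E).

Lemma measurable_bad_chan t : measurable (bad_chan t).
Proof.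
rewrite -[X in measurable X]setTI; apply: measurable_chan_mx => //.
by apply: measurableC; exact: measurable_well_conditioned.
Qed.

Lemma measurable_bad_noise t k : measurable (bad_noise t k).
Proof.
rewrite -[X in measurable X]setTI; apply: measurable_noise => //.
exact: measurable_large.
Qed.

Lemma measurable_off_state s t : measurable (off_state s t).
Proof. by apply: measurableC; exact: measurable_state_set1. Qed.

(** The threshold allows for a mean of at most [delta] and a deviation of [delta]. *)
Definition many_bad_chan n := [set w | (delta + delta) * n%:R <= \sum_(t < n) \1_(bad_chan t) w].
Definition many_bad_noise k n :=
  [set w | (delta + delta) * n%:R <= \sum_(t < n) \1_(bad_noise t k) w].
(** Too few occurrences of [s] are expressed as too many slots in another state, so that the upper
    tail bound of [weak_law] applies. *)
Definition rare_state s n := [set w |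
  (1 - state_prob C s + delta) * n%:R <= \sum_(t < n) \1_(off_state s t) w].

Lemma many_bad_chan_cvg : fine (P (many_bad_chan n)) @[n --> \oo] --> (0 : R).
Proof.
apply: weak_law => // [t|t t' tt'].
  exact: measurable_bad_chan.
have mW : measurable [set M : 'M[R[i]]_K | ~ well_conditioned B M].
  by apply: measurableC; exact: measurable_well_conditioned.
exact: (chan_indep_times (@chan_indep _ _ _ _ _ C) tt' mW).
Qed.

Lemma many_bad_noise_cvg k : fine (P (many_bad_noise k n)) @[n --> \oo] --> (0 : R).
Proof.
apply: (@weak_law _ _ _ P (fun t => bad_noise t k)) => // [t|t t' tt'].
  exact: measurable_bad_noise.
have tk : (t, k) != (t', k) by apply: contra tt' => /eqP[->].
exact: (independent_rvs_pair (@noise_indep _ _ _ _ _ C) tk (measurable_large _)).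
Qed.

Lemma rare_state_cvg s : fine (P (rare_state s n)) @[n --> \oo] --> (0 : R).
Proof.
have m1 : measurable (~` [set s]).
  by apply: measurableC; apply: measurable_mx_set1.
apply: (@weak_law _ _ _ P (off_state s)) => // [t|t t' tt'|t].
- exact: measurable_off_state.
- exact: (independent_rvs_pair (@jam_state_indep _ _ _ _ _ C) tt' m1).
rewrite /off_state probability_setC; last exact: measurable_state_set1.
have ms : measurable [set s] by apply: measurable_mx_set1.
have -> : P [set w | jam_state C t w = s] = P (jam_state C 0 @^-1` [set s]).
  exact: (@jam_state_ident _ _ _ _ _ C t 0%N _ ms).
rewrite EFinB /state_prob fineK ?fin_num_measure//.
by rewrite -[X in measurable X]setTI; apply: measurable_funPT.
Qed.

End rare_events.

Section error.
Context (R : realType) (K : nat) (k0 : 'I_K) d (T : measurableType d)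
  (P : probability T R).
Variable C : jammed_bc K P.
Variables (p g c : R) (nB q b n : nat) (delta : R).
Local Notation state := 'rV[bool]_K.
Local Notation B := (nB%:R : R).
Hypotheses (p0 : 0 <= p) (d0 : 0 < delta).
Hypotheses (B1 : 1 <= B) (cE : c = 2 * b%:R)
  (gapg : decoding_gap K (2 * c) B K < g).
Hypothesis power : K%:R * (2 * g * q%:R * (2 * K%:R * B) ^+ K) ^+ 2 <= p.

Local Notation E := (Num.truncn (4 * delta * n%:R)).
Variables (N : state -> nat) (M : 'I_K -> nat).
Variable cb : forall k, nat -> {ffun pos n N k -> 'I_q.+1 * 'I_q.+1}.
Hypothesis M_gt0 : forall k, (0 < M k)%N.
Hypothesis sep : forall k m m', (m < M k)%N -> (m' < M k)%N -> m != m' ->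
  (E.*2 * (K`!).+1 < hamming (cb k m) (cb k m'))%N.
Hypothesis blocks : forall s, (N s * size (slots (unjammed s)) <=
  Num.truncn ((state_prob C s - delta) * n%:R))%N.

Let code := mat_code k0 p g B c E cb M_gt0.

Let sum_indic (A : nat -> set T) w :
  \sum_(t < n) \1_(A t) w = (\sum_(t < n) `[< A t w >])%:R :> R.
Proof.
rewrite natr_sum; apply: eq_bigr => t _; rewrite indicE; congr (_ %:R).
Qed.

Lemma code_power : power_constraint C p code.
Proof.
move=> t tn.
have mf : measurable_fun setT (fun w => sqnorm (input C code t w)).
  by apply: measurable_sqnorm; exact: measurable_input.
have -> : p%:E = ('E_P[cst p])%E by rewrite expectation_cst.
apply: expectation_le => //.
- by move=> w; apply: sumr_ge0 => i _; apply: sumr_ge0 => j _; exact: sqr_ge0.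
- by apply: aeW => w; exact: clipped_power.
Qed.

Lemma input_clipped t w : (t < n)%N -> input C code t w =
  clipped k0 p (fun t => chan_mx C t w) (fun t => jam_state C t w)
    (data g cb (fun k => msg C M k w)) t.
Proof.
move=> tn; rewrite /input /= /mat_enc.
have nthE (X : Type) (x0 : X) (f : nat -> X) l t0 : (t0 < l)%N ->
    nth x0 [tuple f i | i < l] t0 = f t0.
  by move=> tl; rewrite -[t0]/(val (Ordinal tl)) -tnth_nth tnth_mktuple.
apply: eq_clipped => t' t't.
  exact: (nthE _ 0 (fun t => chan_mx C t w)).
exact: (nthE _ (const_mx false) (fun t => jam_state C t w : state)).
Qed.

(** For the messages actually sent, a slot can be bad only through its channel or its noise. Off the
    exceptional events there are fewer than [4 * delta * n%:R] such slots, and every pattern occurs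
    often enough for its blocks to be complete. *)
Lemma success k w :
  (forall k', (msg C M k' w < M k')%N) ->
  ~ many_bad_chan C nB delta n w -> ~ many_bad_noise C b delta k n w ->
  (forall s, ~ rare_state C delta s n w) ->
  msg C M k w = decoded C p code k w.
Proof.
move=> wM /negP; rewrite -ltNge (sum_indic (bad_chan C nB)) => badH.
move=> /negP; rewrite -ltNge (sum_indic (fun t => bad_noise C b t k)) => badN freq.
rewrite /decoded; symmetry.
pose Hs t := chan_mx C t w; pose st t := jam_state C t w.
have c0 : 0 <= c by rewrite cE mulr_ge0.
pose m := fun k => msg C M k w.
pose y := fun t => output C p code t k w.
apply: (mat_dec_correct (m := m) (y := y) (Hs := Hs) (st := st) B1 c0 gapg power sep) => //.
 move=> s; apply: leq_trans (blocks s) _; rewrite truncn_le_nat.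
  have /negP := freq s; rewrite -ltNge (sum_indic (off_state C s)).
  have : (n%:R : R) = (size (occ st s n))%:R + (\sum_(t < n) `[< off_state C s t w >])%:R.
    rewrite size_occ -natrD -big_split /=; congr (_ %:R).
    rewrite -[LHS]card_ord -sum1_card; apply: eq_bigr => t _.
    rewrite /off_state /st; have [E|ne] := eqVneq (jam_state C t w) s.
      by rewrite (_ : `[< _ >] = false)//; apply/asboolP => /(_ E).
    by rewrite (_ : `[< _ >] = true)//; apply/asboolP => /= E; rewrite E eqxx in ne.
  by move=> nE h; rewrite -natr1; move: h; rewrite nE; lra.
rewrite /m /y /consistent truncn_ge_nat; last by rewrite !mulr_ge0// ltW.
have : (#|[set t : 'I_n | bad_slot k0 p g B c cb k (fun k => msg C M k w)
          (fun t => output C p code t k w) Hs st t]%SET|%:R : R) <=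
   (\sum_(t < n) `[< bad_chan C nB t w >])%:R + (\sum_(t < n) `[< bad_noise C b t k w >])%:R.
  rewrite -natrD -big_split /= ler_nat -sum1_card big_mkcond /=.
  apply: leq_sum => t _; rewrite inE; case: ifP => // /andP[nj bad].
  case/orP: bad => [/asboolP nwc|cy].
    by rewrite (_ : `[< _ >] = true)//; apply/asboolP.
  rewrite (_ : `[< bad_noise C b t k w >] = true) ?addn1//.
  apply/asboolP; apply: contrapT => /normc_small => /(_ (ler0n _ _)).
  rewrite leNgt -cE => /negP; apply; move: cy.
  (* Receiver [k] is not jammed in this slot, and the prediction from the true messages is the
     transmitted input, so only the noise remains. *)
  rewrite (_ : output _ _ _ _ _ _ - _ = noise C t k w)//.
  rewrite /output input_clipped// (negbTE nj) mul0r addr0 addrAC.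
  rewrite [X in X - _ + _](_ : _ = \sum_l Hs t k l * clipped k0 p Hs st
     (data g cb (fun k1 => msg C M k1 w)) t l 0) ?subrr ?add0r//.
  by rewrite mxE; apply: eq_bigr => l _; rewrite /Hs mxE.
by move=> h; move: badH badN; move: h; lra.
Qed.

Lemma error_le k : error_prob C p code k <=
  fine (P (many_bad_chan C nB delta n)) + fine (P (many_bad_noise C b delta k n)) +
  \sum_s fine (P (rare_state C delta s n)).
Proof.
have mE := measurable_error C p code k.
have mF0 : measurable [set w | exists k, (M k <= msg C M k w)%N].
  rewrite (_ : [set _ | _] = ~` [set w | forall k, (msg C M k w < M k)%N]).
    apply: measurableC; apply: measurable_forall_fin => k'.
    apply: measurable_boolset; apply: measurable_fun_ltn; last exact: measurable_cst.
    exact: measurable_funPT.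
  apply/seteqP; split => w /=.
    by move=> [k' +] /(_ k'); rewrite leqNgt => /negP.
  move=> nall; apply: contrapT => nex; apply: nall => k'.
  by rewrite ltnNge; apply/negP => kM; apply: nex; exists k'.
have mF1 : measurable (many_bad_chan C nB delta n).
  by apply: count_measurable => t; exact: measurable_bad_chan.
have mF2 : measurable (many_bad_noise C b delta k n).
  apply: (@count_measurable _ _ _ (fun t => bad_noise C b t k)) => t.
  exact: measurable_bad_noise.
have mF3 s : measurable (rare_state C delta s n).
  by apply: (@count_measurable _ _ _ (off_state C s)) => t; exact: measurable_off_state.
have mF3' : measurable (\bigcup_(s in [set: state]) rare_state C delta s n).
  by apply: fin_bigcup_measurable => //; exact: finite_finset.
set F0 := [set w | exists k, _] in mF0.
have F00 : P F0 = 0%E by exact: (msg_bound C code).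
have sub : [set w | msg C M k w <> decoded C p code k w] `<=`
   F0 `|` (many_bad_chan C nB delta n `|` (many_bad_noise C b delta k n `|`
     \bigcup_(s in [set: state]) rare_state C delta s n)).
  move=> w err; apply: contrapT => /= out; apply: err; apply: success.
  - move=> k'; rewrite ltnNge; apply/negP => kM; apply: out; left; by exists k'.
  - by move=> ?; apply: out; right; left.
  - by move=> ?; apply: out; right; right; left.
  - by move=> s ?; apply: out; do 3 right; exists s.
have mU : measurable (F0 `|` (many_bad_chan C nB delta n `|` (many_bad_noise C b delta k n `|`
     \bigcup_(s in [set: state]) rare_state C delta s n))).
  by do 3 (apply: measurableU => //).
rewrite /error_prob -lee_fin fineK ?fin_num_measure// !EFinD.
rewrite -[X in (_ <= X + _ + _)%E]/(fine _)%:E.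
rewrite !fineK ?fin_num_measure// -sumEFin.
rewrite (eq_bigr (fun s => P (rare_state C delta s n))); last first.
  by move=> s _; rewrite fineK// fin_num_measure.
apply: le_trans (le_measure _ _ _ sub) _; rewrite ?inE//.
apply: le_trans (measureU2 _ _ _) _ => //; first by do 2 (apply: measurableU => //).
rewrite [X in (X + _)%E]F00 add0e.
apply: le_trans (measureU2 _ _ _) _ => //; first by apply: measurableU.
rewrite -addeA; apply: leeD2l.
apply: le_trans (measureU2 _ _ _) _ => //.
by apply: leeD2l; exact: probability_union_le.
Qed.

End error.

(** * Rates *)

Lemma sum_ord_lt l l' : (l <= l')%N -> (\sum_(i < l' | i < l) 1 = l)%N.
Proof.
move=> ll'; rewrite -(big_ord_widen l' (fun=> 1%N) ll').
by rewrite sum1_card card_ord.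
Qed.

Lemma card_pos K n N (k : 'I_K) :
  (forall s, k \in unjammed s -> (N s <= n)%N) ->
  #|{: pos n N k}| = (\sum_(s | k \in unjammed s) N s * (#|unjammed s|)`!)%N.
Proof.
move=> Nn; rewrite card_sig -sum1_card.
pose m (s : 'rV[bool]_K) := (#|unjammed s|)`!.
have mK s : (m s <= (K`!).+1)%N.
  rewrite (leq_trans _ (leqnSn _))//; apply: leq_fact.
  by rewrite -[X in (_ <= X)%N](card_ord K) max_card.
transitivity (\sum_(sb : 'rV[bool]_K * 'I_n.+1 | (k \in unjammed sb.1) && (sb.2 < N sb.1))
   \sum_(e < (K`!).+1 | e < m sb.1) 1)%N.
  rewrite pair_big_dep /=; apply: eq_bigl => -[[s b] e] /=.
  by rewrite [LHS]inE /valid_pos /= andbA.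
transitivity (\sum_(s | k \in unjammed s) \sum_(b < n.+1 | b < N s) m s)%N.
  rewrite [RHS]pair_big_dep /=; apply: eq_bigr => -[s b] _ /=.
  exact: sum_ord_lt.
apply: eq_bigr => s ks.
transitivity ((\sum_(b < n.+1 | b < N s) 1) * m s)%N.
  by rewrite big_distrl /=; apply: eq_bigr => b _; rewrite mul1n.
by rewrite sum_ord_lt// (leq_trans (Nn s ks)).
Qed.

Lemma truncn_exp_ge (R : realType) (y : R) : 1 <= y -> y / 2 <= (Num.truncn y)%:R.
Proof.
move=> y1; have := truncnS_gt y; rewrite -natr1.
have : 1 <= (Num.truncn y)%:R :> R by rewrite ler1n truncn_gt0.
lra.
Qed.

(** Rounding down loses at most a factor 2, that is [ln 2 / n%:R] in the rate. Cutting the codebooks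
    to this size gives them the prescribed rate as a limit, where the codebooks themselves are only
    bounded from below. *)
Lemma cvg_ln_truncn (R : realType) (r : R) : 0 <= r ->
  ln (Num.truncn (expR (r * n%:R)))%:R / n%:R @[n --> \oo] --> r.
Proof.
move=> r0; apply: (@squeeze_cvgr _ _ _ _ (fun n : nat => r - ln 2 / n%:R) (fun=> r)).
- near=> n.
  have n0 : 0 < n%:R :> R by rewrite ltr0n; near: n; exists 1%N.
  have e1 : 1 <= expR (r * n%:R) by rewrite -expR0 ler_expR mulr_ge0// ltW.
  have t0 : 0 < (Num.truncn (expR (r * n%:R)))%:R :> R by rewrite ltr0n truncn_gt0.
  rewrite ler_pdivrMr// -(ler_pM2r n0) mulrBl divfK ?gt_eqF// divfK ?gt_eqF//.
  apply/andP; split.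
    rewrite -[X in X - _](expRK (r * n%:R)) -ln_div ?posrE ?expR_gt0//.
    by rewrite ler_ln ?posrE ?divr_gt0 ?expR_gt0// truncn_exp_ge.
  rewrite -[leRHS](expRK (r * n%:R)) ler_ln ?posrE ?expR_gt0//.
  by rewrite truncn_le ltW// expR_gt0.
- rewrite -[X in _ --> X]subr0; apply: cvgB; first exact: cvg_cst.
  rewrite -[X in _ --> X](mulr0 (ln 2)); apply: cvgM; first exact: cvg_cst.
  apply/gtr0_cvgV0; last exact: cvgr_idn.
  by near=> n; rewrite ltr0n; near: n; exists 1%N.
- exact: cvg_cst.
Unshelve. all: by end_near. Qed.

Section block_counts.
Context (R : realType) (K : nat) d (T : measurableType d) (P : probability T R).
Variable C : jammed_bc K P.
Variable delta : R.
Local Notation state := 'rV[bool]_K.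
Hypothesis d0 : 0 < delta.

Definition harmonic_sum m : R := \sum_(1 <= i < m.+1) i%:R^-1.

(** In the slots of pattern [s] each of the m unjammed receivers obtains m! symbols per m! H_m
    slots, the count of [size_slots]. *)
Definition user_dof k : R :=
  \sum_(s : state | k \in unjammed s) state_prob C s / harmonic_sum #|unjammed s|.

Lemma harmonic_sum_ge1 m : (0 < m)%N -> 1 <= harmonic_sum m.
Proof.
move=> m0; rewrite /harmonic_sum big_ltn ?ltnS// invr1 lerDl.
by apply: sumr_ge0 => i _; rewrite invr_ge0.
Qed.

Lemma state_prob_ge0 s : 0 <= state_prob C s.
Proof. exact: fine_ge0. Qed.

Lemma measurable_state s : measurable (jam_state C 0 @^-1` [set s]).
Proof. exact: measurable_state_set1. Qed.

Lemma state_prob_le1 s : state_prob C s <= 1.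
Proof.
rewrite -lee_fin fineK ?fin_num_measure//; last exact: measurable_state.
by apply: probability_le1; exact: measurable_state.
Qed.

(* Twice the slots lost on average to bad channels, plus twice those lost to
   large noise. *)
Definition tolerance n := Num.truncn (4 * delta * n%:R).
(** Off the event [rare_state], the pattern [s] occurs more than [(state_prob C s - delta) * n%:R]
    times. The truncation of a negative number is 0, so a pattern rarer than [delta] gets no
    block. *)
Definition nblocks n s :=
  (Num.truncn ((state_prob C s - delta) * n%:R)%R %/ size (slots (unjammed s)))%N.

Lemma nblocks_le n s : (nblocks n s * size (slots (unjammed s)) <=
  Num.truncn ((state_prob C s - delta) * n%:R))%N.
Proof. exact: leq_trunc_div. Qed.

Lemma nblocks_le_n n s : (nblocks n s <= n)%N.
Proof.
apply: leq_trans (leq_div _ _) _; rewrite truncn_le_nat -natr1.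
have : (state_prob C s - delta) * n%:R <= 1 * n%:R.
  by rewrite ler_wpM2r// (le_trans _ (state_prob_le1 s))// lerBlDr lerDl ltW.
rewrite mul1r; lra.
Qed.

(** For each pattern the truncation loses less than one slot and the division less than one block,
    that is at most 1 and K! symbols. *)
Lemma card_pos_ge n k :
  n%:R * (user_dof k - #|{: state}|%:R * delta) - #|{: state}|%:R * (K`!%:R + 1) <=
  #|{: pos n (nblocks n) k}|%:R.
Proof.
rewrite card_pos; last by move=> s _; exact: nblocks_le_n.
rewrite natr_sum.
have term s : k \in unjammed s ->
   n%:R * (state_prob C s / harmonic_sum #|unjammed s| - delta) - (K`!%:R + 1) <=
   (nblocks n s * (#|unjammed s|)`!)%:R.
  move=> ks; set m := #|unjammed s|; set h := harmonic_sum m.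
  have m0 : (0 < m)%N by apply/card_gt0P; exists k.
  have h1 : 1 <= h by exact: harmonic_sum_ge1.
  have h0 : 0 < h by exact: lt_le_trans h1.
  have sE : (size (slots (unjammed s)))%:R = m`!%:R * h :> R by exact: size_slots.
  have f0 : 0 < m`!%:R :> R by rewrite ltr0n fact_gt0.
  have fK : m`!%:R <= K`!%:R :> R.
    by rewrite ler_nat leq_fact// -[X in (_ <= X)%N](card_ord K) max_card.
  set x := (state_prob C s - delta) * n%:R.
  have T0 : (0 < size (slots (unjammed s)))%N by rewrite -(ltr0n R) sE mulr_gt0.
  have tx : x < (Num.truncn x)%:R + 1 by rewrite natr1 truncnS_gt.
  have qx : (Num.truncn x)%:R < ((nblocks n s)%:R + 1) * (m`!%:R * h).
    by rewrite -sE natr1 -natrM ltr_nat ltn_ceil.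
  rewrite natrM.
  have : x / h <= ((nblocks n s)%:R + 1) * m`!%:R + 1 / h.
    by rewrite ler_pdivrMr// mulrDl divfK ?gt_eqF//; nra.
  have : 1 / h <= 1 by rewrite ler_pdivrMr// mul1r.
  have : n%:R * (state_prob C s / h - delta) <= x / h.
    rewrite /x ler_pdivlMr// -mulrA [leRHS]mulrC ler_wpM2l//.
    rewrite mulrBl divfK ?gt_eqF// lerB//.
    by rewrite -[leLHS]mulr1 ler_wpM2l// ltW.
  by lra.
apply: le_trans (ler_sum _ term).
rewrite sumrB -mulr_sumr sumrB -/(user_dof k).
have cle : (\sum_(s : state | k \in unjammed s) 1 : R) <= #|{: state}|%:R.
  by rewrite sumr_const ler_nat max_card.
have sumc (y : R) : \sum_(s : state | k \in unjammed s) y =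
    (\sum_(s : state | k \in unjammed s) 1) * y.
  by rewrite mulr_suml; apply: eq_bigr => s _; rewrite mul1r.
rewrite (sumc delta) (sumc (_ + _)).
have n0 : 0 <= n%:R :> R by [].
have K0 : 0 <= K`!%:R + 1 :> R by rewrite addr_ge0.
apply: lerB; last by rewrite ler_wpM2r.
by rewrite ler_wpM2l// lerB// ler_wpM2r// ltW.
Qed.

End block_counts.

Section rates.
Context (R : realType) (K : nat) (k0 : 'I_K) d (T : measurableType d)
  (P : probability T R).
Variable C : jammed_bc K P.
Variables (p g c : R) (nB q b : nat) (delta : R).
Local Notation state := 'rV[bool]_K.
Local Notation B := (nB%:R : R).
Hypotheses (p0 : 0 <= p) (d0 : 0 < delta)
  (bchan : forall t, (P (bad_chan C nB t) <= delta%:E)%E)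
  (bnoise : forall t k, (P (bad_noise C b t k) <= delta%:E)%E).
Hypotheses (B1 : 1 <= B) (cE : c = 2 * b%:R)
  (gapg : decoding_gap K (2 * c) B K < g).
Hypothesis power : K%:R * (2 * g * q%:R * (2 * K%:R * B) ^+ K) ^+ 2 <= p.

Local Notation letter := ('I_q.+1 * 'I_q.+1)%type.
Local Notation L := (ln (q.+1 * q.+1)%:R : R).
Local Notation E n := (tolerance delta n).
Local Notation N n := (nblocks C delta n).

(** In logarithms, the Gilbert-Varshamov bound loses [ln 2] for each coordinate and one full letter
    for each unit of distance. *)
Lemma gv_codebook n k : exists Cd : {set {ffun pos n (N n) k -> letter}},
  [/\ forall f f', f \in Cd -> f' \in Cd -> f != f' ->
        ((E n).*2 * (K`!).+1 < hamming f f')%N,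
      (0 < #|Cd|)%N &
      #|{: pos n (N n) k}|%:R * (L - ln 2) - ((E n).*2 * (K`!).+1)%:R * L <=
      ln #|Cd|%:R].
Proof.
have cQ : #|{: letter}| = (q.+1 * q.+1)%N by rewrite card_prod !card_ord.
have Q0 : (0 < #|{: letter}|)%N by rewrite cQ.
have [Cd [sep big]] := gilbert_varshamov (pos n (N n) k) ((E n).*2 * (K`!).+1) Q0.
exists Cd; have C0 : (0 < #|Cd|)%N.
  by rewrite lt0n; apply: contraTneq big => ->; rewrite mul0n -ltnNge expn_gt0 Q0.
split => //; move: big; rewrite cQ.
have Qp : 0 < (q.+1 * q.+1)%:R :> R by rewrite ltr0n.
have Cp : 0 < #|Cd|%:R :> R by rewrite ltr0n.
move: ((E n).*2 * _)%N #|{: pos n (N n) k}| => D Y.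
rewrite -(ler_nat R) [(_ * (_ * _))%:R]natrM [(2 ^ _ * _)%:R]natrM !natrX.
move: (q.+1 * q.+1)%:R #|Cd|%:R Qp Cp => Q M Qp Cp big.
have lnX (x : R) m : 0 < x -> ln (x ^+ m) = m%:R * ln x.
  by move=> x0; rewrite lnXn// mulr_natl.
have : ln (Q ^+ Y) <= ln (M * (2 ^+ Y * Q ^+ D)).
  by rewrite ler_ln// posrE ?mulr_gt0 ?exprn_gt0.
have e2 : 0 < 2 ^+ Y :> R by rewrite exprn_gt0.
have eQ : 0 < Q ^+ D by rewrite exprn_gt0.
rewrite lnM ?posrE ?mulr_gt0// (lnM e2 eQ) !lnX//.
by lra.
Qed.

Local Notation S0 := (#|{: state}|%:R : R).
Local Notation K1 := (K`!%:R + 1 : R).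

(** The factor 8 is twice the 4 of [tolerance], because two explanations may each have that many bad
    slots. The loss from incomplete blocks does not grow with [n] and is absorbed by the strict
    inequality on [r]. *)
Lemma codebook_size_eventually k (r : R) (Cd : forall n, {set {ffun pos n (N n) k -> letter}}) :
  (forall n, #|{: pos n (N n) k}|%:R * (L - ln 2) -
     ((E n).*2 * (K`!).+1)%:R * L <= ln #|Cd n|%:R) ->
  (forall n, (0 < #|Cd n|)%N) -> ln 2 <= L ->
  r < (user_dof C k - S0 * delta) * (L - ln 2) - 8 * delta * K1 * L ->
  \forall n \near \oo, expR (r * n%:R) <= #|Cd n|%:R.
Proof.
move=> size_ge Cd0 L2 rA.
set A := (X in r < X) in rA.
have Ar : 0 < A - r by rewrite subr_gt0.
near=> n.
have n0 : 0 <= n%:R :> R by [].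
have Cp : 0 < #|Cd n|%:R :> R by rewrite ltr0n.
rewrite -[leRHS]lnK ?posrE// ler_expR; apply: le_trans (size_ge n).
have nbig : S0 * K1 * (L - ln 2) / (A - r) <= n%:R.
  by near: n; exact: nbhs_infty_ger.
rewrite ler_pdivrMr// in nbig.
have L0 : 0 <= L by rewrite (le_trans _ L2)// ln_ge0// ler1n.
have Ele : ((E n).*2 * (K`!).+1)%:R * L <= 8 * delta * n%:R * K1 * L.
  rewrite ler_wpM2r// natrM -[(K`!).+1%:R]natr1 ler_wpM2r ?addr_ge0//.
  rewrite -muln2 natrM.
  have : (E n)%:R <= 4 * delta * n%:R by rewrite /tolerance truncn_le !mulr_ge0// ltW.
  lra.
have Xge : (n%:R * (user_dof C k - S0 * delta) - S0 * K1) * (L - ln 2) <=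
    #|{: pos n (N n) k}|%:R * (L - ln 2).
  by rewrite ler_wpM2r ?subr_ge0// card_pos_ge.
apply: le_trans (lerB Xge Ele).
rewrite /A in nbig *; nra.
Unshelve. all: by end_near. Qed.

(** Rate 0 is a separate case, met with a single message, because for a small power or a user with
    few degrees of freedom the bound on [r k] may be negative. *)
Lemma achievable_rate (r : 'I_K -> R) :
  (forall k, r k = 0 \/ [/\ 0 <= r k, ln 2 <= L &
     r k < (user_dof C k - S0 * delta) * (L - ln 2) - 8 * delta * K1 * L]) ->
  achievable_DP C p r.
Proof.
move=> hr.
have r0 k : 0 <= r k by case: (hr k) => [->|[]].
have [Cd CdP] : exists Cd : forall n k, {set {ffun pos n (N n) k -> letter}},
    forall n k, [/\ forall f f', f \in Cd n k -> f' \in Cd n k -> f != f' ->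
        ((E n).*2 * (K`!).+1 < hamming f f')%N,
      (0 < #|Cd n k|)%N &
      #|{: pos n (N n) k}|%:R * (L - ln 2) - ((E n).*2 * (K`!).+1)%:R * L <=
      ln #|Cd n k|%:R].
  exists (fun n k => sval (cid (gv_codebook n k))) => n k.
  exact: svalP (cid (gv_codebook n k)).
have Cd0 n k : (0 < #|Cd n k|)%N by have [] := CdP n k.
(* The codebook size caps the number of messages only for small [n]; the minimum makes the code well
   defined for every length. *)
pose M n k := minn (Num.truncn (expR (r k * n%:R))) #|Cd n k|.
pose cb n k (mu : nat) := nth [ffun=> (ord0, ord0)] (enum (Cd n k)) mu.
have M0 n k : (0 < M n k)%N.
  by rewrite leq_min Cd0 truncn_gt0 -expR0 ler_expR mulr_ge0.
have sep n k m m' : (m < M n k)%N -> (m' < M n k)%N -> m != m' ->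
    ((E n).*2 * (K`!).+1 < hamming (cb n k m) (cb n k m'))%N.
  rewrite /M !leq_min => /andP[_ mC] /andP[_ m'C] mm'.
  rewrite cardE in mC; rewrite cardE in m'C.
  have [Cdsep _ _] := CdP n k; apply: Cdsep.
  - by rewrite /cb -mem_enum mem_nth.
  - by rewrite /cb -mem_enum mem_nth.
  - by rewrite /cb nth_uniq ?enum_uniq.
exists (fun n => mat_code k0 p g B c (E n) (cb n) (M0 n)); split.
- by move=> n; exact: code_power.
- move=> k; rewrite /=.
  apply: cvg_trans (cvg_ln_truncn (r0 k)); apply: near_eq_cvg.
  near=> n; rewrite /M (minn_idPl _)//.
  rewrite -(ler_nat R); apply: (@le_trans _ _ (expR (r k * n%:R))).
    by rewrite truncn_le expR_ge0.
  near: n; have [rk|[_ L2 rA]] := hr k.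
    by apply: nearW => n'; rewrite rk mul0r expR0 ler1n.
  apply: codebook_size_eventually rA => // n'.
  by have [_ _] := CdP n' k.
move=> k; apply: (@squeeze_cvgr _ _ _ _ (fun=> 0) (fun n =>
  fine (P (many_bad_chan C nB delta n)) + fine (P (many_bad_noise C b delta k n)) +
  \sum_s fine (P (rare_state C delta s n)))).
- near=> n; apply/andP; split; first exact: fine_ge0.
  apply: (@error_le R K k0 d T P C p g c nB q b n delta d0 B1 cE gapg power
    (N n) (M n) (cb n) (M0 n) (@sep n)) => s.
  exact: nblocks_le.
- exact: cvg_cst.
rewrite -[X in _ --> X]addr0; apply: cvgD.
  rewrite -[X in _ --> X]addr0; apply: cvgD.
    exact: many_bad_chan_cvg.
  exact: many_bad_noise_cvg.
pose f s n := fine (P (rare_state C delta s n)).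
suff sumcvg (l : seq state) : (fun n => \sum_(s <- l) f s n) @ \oo --> (0 : R).
  exact: sumcvg.
elim: l => [|s l IH].
  rewrite (_ : (fun n => _) = (fun=> 0)); first exact: cvg_cst.
  by apply/funext => n; rewrite big_nil.
rewrite (_ : (fun n => _) = (fun n => f s n + \sum_(s <- l) f s n)); last first.
  by apply/funext => n; rewrite big_cons.
rewrite -[X in _ --> X]addr0; apply: cvgD; last exact: IH.
exact: rare_state_cvg.
Unshelve. all: by end_near. Qed.

End rates.

(** * The sum over the users *)

Section sum_dof.
Context (R : realType) (K : nat) d (T : measurableType d) (P : probability T R).
Variable C : jammed_bc K P.
Local Notation state := 'rV[bool]_K.

Lemma prob_in_seq (I : eqType) (X : T -> I) (s : seq I) : uniq s ->
  (forall i, measurable [set w | X w = i]) ->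
  measurable [set w | X w \in s] /\
  fine (P [set w | X w \in s]) = \sum_(i <- s) fine (P [set w | X w = i]).
Proof.
move=> + mX; elim: s => [_|i s IH /= /andP[is_ us]].
  rewrite big_nil (_ : [set _ | _] = set0); first by rewrite measure0.
  by apply/seteqP; split.
have [ms Es] := IH us.
have E : [set w | X w \in i :: s] = [set w | X w = i] `|` [set w | X w \in s].
  apply/seteqP; split => w /=; rewrite inE; first by move=> /orP[/eqP|]; [left|right].
  by move=> [->|->]; rewrite ?eqxx ?orbT.
rewrite E; split; first exact: measurableU.
rewrite measureU//; last first.
  by apply/seteqP; split => // w /= [->]; rewrite (negbTE is_).
by rewrite fineD ?fin_num_measure// Es big_cons.
Qed.

Lemma card_unjammed (s : state) : (#|unjammed s| = K - \sum_(k < K) s 0%R k)%N.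
Proof.
have -> : (\sum_(k < K) s 0%R k = #|~: unjammed s|)%N.
  rewrite -sum1_card [RHS]big_mkcond /=; apply: eq_bigr => k _.
  by rewrite !inE negbK; case: (s 0 k).
by apply/esym/eqP; rewrite -(eqn_add2r #|~: unjammed s|) subnK ?cardsC ?card_ord//
  -[X in (_ <= X)%N](card_ord K) max_card.
Qed.

(** Exchanging the sums, a pattern with m unjammed receivers is counted m times with weight 1/H_m,
    which is [DoF_MAT R m]; the patterns are then grouped by the number of jammed receivers. *)
Lemma sum_user_dof : \sum_(k < K) user_dof C k =
  \sum_(j < K.+1) num_jammed_prob C j * DoF_MAT R (K - j).
Proof.
have jK (s : state) : (\sum_(k < K) s 0%R k < K.+1)%N.
  rewrite ltnS -[X in (_ <= X)%N](card_ord K) -sum1_card leq_sum// => k _.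
  exact: leq_b1.
have jE j : num_jammed_prob C j =
    \sum_(s : state | (\sum_(k < K) s 0%R k)%N == j) state_prob C s.
  rewrite /num_jammed_prob.
  have := @prob_in_seq _ (jam_state C 0)
    [seq s : state <- index_enum state | (\sum_(k < K) s 0%R k)%N == j].
  rewrite filter_uniq ?index_enum_uniq// => /(_ isT (measurable_state_set1 C 0))[_].
  rewrite big_filter /state_prob => <-; congr (fine (P _)).
  by apply/seteqP; split => w /=; rewrite mem_filter mem_index_enum andbT; move/eqP.
transitivity (\sum_(s : state) state_prob C s * DoF_MAT R #|unjammed s|).
  rewrite (exchange_big_dep xpredT)//=; apply: eq_bigr => s _.
  rewrite sumr_const -mulr_natl; case: #|unjammed s| => [|m]; first by rewrite mul0r /= mulr0.
  by rewrite /DoF_MAT -/(harmonic_sum R m.+1); ring.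
rewrite (partition_big (fun s => Ordinal (jK s)) xpredT)//=.
apply: eq_bigr => j _; rewrite jE mulr_suml.
by apply: eq_big => [s|s /eqP <-]; rewrite ?card_unjammed.
Qed.

End sum_dof.

(** * Letting the power grow *)

Section asymptotics.
Context (R : realType) (K : nat) (k0 : 'I_K) d (T : measurableType d)
  (P : probability T R).
Variable C : jammed_bc K P.
Local Notation state := 'rV[bool]_K.

Lemma ln_ge_near (y : R) : \forall p \near +oo, y <= ln p.
Proof.
near=> p.
have p0 : 0 < p by near: p; exact: nbhs_pinfty_gt.
have yp : expR y <= p by near: p; exact: nbhs_pinfty_ge.
by rewrite -[leLHS]expRK ler_ln ?posrE ?expR_gt0.
Unshelve. all: by end_near. Qed.

(** The maximum with 0 covers the users with fewer than [eta] degrees of freedom. *)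
Definition target_rate (eta p : R) (k : 'I_K) : R :=
  Num.max 0 ((user_dof C k - eta) * ln p).

Lemma user_dof_ge0 k : 0 <= user_dof C k.
Proof.
apply: sumr_ge0 => s ks; rewrite divr_ge0 ?state_prob_ge0//.
by apply: sumr_ge0 => i _; rewrite invr_ge0.
Qed.

Lemma target_rate_achievable (eta : R) : 0 < eta ->
  (forall p, 0 < p -> achievable_DP C p (fun=> 0)) /\
  \forall p \near +oo, achievable_DP C p (target_rate eta p).
Proof.
move=> eta0.
pose S0 : R := #|{: state}|%:R; pose K1 : R := K`!%:R + 1.
have S00 : 0 <= S0 by [].
have K10 : 0 < K1 by rewrite ltr_wpDl.
(* Chosen so that the losses proportional to [ln p] add up to [eta / 2]; the other half of [eta]
   absorbs the losses that stay bounded as [p] grows. *)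
pose delta := eta / 2 / (S0 + 8 * K1).
have SK0 : 0 < S0 + 8 * K1 by rewrite ltr_wpDl// mulr_gt0.
have d0 : 0 < delta by rewrite !divr_gt0.
have [nB0 badB0] := bad_channel_prob (@chan_indep _ _ _ _ _ C)
  (@chan_ident _ _ _ _ _ C) (@chan_density _ _ _ _ _ C) d0.
pose nB := nB0.+1.
have bchan t : (P (bad_chan C nB t) <= delta%:E)%E.
  apply: le_trans (badB0 t); apply: le_measure; rewrite ?inE.
  - exact: measurable_bad_chan.
  - exact: (measurable_bad_chan C nB0 t).
  move=> w /= nwc wc; apply: nwc; apply: well_conditioned_le wc.
  by rewrite ler_nat.
have [b bnoise] := noise_tail C d0.
pose B : R := nB%:R.
have B1 : 1 <= B by rewrite ler1n.
pose c : R := 2 * b%:R.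
have c20 : 0 <= 2 * c by rewrite !mulr_ge0.
pose g : R := decoding_gap K (2 * c) B K + 1.
have gapg : decoding_gap K (2 * c) B K < g by rewrite ltrDl.
have g0 : 0 < g by rewrite ltr_wpDl// decoding_gap_ge0// (le_trans _ B1).
have KR1 : 1 <= K%:R :> R by rewrite ler1n (leq_ltn_trans _ (ltn_ord k0)).
pose X : R := (2 * K%:R * B) ^+ K.
have X0 : 0 < X by rewrite exprn_gt0// !mulr_gt0// (lt_le_trans _ B1, lt_le_trans _ KR1).
(* With about sqrt(p) / kappa values per real coordinate the power bound of [scheme_power] stays
   below [p], and the number of grid points is of order [p]. *)
pose kappa : R := K%:R * (2 * g * X).
have kappa0 : 0 < kappa by rewrite !mulr_gt0// (lt_le_trans _ KR1).
pose q (p : R) := Num.truncn (Num.sqrt p / kappa).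
have power p : 0 < p -> K%:R * (2 * g * (q p)%:R * X) ^+ 2 <= p.
  move=> p0.
  have qle : (q p)%:R * kappa <= Num.sqrt p.
    by rewrite -ler_pdivlMr// truncn_le divr_ge0// ltW.
  apply: (@le_trans _ _ (((q p)%:R * kappa) ^+ 2)); last first.
    rewrite -[leRHS](sqr_sqrtr (ltW p0)) lerXn2r// nnegrE ?sqrtr_ge0//.
    by rewrite mulr_ge0// ltW.
  rewrite /kappa [leRHS](_ : _ = K%:R * (K%:R * (2 * g * (q p)%:R * X) ^+ 2)); last by ring.
  by rewrite ler_wpM2l// ler_peMl// sqr_ge0.
split=> [p p0|].
  apply: (achievable_rate k0 (ltW p0) d0 bchan bnoise B1 (erefl c) gapg (power _ p0)).
  by move=> k; left.
(* A common bound for all users, so that one threshold on [p] serves every [k]. *)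
pose Dm : R := \sum_k user_dof C k.
pose l (p : R) := ln p - 2 * ln kappa.
have Lge p : 0 < p -> l p <= ln ((q p).+1 * (q p).+1)%:R.
  move=> p0; rewrite natrM lnM ?posrE ?ltr0n//.
  have sp : 0 < Num.sqrt p by rewrite sqrtr_gt0.
  have : ln (Num.sqrt p / kappa) <= ln (q p).+1%:R.
    by rewrite ler_ln ?posrE ?divr_gt0 ?ltr0n// ltW// truncnS_gt.
  rewrite ln_div ?posrE//.
  have : ln p = 2 * ln (Num.sqrt p).
    by rewrite -[p in LHS](sqr_sqrtr (ltW p0)) lnXn// mulr_natl.
  rewrite /l; lra.
near=> p.
have p0 : 0 < p by near: p; exact: nbhs_pinfty_gt.
apply: (achievable_rate k0 (ltW p0) d0 bchan bnoise B1 (erefl c) gapg (power _ p0)).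
move=> k; rewrite /target_rate.
have [neg|pos] := leP ((user_dof C k - eta) * ln p) 0; first by left.
right; rewrite -/S0 -/K1; split; first exact: ltW.
  apply: le_trans (Lge p p0); rewrite /l lerBrDr.
  near: p; apply: ln_ge_near.
have Lp := Lge p p0; set L := ln _ in Lp *.
have D0 := user_dof_ge0 k.
set D := user_dof C k in D0 pos *.
have lnp0 : 0 < ln p by near: p; apply: filterS (ln_ge_near 1) => x; exact: lt_le_trans.
have Deta : eta < D by move: pos; rewrite pmulr_lgt0// subr_gt0.
have deltaE : S0 * delta + 8 * delta * K1 = eta / 2.
  by rewrite /delta; field; rewrite gt_eqF.
have big : 2 * (Dm * `|2 * ln kappa| + Dm * ln 2 + 1) / eta <= ln p.
  by near: p; exact: ln_ge_near.
rewrite ler_pdivrMr// in big.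
have ln20 : 0 <= ln 2 :> R by rewrite ln_ge0// ler1n.
have DDm : D <= Dm.
  by rewrite /Dm (bigD1 k)//= lerDl sumr_ge0// => k' _; exact: user_dof_ge0.
have Dk : D * `|2 * ln kappa| <= Dm * `|2 * ln kappa| by rewrite ler_wpM2r.
have Dl : D * ln 2 <= Dm * ln 2 by rewrite ler_wpM2r.
have kle : 2 * ln kappa <= `|2 * ln kappa| by exact: ler_norm.
have kge : - (2 * ln kappa) <= `|2 * ln kappa| by rewrite -normrN ler_norm.
have : (D - eta / 2) * l p <= (D - eta / 2) * L.
  by rewrite ler_wpM2l//; lra.
have Sd : 0 <= S0 * delta by rewrite mulr_ge0// ltW.
have : S0 * delta * ln 2 >= 0 by rewrite mulr_ge0.
rewrite /l.
have : (D - eta / 2) * (2 * ln kappa) <= D * `|2 * ln kappa|.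
  by apply: (@le_trans _ _ ((D - eta / 2) * `|2 * ln kappa|)); [rewrite ler_wpM2l//; lra|
     rewrite ler_wpM2r//; lra].
have -> : (D - S0 * delta) * (L - ln 2) - 8 * delta * K1 * L =
   (D - (S0 * delta + 8 * delta * K1)) * L - D * ln 2 + S0 * delta * ln 2 by ring.
rewrite deltaE.
lra.
Unshelve. all: by end_near. Qed.

(** Takes the smallest achievable value among the 1/(m+1) with m ≤ N. If none is achievable, the
    fallback is the sum of all [user_dof], for which the target rates are 0. *)
Lemma best_target p N : 1 <= p ->
  exists eta : R, [/\ 0 <= eta, achievable_DP C p (target_rate eta p) &
    forall m, (m <= N)%N -> achievable_DP C p (target_rate m.+1%:R^-1 p) ->
      eta <= m.+1%:R^-1].
Proof.
move=> p1; have p0 : 0 < p by exact: lt_le_trans p1.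
have zero : exists eta : R, 0 <= eta /\ achievable_DP C p (target_rate eta p).
  exists (\sum_k user_dof C k); split; first by apply: sumr_ge0 => k _; exact: user_dof_ge0.
  have [z _] := target_rate_achievable ltr01.
  rewrite (_ : target_rate _ p = fun=> 0); first exact: z.
  apply/funext => k; apply/max_idPl; rewrite mulr_le0_ge0 ?ln_ge0//.
  rewrite subr_le0 (bigD1 k)//= lerDl sumr_ge0// => k' _; exact: user_dof_ge0.
have step n eta0 : (forall m, (m < n)%N -> achievable_DP C p (target_rate m.+1%:R^-1 p) ->
      eta0 <= m.+1%:R^-1) -> 0 <= eta0 -> achievable_DP C p (target_rate eta0 p) ->
   exists eta : R, [/\ 0 <= eta, achievable_DP C p (target_rate eta p) &
    forall m, (m < n.+1)%N -> achievable_DP C p (target_rate m.+1%:R^-1 p) ->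
      eta <= m.+1%:R^-1].
  move=> le e0 ach.
  have [yes|no] := pselect (achievable_DP C p (target_rate n.+1%:R^-1 p)).
    exists n.+1%:R^-1; split => // m mn _.
    by rewrite lef_pV2 ?posrE ?ltr0n// ler_nat.
  exists eta0; split => // m; rewrite ltnS leq_eqVlt => /orP[/eqP -> /no//|].
  exact: le.
elim: N => [|N [eta [e0 ach le]]].
  have [eta0 [e0 ach]] := zero.
  by have [//|eta [? ? le]] := step 0%N eta0 _ e0 ach; exists eta.
by have [//|eta' [? ? le']] := step N.+1 eta _ e0 ach; exists eta'.
Qed.

(** For each m the value 1/(m+1) is achievable from some unknown power on, and it is among the
    values compared as soon as p ≥ m. The best choice at power [p] is then at most 1/(m+1), so it
    tends to 0. *)
Lemma user_dof_achievable : DoF_region_DP C (user_dof C).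
Proof.
have /choice[eta etaP] (p : R) : exists eta : R, 1 <= p ->
    [/\ 0 <= eta, achievable_DP C p (target_rate eta p) &
    forall m, (m <= Num.truncn p)%N -> achievable_DP C p (target_rate m.+1%:R^-1 p) ->
      eta <= m.+1%:R^-1].
  have [p1|np1] := pselect (1 <= p); last by exists 0 => /np1.
  by have [e h] := best_target (Num.truncn p) p1; exists e.
exists (fun p => if 1 <= p then target_rate (eta p) p else fun=> 0); split => [p p0|k].
  case: ifP => [p1|_]; first by have [] := etaP p p1.
  by have [z _] := target_rate_achievable ltr01; exact: z.
apply/cvgrPdist_le => e e0.
have [m me] : exists m : nat, m.+1%:R^-1 <= e.
  exists (Num.truncn e^-1); rewrite -[leRHS]invrK lef_pV2 ?posrE ?invr_gt0//.
  by rewrite ltW// truncnS_gt.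
have m0 : 0 < (m.+1%:R^-1 : R) by rewrite invr_gt0.
have [_ ach] := target_rate_achievable m0.
near=> p.
have p1 : 1 <= p by near: p; exact: nbhs_pinfty_ge.
have lp0 : 0 < ln p.
  by near: p; apply: filterS (ln_ge_near 1) => x; exact: lt_le_trans.
have mp : (m <= Num.truncn p)%N.
  have mR : m%:R <= p by near: p; exact: nbhs_pinfty_ge.
  by rewrite truncn_ge_nat// (le_trans ler01).
have [eta_ge0 _ /(_ m mp) eta_le] := etaP p p1.
have {}eta_le : eta p <= e by apply: le_trans me; apply: eta_le; near: p.
rewrite p1 /target_rate maxr_pMl ?invr_ge0 ?(ltW lp0)// mul0r mulfK ?gt_eqF//.
have D0 := user_dof_ge0 k.
by rewrite ler_norml; have [h|h] := leP 0 (user_dof C k - eta p); lra.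
Unshelve. all: by end_near. Qed.

End asymptotics.

Theorem theorem10 (R : realType) (K : nat) (d : measure_display)
    (T : measurableType d) (P : probability T R) (C : jammed_bc K P)
    (K_gt0 : (0 < K)%N) (C_sym : symmetric_jammer C) :
  exists2 dof : 'I_K -> R, DoF_region_DP C dof &
    \sum_(k < K) dof k =
    \sum_(j < K.+1) num_jammed_prob C j * DoF_MAT R (K - j).
Proof.
exists (user_dof C); last exact: sum_user_dof.
exact: (user_dof_achievable (Ordinal K_gt0)).
Qed.
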